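(* Let $n\geqslant 2$ and let $$PA_{n,1}= \Delta_{[n+1]}+\sum_{\beta\in \mathcal{A}_1} \Delta_{\bigcup\beta}+ \sum_{\beta\in \mathcal{A}_2} N_\beta \subseteq \mathbf{R}^{n+1}.$$ Then $PA_{n,1}$ is an $n$-dimensional Minkowski-realisation of the simplicial complex $C$. Moreover, $PA_{n,1}\simeq \mathbf{PA}_n$ (normal equivalence).
   Context: **Polytopes.** A polytope is the convex hull of a finite nonempty set of points; $\mathcal{M}_N$ is the collection of all polytopes in $\mathbf{R}^N$; $\mathcal{V}(P)$ is the vertex set of $P$; $[k]=\{1,\dots,k\}$; $\subset$ is proper inclusion. Sums of polytopes are Minkowski sums. $\Delta_I=conv\{e_i\mid i\in I\}\subseteq\mathbf{R}^{n+1}$ for $\emptyset\neq I\subseteq[n+1]$, with $e_i$ the standard basis vectors. For a hyperplane $\pi$ given by an equation, $\pi^{\geqslant}$ (resp. $\pi^{>}$) is the set obtained by replacing $=$ by $\geqslant$ (resp. $>$). A truncation $\mathrm{tr}_FP$ of $P$ in a proper nonempty face $F$ that is not a facet is a polytope $P\cap\pi^{\geqslant}$ such that every vertex of $P$ not in $F$ lies in $\pi^{>}$ and no vertex of $F$ lies in $\pi^{\geqslant}$. The normal cone of $P\in\mathcal{M}_N$ at a nonempty face $F$ is $N_F(P)=\{v\in\mathbf{R}^N\mid \langle v,y\rangle=\max_{z\in P}\langle v,z\rangle\ \forall y\in F\}$; the normal fan is $\mathcal{N}(P)=\{N_F(P)\mid F\text{ a nonempty face of }P\}$; $P\simeq Q$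 (normally equivalent) means $\mathcal{N}(P)=\mathcal{N}(Q)$. **Truncators.** $P_2$ is a truncator summand for $P_1$ if there is a truncation $\mathrm{tr}_FP_1$ of $P_1$ in a proper face $F$ with $P_1+P_2\simeq \mathrm{tr}_FP_1$. An indexed set $\{P_i\}_{i\in[m]}$ is a truncator set of summands for $S_0$ if for every $i\in[m]$, $P_i$ is a truncator summand for $S_{i-1}$, where $S_i=S_{i-1}+P_i$. **Building sets, nested sets.** A building set of $\mathcal{P}(V)$ ($V$ finite) is a collection of nonempty subsets of $V$ containing all singletons and closed under unions of pairs of intersecting members. A building set of a simplicial complex $K$ (which contains $\emptyset$) is a collection $\mathcal{B}$ of simplices of $K$ such that $\mathcal{B}\cap\mathcal{P}(V_i)$ is a building set of $\mathcal{P}(V_i)$ for every maximal simplex $V_i$ of $K$. For a family $N$ of sets, an $N$-antichain is a subset $\{X_1,\dots,X_m\}\subseteq N$, $m\geqslant2$, of mutually incomparable (for inclusion) sets. $N\subseteq\mathcal{B}$ is nested with respect to $\mathcal{B}$ if the union of every $N$-antichain is an element of $K-\mathcal{B}$. Nested sets form a simplicial complex. A polytope $P$ realises a simplicial complex $K$ if its face lattice with the empty face removed is isomorphic to $(K,\supseteq)$. **The complex $C$.** $C_0=\mathcal{P}([n+1])-\{[n+1]\}$; $\mathcal{B}_0=C_0-\{\emptyset\}$; $C_1$ is the complex of all nested sets with respect to the building set $\mathcal{B}_0$ of $C_0$. $\mathcal{B}_1\subseteq C_1$ is the family of all sets $$\beta=\bigl\{\{i_{k+l},\ldots,i_k,\ldots,i_1\},\ldots,\{i_{k+l},\ldots,i_k,i_{k-1}\},\{i_{k+l},\ldots,i_k\}\bigr\},\qquad(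 * )$$ where $1\leqslant k\leqslant k+l\leqslant n$ and $i_1,\dots,i_{k+l}$ are distinct elements of $[n+1]$ (so $|\beta|=k$). It is a building set of $C_1$, and $C$ is the complex of all nested sets with respect to $\mathcal{B}_1$. $\mathcal{A}_1$ is the set of one-element members of $\mathcal{B}_1$ and $\mathcal{A}_2=\mathcal{B}_1-\mathcal{A}_1$. **Minkowski-realisation.** Let $K$ be the complex of all nested sets with respect to a building set $\mathcal{B}$, and let $\{\mathcal{A}_1,\mathcal{A}_2\}$ be the partition of $\mathcal{B}$ with $\mathcal{A}_1$ the collection of singleton elements. An $n$-polytope $P\subseteq \mathbf{R}^{n+1}$ is an $n$-dimensional Minkowski-realisation of $K$ if: (i) $P$ realises $K$; (ii) there is a function $\varphi:\mathcal{B}\to\mathcal{M}_{n+1}$ with $P=\Delta_{[n+1]}+\sum_{\beta\in\mathcal{B}}\varphi(\beta)$; (iii) for every bijective indexing $x:[m]\to\mathcal{A}_2$ such that $|x(i)|\geqslant|x(j)|$ for all $i<j$, the indexed set $\{\varphi(x(i))\}_{i\in[m]}$ is a truncator set of summands for $\Delta_{[n+1]}+\sum_{\beta\in\mathcal{A}_1}\varphi(\beta)$. **The polytopes $N_\beta$.** For $\beta\in\mathcal{A}_2$ as in $( * )$ (so $k>1$), let $\beta_{min}=\{i_{k+l},\ldots,i_k\}$, $\beta_{max}=\{i_{k+l},\ldots,i_1\}$ and $$\mathcal{B}_\beta=\{\emptyset\ne B\subseteq[n+1]\mid B\in\beta\text{ or }B\subset\beta_{min}\text{ or }\beta_{max}\subset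 B\}\cup\{\{v\}\mid v\in[n+1]\},$$ $P_{\mathcal{B}_\beta}=\sum_{B\in\mathcal{B}_\beta}\Delta_B$. For $A\in\mathcal{B}_\beta-\{[n+1]\}$, $f_A$ is the facet of $P_{\mathcal{B}_\beta}$ lying in the hyperplane $\sum_{i\in A}x_i=|\{B\in\mathcal{B}_\beta\mid B\subseteq A\}|$. $F_\beta=\bigcap_{B\in\beta}f_B$, and $N_\beta=conv(\mathcal{V}(P_{\mathcal{B}_\beta})-\mathcal{V}(F_\beta))$. **The polytope $\mathbf{PA}_n$.** For $1\leqslant k\leqslant k+l\leqslant n$ let $\kappa(k,l)=\frac{3^{k+l+1}-3^{l+1}}{2}+\frac{3^k-3k}{3^n-n-1}$. For $\beta\in\mathcal{B}_1$ as in $( * )$, $\pi_\beta$ is the hyperplane $x_{i_1}+2x_{i_2}+\ldots+k(x_{i_k}+\ldots+x_{i_{k+l}})=\kappa(k,l)$ in $\mathbf{R}^{n+1}$. With $\pi$ the hyperplane $x_1+\ldots+x_{n+1}=3^{n+1}$, $\mathbf{PA}_n=\bigl(\bigcap_{\beta\in\mathcal{B}_1}\pi_\beta^{\geqslant}\bigr)\cap\pi$. *)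

(* Defs.v *)
From HB Require Import structures.
From mathcomp Require Import all_boot all_order all_algebra.

Set Implicit Arguments.
Unset Strict Implicit.
Unset Printing Implicit Defensive.

Import Order.TTheory GRing.Theory Num.Theory.

Section Complexes.
Variable V : finType.
Implicit Types (K B N A : {set {set V}}) (W : {set V}).

Definition simplicial_complex K : Prop :=
  set0 \in K /\ forall X Y : {set V}, X \in K -> Y \subset X -> Y \in K.

Definition power_building_set W B : Prop :=
  [/\ forall X : {set V}, X \in B -> X != set0 /\ X \subset W,
      forall v, v \in W -> [set v] \in B
    & forall X Y : {set V}, X \in B -> Y \in B -> X :&: Y != set0 ->
        X :|: Y \in B].

Definition building_set K B : Prop :=
  [/\ simplicial_complex K, B \subset K
    & forall W, maxset [pred X in K] W -> power_building_set W (B :&: powerset W)].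

Definition antichain A : bool :=
  (1 < #|A|) &&
  [forall X in A, forall Y in A, (X != Y) ==> ~~ (X \subset Y)].

Definition nested K B N : bool :=
  (N \subset B) &&
  [forall A : {set {set V}}, (A \subset N) && antichain A ==>
     (cover A \in K :\: B)].

Definition nested_complex K B : {set {set {set V}}} :=
  [set N | nested K B N].

Definition singletons_of B : {set {set V}} := [set b in B | #|b| == 1].

End Complexes.

(* The set [n+1] is represented by 'I_n.+1. *)
Section ComplexC.
Variable n : nat.
Local Notation I := 'I_n.+1.

Definition C0 : {set {set I}} := [set: {set I}] :\ [set: I].
Definition B0 : {set {set I}} := C0 :\ set0.
Definition C1 : {set {set {set I}}} := nested_complex C0 B0.

(* With s = [:: i_1; ...; i_(k+l)], this is the family of the k sets
   {i_(k+l), ..., i_j}, 1 <= j <= k. *)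
Definition star (k : nat) (s : seq I) : {set {set I}} :=
  [set [set x in drop j s] | j : 'I_k].

Definition B1 : {set {set {set I}}} :=
  [set b | [exists k : I, exists l : I, exists s : (k + l).-tuple I,
     [&& 0 < k, k + l <= n, uniq s & b == star k s]]].

Definition C : {set {set {set {set I}}}} := nested_complex C1 B1.
Definition A1 : {set {set {set I}}} := singletons_of B1.
Definition A2 : {set {set {set I}}} := B1 :\: A1.

(* The members of B1 are chains: see star_minE and star_maxE. *)
Definition star_min (b : {set {set I}}) : {set I} := \bigcap_(A in b) A.
Definition star_max (b : {set {set I}}) : {set I} := cover b.

Lemma star_minE k (s : seq I) :
  0 < k -> star_min (star k s) = [set x in drop k.-1 s].
Proof.
case: k => // k _; apply/setP=> x; rewrite inE.
apply/bigcapP/idP => [h|xs A].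
  suff /h : [set x in drop k s] \in star k.+1 s by rewrite inE.
  by apply/imsetP; exists ord_max.
case/imsetP=> j _ ->; rewrite inE; move: xs.
by rewrite /= -{1}(subnK (leq_ord j)) -drop_drop => /mem_drop.
Qed.

Lemma star_maxE k (s : seq I) :
  0 < k -> star_max (star k s) = [set x in s].
Proof.
case: k => // k _; apply/setP=> x; rewrite inE; apply/bigcupP/idP => [[A]|xs].
  by case/imsetP=> j _ ->; rewrite inE => /mem_drop.
exists [set x in drop 0 s]; last by rewrite inE drop0.
by apply/imsetP; exists ord0.
Qed.

Definition Bsub (b : {set {set I}}) : {set {set I}} :=
  [set B : {set I} | (B != set0) &&
     [|| B \in b, B \proper star_min b | star_max b \proper B]]
  :|: [set [set v] | v : I].

End ComplexC.

From mathcomp Require Import boolp classical_sets reals.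

Local Open Scope ring_scope.
Local Open Scope classical_set_scope.

Section Polytopes.
Variables (R : realType) (N : nat).
Local Notation E := 'rV[R]_N.
Implicit Types (S P Q F T : set E) (u v x y z : E).

Definition dotp u v : R := \sum_i u 0 i * v 0 i.

Definition convhull S : set E := [set x |
  exists (m : nat) (p : 'I_m -> E) (w : 'I_m -> R),
    [/\ forall i, S (p i), forall i, 0 <= w i, \sum_i w i = 1
      & x = \sum_i w i *: p i]].

Definition polytope P : Prop :=
  exists s : seq E, s != [::] /\ P = convhull [set` s].

Definition msum P Q : set E := [set x | exists2 y, P y & exists2 z, Q z & x = y + z].

Lemma msumC : commutative msum.
Proof.
by move=> P Q; apply/seteqP; split=> x [y Py [z Qz ->]];
  exists z => //; exists y => //; rewrite addrC.
Qed.

Lemma msumA : associative msum.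
Proof.
move=> P Q T; apply/seteqP; split=> x.
  case=> y Py [_ [z Qz [t Tt ->]] ->]; exists (y + z); last first.
    by exists t => //; rewrite addrA.
  by exists y => //; exists z.
case=> _ [y Py [z Qz ->]] [t Tt ->]; exists y => //; exists (z + t).
  by exists z => //; exists t.
by rewrite addrA.
Qed.

Lemma msum0 : left_id [set 0] msum.
Proof.
move=> P; apply/seteqP; split=> x => [[_ -> [y Py ->]]|Px]; first by rewrite add0r.
by exists 0 => //; exists x => //; rewrite add0r.
Qed.

HB.instance Definition _ :=
  Monoid.isComLaw.Build (set E) [set 0] msum msumA msumC msum0.

(* The empty set and P itself are faces of P. *)
Definition face P F : Prop := exists (v : E) (c : R),
  (forall z, P z -> dotp v z <= c) /\ F = [set z | P z /\ dotp v z = c].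

Definition nonempty_face P F : Prop := face P F /\ F !=set0.

Definition vertices P : set E := [set v | face P [set v]].

(* P contains d + 1 affinely independent points p0, p0 + row i m (i < d),
   and P is contained in their affine hull. *)
Definition affine_dim P (d : nat) : Prop :=
  exists (p0 : E) (m : 'M[R]_(d, N)),
    [/\ row_free m, P p0, forall i, P (p0 + row i m)
      & forall x, P x -> (x - p0 <= m)%MS].

Definition facet P F : Prop :=
  face P F /\ exists d : nat, affine_dim P d.+1 /\ affine_dim F d.

(* As F is a subset of P, the maximum of <v, _> over P is attained at y in F
   iff <v, y> is an upper bound. *)
Definition normal_cone P F : set E :=
  [set v | forall y, F y -> forall z, P z -> dotp v z <= dotp v y].

Definition normal_fan P : set (set E) :=
  [set normal_cone P F | F in nonempty_face P].

Definition normally_equivalent P Q : Prop :=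
  [/\ polytope P, polytope Q & normal_fan P = normal_fan Q].

(* T is a truncation of P in F, by the hyperplane <a, x> = c. *)
Definition truncation P F T : Prop :=
  [/\ nonempty_face P F, F <> P, ~ facet P F, polytope T
    & exists (a : E) (c : R),
      [/\ a != 0, T = P `&` [set x | c <= dotp a x],
          forall v, vertices P v -> ~ F v -> c < dotp a v
        & forall v, vertices F v -> ~ c <= dotp a v]].

Definition truncator_summand P1 P2 : Prop :=
  exists F T, truncation P1 F T /\ normally_equivalent (msum P1 P2) T.

Fixpoint truncator_set (S0 : set E) (s : seq (set E)) : Prop :=
  if s is P :: s' then
    truncator_summand S0 P /\ truncator_set (msum S0 P) s'
  else True.

Definition realises (V : finType) (P : set E) (K : {set {set V}}) : Prop :=
  exists f : {set V} -> set E,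
    [/\ forall X, X \in K -> nonempty_face P (f X),
        forall F, nonempty_face P F -> exists2 X, X \in K & f X = F
      & forall X Y, X \in K -> Y \in K -> (f X `<=` f Y <-> Y \subset X)].

Definition simplex (A : {set 'I_N}) : set E :=
  convhull [set delta_mx 0 i | i in [set` A]].

End Polytopes.

Section Realisation.
Variables (R : realType) (n : nat).
Local Notation E := 'rV[R]_n.+1.

(* P is an n-dimensional Minkowski-realisation of K, the complex of all nested
   sets with respect to the building set B of K0. *)
Definition Minkowski_realisation (V : finType) (K0 B : {set {set V}})
    (K : {set {set {set V}}}) (P : set E) : Prop :=
  [/\ building_set K0 B, K = nested_complex K0 B, polytope P, affine_dim P n
    & realises P K /\
      exists phi : {set V} -> set E,
      [/\ forall b, b \in B -> polytope (phi b),
          P = msum (simplex [set: 'I_n.+1]%SET)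
                (\big[@msum R n.+1/[set 0]]_(b in B) phi b)
        & forall (m : nat) (x : 'I_m -> {set V}),
            injective x ->
            [set x i | i : 'I_m]%SET = B :\: singletons_of B ->
            (forall i j : 'I_m, (i < j)%N -> (#|x j| <= #|x i|)%N) ->
            truncator_set
              (msum (simplex [set: 'I_n.+1]%SET)
                (\big[@msum R n.+1/[set 0]]_(b in singletons_of B) phi b))
              [seq phi (x i) | i <- enum 'I_m]]].

Variable b : {set {set 'I_n.+1}}.

Definition PBsub : set E :=
  \big[@msum R n.+1/[set 0]]_(B in Bsub b) simplex B.

(* The facet f_A: since the hyperplane supports PBsub, the facet lying in it is
   its whole intersection with PBsub. *)
Definition fsub (A : {set 'I_n.+1}) : set E :=
  PBsub `&` [set x : E | \sum_(i in A) x 0 i =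
                         #|[set B in Bsub b | B \subset A]%SET|%:R].

Definition Fsub : set E := \bigcap_(A in [set` b]) fsub A.

Definition Nsub : set E := convhull (vertices PBsub `\` vertices Fsub).

End Realisation.

Definition PA1 (R : realType) (n : nat) : set 'rV[R]_n.+1 :=
  msum (msum (simplex [set: 'I_n.+1]%SET)
         (\big[@msum R n.+1/[set 0]]_(b in A1 n) simplex (finset.cover b)))
       (\big[@msum R n.+1/[set 0]]_(b in A2 n) Nsub b).

Definition kappa (R : realType) (n k l : nat) : R :=
  (3 ^+ (k + l + 1) - 3 ^+ (l + 1)) / 2
  + (3 ^+ k - 3 * k%:R) / (3 ^+ n - n%:R - 1).

(* The elements b of B1 are given through their representations star k s:
   the coefficient of x_(i_j) is min(j, k), for 1 <= j <= k + l. *)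
Definition PA (R : realType) (n : nat) : set 'rV[R]_n.+1 :=
  [set x : 'rV[R]_n.+1 | \sum_i x 0 i = 3 ^+ n.+1 /\
    forall (k l : nat) (s : (k + l).-tuple 'I_n.+1),
      (0 < k)%N -> (k + l <= n)%N -> uniq s ->
      kappa R n k l <= \sum_(j < k + l) (minn j.+1 k)%:R * x 0 (tnth s j)].

Arguments PA1 R n : clear implicits.
Arguments PA R n : clear implicits.

(* Main.v *)
(** For [b] a family of sets put [ev b = \sum_(A in b) 1_A] and
    [cval b x = <ev b, x>].  For every building set [G] with
    [A1 <= G <= B1] the cones spanned by the [ev b], [b] in a [G]-nested set,
    cover the space modulo the line of [(1, ..., 1)].  Hence, if a polyhedron
    [poly G h tot], cut out of a hyperplane by the inequalities
    [h b <= cval b x] for [b \in G], has for each nested set a point at which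
    exactly its inequalities are tight, then it is the convex hull of those
    points, its face lattice is the complex of [G]-nested sets and its normal fan
    depends on [G] only.

    The partial sums, their truncations and [PA] all satisfy this criterion.  For
    a partial sum (with [G] the set of the [b] already added) the points are sums
    of vertices of the summands: a linear order for which the members of the nested
    set [N] are chains of up-sets selects a vertex of each [PBsub b]; when this vertex
    lies on the face removed in forming [Nsub b], transposing two neighbours across
    some [ch b \in b] gives a vertex of [Nsub b], at which only the sum over [ch b]
    grows, by 1.  The choice of [ch b] outside all the members of [N] not containing [b]
    makes exactly the inequalities of [N] tight.  The truncation of the face of [b] is
    handled by interpolating between points for [N :\ b] and for
    [(N :\ b) :|: {{A} | A \in b}].  For [PA], the same choices distribute weights
    (the second differences of the correction term of [kappa]) over a full flag
    of the permutohedron with values [3 ^ #|A|]. *)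

Require Import Defs.
From mathcomp Require Import all_boot all_order all_algebra perm zify lra ring.

Set Implicit Arguments.
Unset Strict Implicit.
Unset Printing Implicit Defensive.

(** * Flags and the building set B1 *)

Section Flags.
Variable n : nat.
Local Notation I := 'I_n.+1.
Implicit Types (A D E : {set I}) (W b c : {set {set I}}) (N G : {set {set {set I}}}).

(** The vertices of a partial sum are nowhere classified. Every summand bounds [cval c] from below,
    [support] adds these bounds up, and the problem is to attain them simultaneously. The simplices
    follow the order. For [Nsub b] the vertices are integral, so a vertex off the removed face
    exceeds the bound of [PBsub b] by at least 1 on some member of [b]; [cval c] has to pay this
    unit when [b \subset c], and the obstacle is to place it so that no other [c] of the nested set
    pays it. This is what nestedness grants, in [nested_not_covered]. Decreasing cardinality enters
    twice: it makes each intermediate family a building set, and it leaves no member with two or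
    more elements inside the family [b] about to be added. Hence no unit is counted yet in the bound
    on [cval b], which is then the sum of the bounds on the single members of [b]: the supporting
    hyperplane cuts exactly the face to be truncated. In [PA], the powers of 3 give every family
    with a member that is not an up-set a slack above 1, whereas all corrections stay below 1. *)

Definition flag W : Prop :=
  (forall A, A \in W -> A != set0 /\ A != setT) /\
  (forall A D, A \in W -> D \in W -> (A \subset D) || (D \subset A)).

Lemma flagS W b : flag W -> b \subset W -> flag b.
Proof.
move=> [h1 h2] /subsetP s; split=> [A /s /h1 //|A D /s Aw /s Dw]; exact: h2.
Qed.

Lemma flag_leq_card W A D :
  flag W -> A \in W -> D \in W -> #|A| <= #|D| -> A \subset D.
Proof.
move=> [_ h] Aw Dw le; case/orP: (h _ _ Aw Dw) => // DA.
by have /eqP -> : D == A by rewrite eqEcard DA.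
Qed.

Lemma flag_eq_card W A D : flag W -> A \in W -> D \in W -> #|A| = #|D| -> A = D.
Proof.
move=> fW Aw Dw e; apply/eqP.
by rewrite eqEcard e leqnn (flag_leq_card fW Aw Dw) ?e.
Qed.

Lemma flag_card b : flag b -> #|b| <= n.
Proof.
move=> fb; have bnd A : A \in b -> 0 < #|A| <= n.
  move=> /fb.1[A0 AT]; rewrite card_gt0 A0 /=.
  have : A \proper setT by rewrite properT.
  by move/proper_card; rewrite cardsT card_ord ltnS.
have inj : {in b &, injective (fun A => inord #|A| : 'I_n.+1)}.
  move=> A D Ab Db /(congr1 val); rewrite /= !inordK ?ltnS; last 2 first.
  - by case/andP: (bnd _ Db).
  - by case/andP: (bnd _ Ab).
  exact: (flag_eq_card fb).
rewrite -(card_in_imset inj) -[X in _ <= X]/(n.+1.-1) -[n.+1 in X in _ <= X]card_ord.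
rewrite -(cardsC1 (ord0 : I)); apply: subset_leq_card; apply/subsetP => i.
case/imsetP=> A /bnd /andP[A0 An] ->; rewrite !inE -val_eqE /= inordK ?ltnS //.
by rewrite -lt0n.
Qed.

Lemma flag1 A : A != set0 -> A != setT -> flag [set A].
Proof.
move=> A0 AT; split=> [D /set1P -> //|D E /set1P -> /set1P ->].
by rewrite subxx.
Qed.

Lemma flag0 : flag set0.
Proof. by split=> A; rewrite inE. Qed.

Lemma flagU1 A W : flag W -> A != set0 -> A != setT ->
  (forall D, D \in W -> (A \subset D) || (D \subset A)) -> flag (A |: W).
Proof.
move=> [h1 h2] A0 AT h; split=> [D /setU1P[-> //|/h1 //]|D E].
move=> /setU1P[->|Dw] /setU1P[->|Ew]; rewrite ?subxx //; [exact: h| |exact: h2].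
by rewrite orbC; apply: h.
Qed.

Lemma antichain2 (V : finType) (X Y : {set V}) :
  ~~ (X \subset Y) -> ~~ (Y \subset X) -> antichain [set X; Y].
Proof.
move=> XY YX; have neq : X != Y by apply: contraNneq XY => ->.
rewrite /antichain cards2 neq; apply/forall_inP => S /set2P hS.
apply/forall_inP => S' /set2P hS'; apply/implyP.
by case: hS => ->; case: hS' => ->; rewrite ?eqxx.
Qed.

Lemma antichainP (V : finType) (F : {set {set V}}) :
  reflect (1 < #|F| /\ forall X Y, X \in F -> Y \in F -> X \subset Y -> X = Y)
    (antichain F).
Proof.
apply: (iffP andP) => -[c h]; split=> //.
  move=> X Y XF YF; apply: contraTeq => ne.
  by move/forall_inP: h => /(_ _ XF) /forall_inP/(_ _ YF)/implyP; apply.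
apply/forall_inP => X XF; apply/forall_inP => Y YF; apply/implyP.
by apply: contra => /(h _ _ XF YF) ->.
Qed.

Lemma cover2 (V : finType) (X Y : {set V}) : cover [set X; Y] = X :|: Y.
Proof. by rewrite /cover bigcup_setU !big_set1. Qed.

(** [C0 :\: B0] contains only the empty set, which is no union of nonempty sets; so a nested set
    admits no antichain at all. *)
Lemma C1P W : W \in C1 n <-> flag W.
Proof.
rewrite inE; split.
  case/andP=> /subsetP s /forall_inP h.
  have s' A : A \in W -> A != set0 /\ A != setT.
    by move/s; rewrite !inE andbT => /andP[-> ->].
  split=> // A D Aw Dw; case: (boolP (A \subset D)) => //= AD.
  apply/negP => /negP DA.
  have := h [set A; D]; rewrite antichain2 // andbT.
  have -> : [set A; D] \subset W by apply/subsetP => X /set2P[->|->].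
  move/(_ isT); rewrite cover2 !inE andbT negb_and !negbK setU_eq0.
  by have [/negPf -> _] := s' _ Aw; case: (A :|: D == setT).
move=> [h1 h2]; apply/andP; split.
  by apply/subsetP => A /h1[a b]; rewrite !inE a b.
apply/forall_inP => F /andP[/subsetP FW /antichainP[c h]].
have /card_gt1P[X [Y [XF YF]]] := c.
by case/orP: (h2 _ _ (FW _ XF) (FW _ YF)) => /h -> //; rewrite ?eqxx.
Qed.

Lemma C1_simplicial : simplicial_complex (C1 n).
Proof.
split; first exact/C1P/flag0.
by move=> X Y /C1P fX YX; apply/C1P; apply: flagS YX.
Qed.

Lemma card_drop (s : seq I) j : uniq s -> #|[set x in drop j s]| = size s - j.
Proof. by move=> u; rewrite cardsE (card_uniqP _) ?drop_uniq // size_drop. Qed.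

Lemma drop_set_sub (s : seq I) i j : i <= j ->
  [set x in drop j s] \subset [set x in drop i s].
Proof.
move=> le; apply/subsetP => x; rewrite !inE -(subnK le) -drop_drop.
exact: mem_drop.
Qed.

Lemma star0 (s : seq I) : star 0 s = set0.
Proof. by apply/setP => A; rewrite inE; apply/imsetP => -[[]]. Qed.

Lemma starP k (s : seq I) A :
  reflect (exists2 j, j < k & A = [set x in drop j s]) (A \in star k s).
Proof.
apply: (iffP imsetP) => [[j _ ->]|[j jk ->]]; first by exists j.
by exists (Ordinal jk).
Qed.

Lemma star_cons k x (s : seq I) :
  star k.+1 (x :: s) = [set y in x :: s] |: star k s.
Proof.
apply/setP => A; rewrite !inE; apply/starP/orP.
  case=> -[|j] jk ->; [left; exact: eqxx|right].
  by apply/starP; exists j.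
case=> [/eqP ->|/starP[j jk ->]]; first by exists 0.
by exists j.+1.
Qed.

(* Together with [flag], an intrinsic form of [star]: see [B1P]. *)
Definition contiguous b : Prop :=
  forall A D t, A \in b -> D \in b -> #|A| <= t <= #|D| -> exists2 E, E \in b & #|E| = t.

Lemma star_flag k (s : seq I) : 0 < k -> k <= size s <= n -> uniq s ->
  [/\ flag (star k s), star k s != set0 & contiguous (star k s)].
Proof.
move=> k0 /andP[ks sn] u; split.
- split=> [A /starP[j jk ->]|A D /starP[i ik ->] /starP[j jk ->]].
    have c := card_drop j u; split.
      by rewrite -card_gt0 c subn_gt0 (leq_trans jk).
    apply: contraTneq sn => e; move: c; rewrite e cardsT card_ord => c.
    rewrite -ltnNge; have := leq_subr j (size s); rewrite -c; apply: leq_trans.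
    exact: ltnSn.
  by case/orP: (leq_total i j) => /drop_set_sub -> //; rewrite orbT.
- by apply/set0Pn; exists [set x in drop 0 s]; apply/starP; exists 0.
move=> _ _ t /starP[i ik ->] /starP[j jk ->]; rewrite !card_drop //.
move=> h; exists [set x in drop (size s - t) s].
  by apply/starP; exists (size s - t) => //; lia.
by rewrite card_drop //; lia.
Qed.

Lemma flag_max b : flag b -> b != set0 ->
  exists2 D, D \in b & forall A, A \in b -> A \subset D.
Proof.
move=> fb /set0Pn[A0 A0b].
have [D Db h] := @arg_maxnP _ A0 (mem b) (fun A => #|A|) A0b.
exists D => // A Ab; apply: flag_leq_card fb _ _ _ => //; exact: h.
Qed.

(** Remove the largest member [D] and recurse. Contiguity provides a member with one element more
    than the largest remaining one; it can only be [D], so [D] adds a single element, which becomes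
    the head of the sequence. For a single member any enumeration serves. *)
Lemma star_exists b : flag b -> b != set0 -> contiguous b ->
  exists s, [/\ uniq s, #|b| <= size s, size s <= n & b = star #|b| s].
Proof.
move: {2}#|b| (erefl #|b|) => k.
elim: k b => [|k IH] b cb fb b0 ct; first by rewrite -card_gt0 cb in b0.
have [D Db Dmax] := flag_max fb b0.
pose b' := b :\ D.
have cb' : #|b'| = k by move: cb; rewrite (cardsD1 D b) Db /= => -[].
have [D0 DT] := fb.1 _ Db.
have Dn : #|D| <= n.
  have : D \proper setT by rewrite properT.
  by move/proper_card; rewrite cardsT card_ord ltnS.
case: (posnP k) => [k0|k0].
  have bD : b = [set D].
    apply/eqP; rewrite eq_sym eqEcard sub1set Db cards1 cb k0 //.
  exists (enum D); rewrite enum_uniq -cardE cb k0 card_gt0; split=> //.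
  rewrite bD; apply/setP => A; apply/set1P/starP.
    by move=> ->; exists 0 => //; rewrite drop0; apply/setP => x; rewrite inE mem_enum.
  by case=> -[|//] _ ->; rewrite drop0; apply/setP => x; rewrite inE mem_enum.
have fb' : flag b' by apply: flagS fb _; apply: subD1set.
have b'0 : b' != set0 by rewrite -card_gt0 cb'.
have lt_D A : A \in b' -> #|A| < #|D|.
  by case/setD1P=> AD Ab; apply: proper_card; rewrite properEneq AD Dmax.
have ct' : contiguous b'.
  move=> A E t Ab Eb /andP[le1 le2].
  have [|X Xb Xt] := ct A E t (subsetP (subD1set _ _) _ Ab)
    (subsetP (subD1set _ _) _ Eb) _; first by rewrite le1.
  exists X => //; rewrite !inE Xb andbT; apply: contraTneq le2 => XD.
  by rewrite -ltnNge -Xt XD lt_D.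
have [s [us ks sn bs]] := IH _ cb' fb' b'0 ct'.
have sb' : [set x in s] \in b'.
  rewrite bs; apply/starP; exists 0; last by rewrite drop0.
  by rewrite cb'.
have [|X Xb Xt] := ct [set x in s] D (size s).+1 (subsetP (subD1set _ _) _ sb') Db.
  have := lt_D _ sb'; have := card_drop 0 us; rewrite drop0 subn0 => -> ->.
  by rewrite leqnSn.
have XD : X = D.
  apply/eqP; apply: contraT => XD; move/eqP: Xt; apply: contraLR => _.
  rewrite neq_ltn; apply/orP; left; have : X \in b' by rewrite !inE XD.
  by rewrite bs => /starP[j _ ->]; rewrite card_drop // ltnS leq_subr.
have cD : #|D| = (size s).+1 by rewrite -XD.
have sD : [set x in s] \subset D by apply: Dmax; apply: (subsetP (subD1set _ _) _ sb').
have /set0Pn[x] : D :\: [set x in s] != set0.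
  rewrite -card_gt0 cardsD (setIidPr sD) cD.
  have := card_drop 0 us; rewrite drop0 subn0 => ->; rewrite subSnn //.
rewrite !inE => /andP[xs xD].
exists (x :: s); rewrite /= us xs cb; split=> //; first by rewrite -cb' ltnS.
- by rewrite -cD.
rewrite star_cons.
have -> : [set y in x :: s] = D.
  apply/eqP; rewrite eqEcard; apply/andP; split.
    apply/subsetP => y; rewrite !inE => /orP[/eqP -> //|ys].
    by apply: (subsetP sD); rewrite inE.
  by rewrite cD cardsE (card_uniqP _) //= us xs.
by rewrite -cb' -bs setD1K.
Qed.

Lemma B1P b : b \in B1 n <-> [/\ flag b, b != set0 & contiguous b].
Proof.
rewrite inE; split.
  case/existsP=> k /existsP[l /existsP[s /and4P[k0 kl u /eqP ->]]].
  apply: star_flag => //; by rewrite size_tuple leq_addr kl.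
case=> fb b0 ct; have [s [us ks sn bs]] := star_exists fb b0 ct.
have kn : #|b| < n.+1 by rewrite ltnS (leq_trans ks).
have ln : size s - #|b| < n.+1 by rewrite ltnS (leq_trans _ sn) ?leq_subr.
apply/existsP; exists (Ordinal kn); apply/existsP; exists (Ordinal ln).
have sz : size s == #|b| + (size s - #|b|) by rewrite subnKC.
apply/existsP; exists (Tuple sz); rewrite /= us card_gt0 b0 subnKC // sn /=.
by rewrite -bs.
Qed.

Lemma B1_flag b : b \in B1 n -> flag b. Proof. by case/B1P. Qed.
Lemma B1_neq0 b : b \in B1 n -> b != set0. Proof. by case/B1P. Qed.

Lemma B1_set1 A : A != set0 -> A != setT -> [set A] \in B1 n.
Proof.
move=> A0 AT; apply/B1P; split; first exact: flag1.
  by apply/set0Pn; exists A; rewrite inE.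
move=> D E t /set1P -> /set1P -> le; exists A; rewrite ?inE //.
by apply/eqP; rewrite eqn_leq.
Qed.

(** The cardinalities of each family fill an interval, and a common member makes the two intervals
    overlap. *)
Lemma B1_setU b c : b \in B1 n -> c \in B1 n -> b :&: c != set0 ->
  flag (b :|: c) -> b :|: c \in B1 n.
Proof.
move=> /B1P[_ b0 cb] /B1P[_ _ cc] /set0Pn[E /setIP[Eb Ec]] f; apply/B1P; split=> //.
  by case/set0Pn: b0 => A Ab; apply/set0Pn; exists A; rewrite inE Ab.
have key A t : A \in b :|: c -> (#|A| <= t <= #|E|) || (#|E| <= t <= #|A|) ->
  exists2 X, X \in b :|: c & #|X| = t.
  by case/setUP=> Ax /orP[] le; [have [X h1 h2] := cb _ _ _ Ax Eb le
    |have [X h1 h2] := cb _ _ _ Eb Ax le|have [X h1 h2] := cc _ _ _ Ax Ec le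
    |have [X h1 h2] := cc _ _ _ Ec Ax le]; exists X; rewrite ?inE ?h1 ?orbT.
move=> A D t Ax Dx /andP[le1 le2]; case/orP: (leq_total t #|E|) => le.
  by apply: key Ax _ => //; rewrite le1 le.
by apply: key Dx _ => //; rewrite le le2 orbT.
Qed.

Lemma A1P b : b \in A1 n <-> exists A, [/\ A != set0, A != setT & b = [set A]].
Proof.
rewrite inE; split; last by case=> A [A0 AT ->]; rewrite B1_set1 //= cards1.
case/andP=> /B1_flag[h _] /cards1P[A e]; exists A.
by have [] := h A; rewrite e ?inE.
Qed.

Lemma A2E b : (b \in A2 n) = (b \in B1 n) && (1 < #|b|).
Proof.
rewrite !inE; case: (boolP [exists k, _]); rewrite ?andbF // andbT => h.
have : b != set0 by apply: B1_neq0; rewrite inE.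
by rewrite -card_gt0; case: #|b| => [|[|]].
Qed.

Lemma A1U_A2 : A1 n :|: A2 n = B1 n.
Proof.
apply/setP => b; rewrite in_setU in_setD /A1 inE.
by case: (b \in B1 n); rewrite ?andbF ?andbT ?orbN.
Qed.

Lemma B1_building : building_set (C1 n) (B1 n).
Proof.
split; first exact: C1_simplicial.
  by apply/subsetP => b /B1_flag /C1P.
move=> W /maxsetP[/= /C1P fW _]; split.
- by move=> X /setIP[/B1_neq0 -> ]; rewrite inE.
- move=> A Aw; have [A0 AT] := fW.1 _ Aw.
  by rewrite inE B1_set1 //= inE sub1set.
move=> X Y /setIP[XB]; rewrite inE => XW /setIP[YB]; rewrite inE => YW XY.
have s : X :|: Y \subset W by rewrite subUset XW.
apply/setIP; split; last by rewrite powersetE.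
by apply: B1_setU => //; apply: flagS fW s.
Qed.

End Flags.

(** * Nested sets *)

Section Nested.
Variable n : nat.
Local Notation I := 'I_n.+1.
Implicit Types (A D E : {set I}) (W b c M : {set {set I}}) (N F G : {set {set {set I}}}).

(* The building sets met at the successive truncations. *)
Definition good G : Prop :=
  [/\ G \subset B1 n, A1 n \subset G
    & forall b c, b \in G -> c \in G -> b :&: c != set0 -> flag (b :|: c) ->
        b :|: c \in G].

Lemma good_B1 : good (B1 n).
Proof.
split=> //; first by apply/subsetP => b; rewrite inE => /andP[].
by move=> b c; apply: B1_setU.
Qed.

(** The union of two incomparable members is strictly larger than each of them, hence already
    present when the families are added by decreasing cardinality. *)
Lemma good_A1U G : G \subset A2 n ->
  (forall b c, b \in G -> c \in A2 n -> #|b| < #|c| -> c \in G) -> good (A1 n :|: G).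
Proof.
move=> /subsetP GA up; split.
- by apply/subsetP => b /setUP[|/GA]; rewrite inE => /andP[].
- exact: subsetUl.
move=> b c bG cG bc f.
have B1G x : x \in A1 n :|: G -> x \in B1 n.
  by case/setUP=> [|/GA]; rewrite inE => /andP[].
have bcB : b :|: c \in B1 n by apply: B1_setU; rewrite ?B1G.
case: (boolP (b \subset c)) => [/setUidPr -> //|nbc].
case: (boolP (c \subset b)) => [/setUidPl -> //|ncb].
have single x y : x \in A1 n -> x :&: y != set0 -> x \subset y.
  case/A1P=> A [_ _ ->] /set0Pn[E /setIP[/set1P -> Ay]].
  by rewrite sub1set.
case/setUP: bG => [/single/(_ bc)|bG]; first by rewrite (negPf nbc).
have lt : #|b| < #|b :|: c|.
  apply: proper_card; rewrite properE subsetUl subUset subxx /=.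
  by rewrite (negPf ncb).
apply/setUP; right; apply: (up b) => //.
have := GA _ bG; rewrite !A2E bcB => /andP[_ h].
exact: ltn_trans h lt.
Qed.

Variable G : {set {set {set I}}}.
Hypothesis gG : good G.
Local Notation nest := (nested (C1 n) G).

Let GB b : b \in G -> b \in B1 n.
Proof. by case: gG => /subsetP s _ _ /s. Qed.

Lemma nestedP N : reflect (N \subset G /\
   forall F, F \subset N -> antichain F -> flag (cover F) /\ cover F \notin G)
  (nest N).
Proof.
apply: (iffP andP) => -[s h]; split=> //.
  move=> F FN aF; move/forall_inP: h => /(_ F); rewrite FN aF => /(_ isT).
  by rewrite inE => /andP[-> /C1P].
apply/forall_inP => F /andP[FN aF]; have [f nF] := h F FN aF.
by rewrite inE nF; apply/C1P.
Qed.

Lemma nested_sub N N' : nest N -> N' \subset N -> nest N'.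
Proof.
move=> /nestedP[s h] s'; apply/nestedP; split; first exact: subset_trans s.
by move=> F FN; apply: h; apply: subset_trans s'.
Qed.

Lemma nested_mem N b : nest N -> b \in N -> b \in G.
Proof. by case/nestedP=> /subsetP s _ /s. Qed.

Lemma nested_set0 : nest set0.
Proof.
apply/nestedP; split; first exact: sub0set.
move=> F; rewrite subset0 => /eqP -> /andP[]; by rewrite cards0.
Qed.

Lemma nested_set1 b : b \in G -> nest [set b].
Proof.
move=> bG; apply/nestedP; split; first by rewrite sub1set.
move=> F /subset_leq_card; rewrite cards1 => c /andP[]; by rewrite ltnNge c.
Qed.

(** Incomparable members form an antichain, so their union is a flag outside [G]; as [G] is closed
    under unions of intersecting members, they must be disjoint. *)
Lemma nested_pair N b c : nest N -> b \in N -> c \in N ->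
  flag (b :|: c) /\ (b :&: c != set0 -> (b \subset c) || (c \subset b)).
Proof.
move=> nN bN cN; have bG := nested_mem nN bN; have cG := nested_mem nN cN.
case: (boolP (b \subset c)) => [bc|nbc].
  by rewrite (setUidPr bc); split=> //; apply/B1_flag/GB.
case: (boolP (c \subset b)) => [cb|ncb].
  by rewrite (setUidPl cb); split=> //; apply/B1_flag/GB.
have [_ h] := nestedP _ nN.
have [|f nin] := h [set b; c] _ (antichain2 nbc ncb).
  by apply/subsetP => X /set2P[->|->].
move: f nin; rewrite cover2 => f nin; split=> // bc.
by case/negP: nin; case: gG => _ _; apply.
Qed.

Lemma nested_flag N : nest N -> flag (cover N).
Proof.
move=> nN; split.
  move=> A /bigcupP[M MN AM]; have [h _] := B1_flag (GB (nested_mem nN MN)).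
  exact: h.
move=> A D /bigcupP[M MN AM] /bigcupP[M' MN' DM].
have [[_ h] _] := nested_pair nN MN MN'.
by apply: h; rewrite inE ?AM ?DM ?orbT.
Qed.

Lemma good_cover F b : flag (b :|: cover F) -> b \in G ->
  (forall M, M \in F -> M \in G /\ b :&: M != set0) -> b :|: cover F \in G.
Proof.
move: {2}#|F| (erefl #|F|) => k; elim: k F => [|k IH] F cF f bG hF.
  by rewrite (cards0_eq cF) /cover big_set0 setU0.
have /set0Pn[M MF] : F != set0 by rewrite -card_gt0 cF.
have cE : cover F = M :|: cover (F :\ M) by rewrite /cover (big_setD1 M).
have e : b :|: cover F = (b :|: cover (F :\ M)) :|: M.
  by rewrite cE -setUA [M :|: _]setUC.
rewrite e; have [MG bM] := hF _ MF.
have cF' : #|F :\ M| = k by move: cF; rewrite (cardsD1 M) MF => -[].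
case: gG => _ _; apply=> //.
- apply: IH => //; last by move=> X /setD1P[_ /hF].
  by apply: flagS f _; rewrite e subsetUl.
- by rewrite setIUl; apply: contraNneq bM; move/eqP; rewrite setU_eq0 => /andP[].
by rewrite -e.
Qed.

(** Otherwise every member of [b] lies in some [M] of [N] that meets [b] without containing it. The
    maximal such [M] form an antichain covering [b] (a single one would contain [b]), and their
    union is in [G] by [good_cover], against nestedness. The [A] found serves as [ch b]: a member of
    [N] contains it exactly when it contains all of [b]. *)
Lemma nested_not_covered N b : nest N -> b \in G ->
  exists2 A, A \in b & forall M, M \in N -> A \in M -> b \subset M.
Proof.
move=> nN bG.
pose bad M := [&& M \in N, b :&: M != set0 & ~~ (b \subset M)].
case: (boolP [exists A in b, [forall M in N, (A \in M) ==> (b \subset M)]]).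
  case/exists_inP=> A Ab /forall_inP h; exists A => // M MN AM.
  by move/implyP: (h _ MN); apply.
move/exists_inPn => h; exfalso.
have hbad A : A \in b -> exists2 M, bad M & A \in M.
  move=> Ab; have /forall_inPn[M MN] := h _ Ab.
  rewrite negb_imply => /andP[AM nb]; exists M => //; rewrite /bad MN nb andbT /=.
  by apply/set0Pn; exists A; rewrite inE Ab.
pose F := [set M | bad M & [forall M', (bad M' && (M \subset M')) ==> (M == M')]].
have maxF M : bad M -> exists2 M', M' \in F & M \subset M'.
  move=> bM; have [M' /maxsetP[bM' mx] MM] := @maxset_exists _ bad M bM.
  exists M' => //; rewrite inE bM' /=; apply/forallP => X; apply/implyP => /andP[bX MX].
  by rewrite (mx X bX MX).
have FN : F \subset N.
  by apply/subsetP => M; rewrite inE => /andP[/and3P[]].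
have bF : b \subset cover F.
  apply/subsetP => A /hbad[M /maxF[M' MF MM] AM]; apply/bigcupP; exists M' => //.
  exact: (subsetP MM).
have aF : antichain F.
  apply/antichainP; split; last first.
    move=> X Y; rewrite !inE => /andP[_ /forallP/(_ Y)/implyP hX] /andP[bY _] XY.
    by apply/eqP/hX; rewrite bY.
  rewrite ltnNge; apply/negP => /card_le1P c1.
  have /set0Pn[A Ab] := B1_neq0 (GB bG).
  have /bigcupP[M MF AM] := subsetP bF _ Ab.
  have : b \subset M.
    apply: subset_trans bF _; apply/bigcupsP => X XF.
    by have := c1 _ MF X; rewrite XF inE => /esym/eqP ->.
  by move: MF; rewrite inE => /andP[/and3P[_ _ /negPf ->]].
have [_ hN] := nestedP _ nN; have [f nin] := hN F FN aF.
case/negP: nin; rewrite -(setUidPr bF); apply: good_cover => //.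
  by rewrite (setUidPr bF).
move=> M; rewrite inE => /andP[/and3P[MN bM _] _]; split=> //.
exact: nested_mem nN MN.
Qed.

(** Used to make the inequality of [b] strict while those of [N] are tight. If [A] escapes
    [cover N], an order can be chosen for which [A] is no up-set. Otherwise the minimality of [M]
    allows [ch M] to be [A], and then [b] pays for [M] without containing it. *)
Lemma nested_witness N b : nest N -> b \in G -> b \notin N ->
  exists2 A, A \in b & A \notin cover N \/
    exists2 M, M \in N & [/\ b \proper M, A \in M
      & forall M', M' \in N -> A \in M' -> M \subset M'].
Proof.
move=> nN bG bN; have [A Ab hA] := nested_not_covered nN bG.
exists A => //; case: (boolP (A \in cover N)) => [|]; last by left.
case/bigcupP=> M0 M0N AM0; right.
have p0 : (M0 \in N) && (A \in M0) by rewrite M0N.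
have [M /andP[MN AM] hM] := @arg_minnP _ M0 (fun M => (M \in N) && (A \in M)) (fun M => #|M|) p0.
exists M => //; split=> //.
  by rewrite properEneq hA // andbT; apply: contraNneq bN => ->.
move=> M' MN' AM'; have [_ cmp] := nested_pair nN MN MN'.
have MM' : M :&: M' != set0 by apply/set0Pn; exists A; rewrite inE AM.
case/orP: (cmp MM') => // M'M.
have /eqP -> // : M' == M by rewrite eqEcard M'M hM // MN'.
Qed.

Definition points_of b : {set {set {set I}}} := [set [set A] | A in b].

Lemma points_ofP b c : reflect (exists2 A, A \in b & c = [set A]) (c \in points_of b).
Proof. exact: imsetP. Qed.

Lemma points_of_A1 b : flag b -> points_of b \subset A1 n.
Proof.
move=> [f _]; apply/subsetP => c /points_ofP[A /f[A0 AT] ->].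
by apply/A1P; exists A.
Qed.

(* The face of the truncated polytope given by [b |: N] lies in the face of the
   untruncated one given by [N :|: points_of b]. *)
Lemma nested_points N b : good (b |: G) -> b \notin G ->
  (forall c, c \in G -> c \subset b -> #|c| <= 1) -> flag b ->
  nested (C1 n) (b |: G) (b |: N) -> b \notin N -> nest (N :|: points_of b).
Proof.
move=> gG' bG hG fb /andP[/subsetP sN hN] bN.
have AG : A1 n \subset G by case: gG.
have NG : N \subset G.
  apply/subsetP => M MN; have /setU1P[e|//] := sN _ (setU1r b MN).
  by move: bN; rewrite -e MN.
apply/nestedP; split.
  by rewrite subUset NG; apply: subset_trans (points_of_A1 fb) AG.
have hN' F : F \subset b |: N -> antichain F -> flag (cover F) /\ cover F \notin b |: G.
  move=> FN aF; move/forall_inP: hN => /(_ F); rewrite FN aF => /(_ isT).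
  by rewrite inE => /andP[-> /C1P].
move=> F FN aF; have [cF aF'] := antichainP _ aF.
case: (boolP [disjoint F & points_of b]) => [dF|].
  have FN' : F \subset b |: N.
    apply/subsetP => M MF; have := subsetP FN _ MF.
    by rewrite !inE; case/orP=> [->|]; rewrite ?orbT // (disjointFr dF MF).
  have [f nin] := hN' F FN' aF; split=> //.
  by apply: contra nin; rewrite inE orbC => ->.
case/pred0Pn=> P0 /= /andP[P0F /points_ofP[A0 A0b P0E]].
(* Since [F] contains a point of [b], adding [b] to [cover F] absorbs all points and all members
   inside [b]; what remains, together with [b], is pairwise incomparable in [b |: N]. *)
pose F' := b |: [set M in F | (M \in N) && ~~ (M \subset b)].
have big M : M \in F -> M \in N -> ~~ (b \subset M).
  move=> MF MN; apply/negP => bM.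
  have e : P0 = M by apply: aF' => //; rewrite P0E sub1set (subsetP bM).
  have : b = P0.
    apply/eqP; rewrite eqEsubset; rewrite {1}e bM /= P0E sub1set //.
  by move=> bP; case/negP: bN; rewrite bP e.
have coverE : cover F :|: b = cover F'.
  apply/setP => X; rewrite inE; apply/orP/bigcupP.
    case=> [/bigcupP[M MF XM]|Xb]; last by exists b; rewrite // !inE eqxx.
    have /setUP[MN|/points_ofP[A Ab ME]] := subsetP FN _ MF.
      case: (boolP (M \subset b)) => [/subsetP Mb|nMb].
        by exists b; rewrite ?Mb // !inE eqxx.
      by exists M => //; rewrite !inE MF MN nMb orbT.
    by exists b; [rewrite !inE eqxx|move: XM; rewrite ME => /set1P ->].
  case=> M /setU1P[-> Xb|]; first by right.
  by rewrite inE => /andP[MF _] XM; left; apply/bigcupP; exists M.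
have intF : cover F :&: b != set0.
  apply/set0Pn; exists A0; rewrite inE A0b andbT; apply/bigcupP; exists P0 => //.
  by rewrite P0E inE.
have F'N : F' \subset b |: N.
  apply/subsetP => M /setU1P[->|]; rewrite !inE ?eqxx // => /andP[_ /andP[-> _]].
  by rewrite orbT.
have F'anti X Y : X \in F' -> Y \in F' -> X \subset Y -> X = Y.
  case/setU1P=> [->|]; [|rewrite inE => /and3P[XF XN Xb]];
  case/setU1P=> [->|] //; rewrite ?(negPf Xb) // inE => /and3P[YF YN Yb] XY.
    by case/negP: (big _ YF YN).
  exact: aF'.
(* If only [b] is left, [cover F] lies in [b] and has two elements, so [hG] keeps it out of [G].
   Otherwise [cover F] in [G], which meets [b], would put the union of the antichain [F'] in
   [b |: G]. *)
case: (leqP #|F'| 1) => cF'.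
  have F'b : F' = [set b].
    apply/eqP; rewrite eq_sym eqEcard cards1 cF' andbT sub1set.
    by rewrite !inE eqxx.
  have Fb : cover F \subset b.
    have -> : b = cover F' by rewrite F'b /cover big_set1.
    by rewrite -coverE subsetUl.
  split; first exact: flagS fb Fb.
  apply/negP => cG; have := hG _ cG Fb; rewrite leqNgt => /negP; apply.
  have /card_gt1P[X [Y [XF YF XY]]] := cF.
  have XN : X \in G.
    have /setUP[/(subsetP NG)//|/(subsetP (points_of_A1 fb)) /(subsetP AG) //] := subsetP FN _ XF.
  have YN : Y \in G.
    have /setUP[/(subsetP NG)//|/(subsetP (points_of_A1 fb)) /(subsetP AG) //] := subsetP FN _ YF.
  have /set0Pn[x xX] := B1_neq0 (GB XN).
  have nYX : ~~ (Y \subset X) by apply/negP => /(aF' _ _ YF XF) e; rewrite e eqxx in XY.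
  have /subsetPn[y yY yX] := nYX.
  apply/card_gt1P; exists x, y; split; first by apply/bigcupP; exists X.
    by apply/bigcupP; exists Y.
  by apply: contraNneq yX => <-.
have aF2 : antichain F' by apply/antichainP.
have [f nin] := hN' F' F'N aF2; rewrite -coverE in f nin.
split; first by apply: flagS f _; apply: subsetUl.
apply: contra nin => cG; case: gG' => _ _; apply=> //.
  by rewrite inE cG orbT.
by rewrite !inE eqxx.
Qed.

Lemma nested_setU1 N b : nested (C1 n) (b |: G) N -> b \notin N -> nest N.
Proof.
move=> /andP[/subsetP sN hN] bN; apply/nestedP; split.
  apply/subsetP => M MN; have /setU1P[e|//] := sN _ MN.
  by move: bN; rewrite -e MN.
move=> F FN aF; move/forall_inP: hN => /(_ F); rewrite FN aF => /(_ isT).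
rewrite inE => /andP[h /C1P f]; split=> //.
by apply: contra h; rewrite inE orbC => ->.
Qed.

End Nested.

(** * Linear orders and up-sets *)

Section Orders.
Variable n : nat.
Local Notation I := 'I_n.+1.
Implicit Types (A B D E : {set I}) (W b c : {set {set I}}) (r : I -> nat).

Definition upset r A : bool := [forall a in A, forall o, (o \in A) || (r o < r a)].

Lemma upsetP r A :
  reflect (forall a o, a \in A -> o \notin A -> r o < r a) (upset r A).
Proof.
apply: (iffP forall_inP) => [h a o /h /forallP/(_ o) h' /negPf oA|h a aA].
  by rewrite oA in h'.
by apply/forallP => o; case: (boolP (o \in A)) => //= /(h _ _ aA).
Qed.

Lemma upsetPn r A :
  reflect (exists a o, [/\ a \in A, o \notin A & r a <= r o]) (~~ upset r A).
Proof.
apply: (iffP forall_inPn) => [[a aA /forallPn[o]]|[a [o [aA oA le]]]].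
  by rewrite negb_or -leqNgt => /andP[oA le]; exists a, o.
by exists a => //; apply/forallPn; exists o; rewrite negb_or oA -leqNgt.
Qed.

Lemma upset_chain r A D : upset r A -> upset r D -> (A \subset D) || (D \subset A).
Proof.
move=> /upsetP uA /upsetP uD; case: (boolP (A \subset D)) => //= /subsetPn[x xA xD].
apply/subsetP => y yD; apply: contraT => yA.
by have := uA _ _ xA yA; rewrite ltnNge ltnW // uD.
Qed.

(** The index of the vertex of [simplex B] that maximises the functional with coefficients [- r i];
    the default [ord0] only shows for empty [B]. *)
Definition first r B : I :=
  odflt ord0 [pick i in B | [forall j in B, r i <= r j]].

Lemma firstP r B : B != set0 ->
  first r B \in B /\ forall j, j \in B -> r (first r B) <= r j.
Proof.
move=> /set0Pn[x xB]; rewrite /first; case: pickP => [i /andP[iB /forall_inP]|] //=.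
have [i iB h] := arg_minnP r xB.
by move/(_ i); rewrite (iB : i \in B) /= => /forall_inPn[j /h ->].
Qed.

(** An up-set containing the minimum of [B] contains all of [B]. So the vertex of [simplex B]
    selected by [r] has the least possible mass on every up-set, which is why inequalities on
    up-sets become tight. *)
Lemma first_upset r A B : upset r A -> B != set0 ->
  (first r B \in A) = (B \subset A).
Proof.
move=> /upsetP uA /(firstP r)[fB h]; apply/idP/subsetP => [fA x xB|]; last by apply.
by apply: contraT => xA; have := uA _ _ fA xA; rewrite ltnNge h.
Qed.

(** The lowest element [a] of [A] and the highest element [o] outside are neighbours in the order,
    so transposing them spoils no up-set other than [A]. The last clause locates the sets whose
    first element lies in [A] although they leave [A]; within [Bsub b] this will single out
    [o |: A]. *)
Lemma swap_order r A : injective r -> upset r A -> A != set0 -> A != setT ->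
  exists r' a o, [/\ injective r', [/\ a \in A, o \notin A & r' a < r' o], ~~ upset r' A,
    forall D, upset r D -> D != A -> upset r' D /\ (A \subset D -> o \in D)
    & forall B, B != set0 -> first r' B \in A -> ~~ (B \subset A) ->
        [/\ a \in B, o \in B & B \subset o |: A]].
Proof.
move=> rI /upsetP uA /set0Pn[a0 a0A]; rewrite -subTset => /subsetPn[o0 _ o0A].
have [a aA ha] := @arg_minnP _ a0 (mem A) r a0A.
have o0A' : (mem (~: A)) o0 by rewrite /= inE.
have [o oA' ho] := @arg_maxnP _ o0 (mem (~: A)) r o0A'.
have oA : o \notin A by move: oA'; rewrite /= inE.
have {}ho x : x \notin A -> r x <= r o by move=> xA; apply: ho; rewrite /= inE.
have {}ha x : x \in A -> r a <= r x by apply: ha.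
have roa := uA _ _ (aA : a \in A) oA.
have neq : a != o by apply: contraNneq oA => <-.
pose t (x : I) : I := tperm a o x.
have r'I : injective (r \o t) by apply: inj_comp rI perm_inj.
exists (r \o t), a, o; split=> //.
- by split=> //=; rewrite /t tpermL tpermR.
- apply/upsetPn; exists a, o; split=> //=.
  by rewrite /t tpermL tpermR ltnW.
- move=> D uD DA; have /upsetP hD := uD.
  have key : (a \in D) = (o \in D) /\ (A \subset D -> o \in D).
    case/orP: (upset_chain (introT (upsetP _ _) uA) uD) => [AD|DA'].
      have [z zD zA] : exists2 z, z \in D & z \notin A.
        by apply/subsetPn; apply: contraNN DA => DA'; rewrite eqEsubset DA'.
      have oD : o \in D.
        apply: contraT => oD; have := hD _ _ zD oD.
        by rewrite ltnNge ho.
      by rewrite oD (subsetP AD).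
    have oD : o \notin D by apply: contra oA => /(subsetP DA').
    split=> [|AD]; last by case/eqP: DA; apply/eqP; rewrite eqEsubset DA'.
    rewrite (negPf oD); apply: contraNF DA => aD; rewrite eqEsubset DA' /=.
    apply/subsetP => x xA; apply: contraT => xD.
    by have := hD _ _ aD xD; rewrite ltnNge ha.
  case: key => key key2; split=> //.
  have tD x : (t x \in D) = (x \in D).
    by rewrite /t; case: tpermP => // ->; rewrite key.
  by apply/upsetP => x y xD yD /=; apply: hD; rewrite tD.
move=> B /(firstP (r \o t)) [fB h] fA nBA.
have out x : x \in B -> x \notin A -> x = o.
  move=> xB xA; apply/eqP; apply: contraT => xo.
  have xa : x != a by apply: contraNneq xA => ->.
  have tx : t x = x by rewrite /t tpermD // eq_sym.
  have := h _ xB; rewrite /= tx => le.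
  have : r o <= r (t (first (r \o t) B)).
    rewrite /t; case: tpermP => [_|e|_ _] //; last exact: leq_trans (ltnW roa) (ha _ fA).
    by move: oA; rewrite -e fA.
  move/leq_trans/(_ le) => le'; case/eqP: xo; apply: rI; apply/eqP.
  by rewrite eqn_leq ho.
have oB : o \in B.
  by have /subsetPn[x xB xA] := nBA; rewrite -(out _ xB xA).
have Bs : B \subset o |: A.
  by apply/subsetP => x xB; rewrite !inE; case: (boolP (x \in A)) => [|/(out _ xB) ->];
    rewrite ?orbT ?eqxx.
split=> //; suff <- : first (r \o t) B = a by [].
apply/eqP; apply: contraT => fa; have := h _ oB; rewrite /= /t tpermR.
have fo : first (r \o t) B != o by apply: contraNneq oA => <-.
rewrite /t tpermD 1?eq_sym // => le.
by case/eqP: fa; apply: rI; apply/eqP; rewrite eqn_leq le ha.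
Qed.

Lemma flag_order W : flag W -> exists2 r, injective r & forall D, D \in W -> upset r D.
Proof.
move=> [_ ch]; pose w i := #|[set D in W | i \in D]|.
(* The number of members containing [i] is the leading digit in base [n.+1]; the index of [i] breaks
   ties and gives injectivity. *)
exists (fun i : I => w i * n.+1 + i).
  move=> i j e; apply: val_inj => /=.
  have := congr1 (modn^~ n.+1) e; by rewrite !modnMDl !modn_small.
move=> D DW; apply/upsetP => a o aD oD.
have lt : w o < w a.
  apply: proper_card; apply/properP; split.
    apply/subsetP => E; rewrite !inE => /andP[EW oE]; rewrite EW /=.
    case/orP: (ch _ _ DW EW) => [/subsetP -> //|ED].
    by case/negP: oD; apply: (subsetP ED).
  by exists D; rewrite !inE DW.
have := leq_mul2r n.+1 (w o).+1 (w a); rewrite lt orbT mulSn => le.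
have := ltn_ord o; lia.
Qed.

Lemma flag_order_avoiding W A : flag W -> A != set0 -> A != setT -> A \notin W ->
  exists r, [/\ injective r, forall D, D \in W -> upset r D & ~~ upset r A].
Proof.
move=> fW A0 AT AW; have [r rI rW] := flag_order fW.
case: (boolP (upset r A)) => uA; last by exists r.
have [r' [a [o [r'I _ nu h _]]]] := swap_order rI uA A0 AT.
exists r'; split=> // D DW; apply: (h _ (rW _ DW) _).1.
by apply: contraNneq AW => <-.
Qed.

End Orders.

(** * The sets of [Bsub b] affected by a transposition *)

Section SubBuilding.
Variable n : nat.
Local Notation I := 'I_n.+1.
Implicit Types (A B D E : {set I}) (b c : {set {set I}}) (r : I -> nat).

Lemma Bsub_neq0 b B : B \in Bsub b -> B != set0.
Proof.
rewrite inE => /orP[|/imsetP[v _ ->]]; first by rewrite inE => /andP[].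
by apply/set0Pn; exists v; rewrite inE.
Qed.

(** Either [A] is the largest member of [b], and all sets properly above it belong to [Bsub b]; or
    contiguity gives a member with one element more, which contains [o] and hence equals
    [o |: A]. *)
Lemma Bsub_setU1 b A o : b \in B1 n -> A \in b -> o \notin A ->
  (forall E, E \in b -> A \subset E -> A != E -> o \in E) -> o |: A \in Bsub b.
Proof.
move=> /B1P[fb b0 ct] Ab oA h; apply/setUP; left; rewrite inE.
have -> /= : o |: A != set0 by apply/set0Pn; exists o; rewrite !inE eqxx.
have [D Db Dmax] := flag_max fb b0.
case: (eqVneq A D) => [AD|neq].
  apply/orP; right; apply/orP; right; rewrite properE.
  apply/andP; split; last by apply/subsetPn; exists o; rewrite ?inE ?eqxx //;
    apply: contra oA => /bigcupP[E Eb oE]; rewrite AD (subsetP (Dmax _ Eb)).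
  by apply/bigcupsP => E /Dmax ED; rewrite AD (subset_trans ED) // subsetUr.
have ltAD : #|A| < #|D|.
  by apply: proper_card; rewrite properEneq neq Dmax.
have [|E Eb cE] := ct A D #|A|.+1 Ab Db; first by rewrite leqnSn ltAD.
have AE : A \subset E by apply: flag_leq_card fb Ab Eb _; rewrite cE.
suff -> : o |: A = E by rewrite Eb.
apply/eqP; rewrite eqEcard cE cardsU1 oA add1n leqnn andbT subUset sub1set AE andbT.
apply: h => //; apply/negP => /eqP e; have := ltnSn #|A|.
by rewrite -[X in _ < X]cE -e ltnn.
Qed.

(** Ensures that transposing [a] and [o] raises the mass of the vertex on [A] by exactly 1. *)
Lemma Bsub_setU1_uniq b A a o B : b \in B1 n -> A \in b -> o \notin A -> a \in A ->
  B \in Bsub b -> a \in B -> o \in B -> B \subset o |: A -> B = o |: A.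
Proof.
move=> /B1P[fb b0 ct] Ab oA aA BB aB oB BoA.
have final : A \subset B -> B = o |: A.
  by move=> AB; apply/eqP; rewrite eqEsubset BoA subUset sub1set oB.
case/setUP: BB => [|/imsetP[v _ e]]; last first.
  by move: oA aB oB; rewrite e !inE => oA /eqP <- /eqP oa; rewrite oa aA in oA.
rewrite inE => /andP[_ /or3P[Bb|/proper_sub Bmin|/proper_sub Bmax]].
- case/orP: (fb.2 _ _ Ab Bb) => [/final //|BA].
  by case/negP: oA; apply: (subsetP BA).
- by case/negP: oA; have /bigcapP := subsetP Bmin _ oB; apply.
by apply: final; apply: subset_trans Bmax; apply: bigcup_sup.
Qed.

(** Take [A] largest among the members that are not up-sets, and [o] outside [A] ranked above some
    [a] in [A]. The larger members are up-sets containing [a], hence contain [o], so [o |: A] is in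
    [Bsub b]; its first element is not [o]. *)
Lemma Bsub_not_upset b r : b \in B1 n -> injective r ->
  ~~ [forall A in b, upset r A] ->
  exists A B, [/\ A \in b, B \in Bsub b, first r B \in A & ~~ (B \subset A)].
Proof.
move=> bB rI /forall_inPn[A0 A0b nu0]; have /B1P[fb b0 ct] := bB.
have p0 : (A0 \in b) && ~~ upset r A0 by rewrite A0b.
have [A /andP[Ab nuA] mx] := @arg_maxnP _ A0 (fun A => (A \in b) && ~~ upset r A)
  (fun A => #|A|) p0.
have [a [o [aA oA le]]] := upsetPn _ _ nuA.
have up E : E \in b -> A \subset E -> A != E -> o \in E.
  move=> Eb AE neq; have uE : upset r E.
    apply: contraT => nuE; have := mx E; rewrite Eb nuE => /(_ isT).
    by rewrite /= leqNgt proper_card // properEneq neq.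
  apply: contraT => oE; have /upsetP h := uE.
  by have := h _ _ (subsetP AE _ aA) oE; rewrite ltnNge le.
exists A, (o |: A); split=> //; first exact: Bsub_setU1.
  have /(firstP r)[] : o |: A != set0 by apply/set0Pn; exists o; rewrite !inE eqxx.
  case/setU1P=> // e /(_ a); rewrite !inE aA orbT e => /(_ isT) le'.
  have ao : a = o by apply: rI; apply/eqP; rewrite eqn_leq le.
  by rewrite -ao aA in oA.
by rewrite subUset sub1set (negPf oA).
Qed.

End SubBuilding.

Import Order.TTheory GRing.Theory Num.Theory.
Local Open Scope ring_scope.

(** * Completeness of the fan of nested sets *)

Section ConeDecomposition.
Variables (R : realFieldType) (n : nat).
Local Notation I := 'I_n.+1.
Implicit Types (A D E : {set I}) (W b c M : {set {set I}}) (N F G : {set {set {set I}}}).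

Lemma finite_lower_bound (T : finType) (P : pred T) (g : T -> R) :
  (forall t, P t -> 0 < g t) -> exists2 e, 0 < e & forall t, P t -> e <= g t.
Proof.
move=> gpos; case: (pickP P) => [t0 Pt0|P0]; last by exists 1 => // t; rewrite P0.
have [t Pt h] := arg_minP g Pt0.
by exists (g t) => //; apply: gpos.
Qed.

(** Layer-cake decomposition: subtract the least positive value on the whole support and recurse.
    The supports shrink strictly and form the flag; a full support is excluded because members of a
    flag are proper. *)
Lemma level_decomposition (v : I -> R) :
  (forall i, 0 <= v i) -> [set i | v i != 0] != setT ->
  exists W (mu : {set I} -> R),
  [/\ flag W, forall A, A \in W -> A \subset [set i | v i != 0],
      forall A, A \in W -> 0 < mu A
    & forall i, v i = \sum_(A in W) mu A *+ (i \in A)].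
Proof.
move: {2}#|_| (leqnn #|[set i | v i != 0]|) => k.
elim: k v => [|k IH] v ck v0 vT.
  move: ck; rewrite leqn0 cards_eq0 => /eqP s0.
  exists set0, (fun=> 0); split=> [|A|A|i]; rewrite ?inE //; first exact: flag0.
  rewrite big_set0; apply/eqP; have := in_set0 i; rewrite -s0 inE.
  by move/negbFE.
set S := [set i | _] in ck vT *.
case: (eqVneq S set0) => [S0|/set0Pn[i0 i0S]].
  exists set0, (fun=> 0); split=> [|A|A|i]; rewrite ?inE //; first exact: flag0.
  rewrite big_set0; apply/eqP; have := in_set0 i; rewrite -S0 inE.
  by move/negbFE.
have outS i : i \notin S -> v i = 0 by rewrite inE negbK => /eqP.
have [i1 i1S' hmin] := arg_minP v i0S.
have i1S : i1 \in S by [].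
pose v' i := v i - v i1 *+ (i \in S).
have vi1 : 0 < v i1 by rewrite lt0r v0 andbT; move: i1S; rewrite /S inE.
have v'0 i : 0 <= v' i.
  rewrite /v'; case: (boolP (i \in S)) => [/hmin|_]; last by rewrite subr0.
  by rewrite subr_ge0.
have S'S : [set i | v' i != 0] \subset S :\ i1.
  apply/subsetP => i; rewrite !inE /v'; case: (eqVneq i i1) => [->|ni] /=.
    by rewrite i1S subrr eqxx.
  move=> ne; case: (boolP (i \in S)) ne; first by rewrite inE.
  by move/outS ->; rewrite subr0 eqxx.
have cS' : (#|[set i | (v' i != 0)%R]| <= k)%N.
  apply: leq_trans (subset_leq_card S'S) _.
  by move: ck; rewrite (cardsD1 i1) i1S.
have S'T : [set i | v' i != 0] != setT.
  apply: contraNneq vT => e; move: S'S; rewrite e => /subsetP h.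
  by have := h i1 (in_setT _); rewrite !inE eqxx.
have [W [mu [fW WS mu0 vE]]] := IH v' cS' v'0 S'T.
have SW : S \notin W.
  apply/negP => /WS /subsetP /(_ i1 i1S) /(subsetP S'S).
  by rewrite !inE eqxx.
exists (S |: W), (fun A => if A == S then v i1 else mu A); split.
- apply: flagU1 => //; first by apply/set0Pn; exists i0.
  move=> D /WS DS; rewrite orbC (subset_trans DS) //.
  by apply: subset_trans S'S _; apply: subD1set.
- move=> A /setU1P[-> //|/WS AS]; apply: subset_trans AS _.
  by apply: subset_trans S'S _; apply: subD1set.
- by move=> A /setU1P[->|AW]; [rewrite eqxx|case: eqP => // _; apply: mu0].
move=> i; rewrite big_setU1 //= eqxx.
have -> : v i = v i1 *+ (i \in S) + v' i by rewrite /v' addrC subrK.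
rewrite vE; congr (_ + _); apply: eq_bigr => A AW.
by case: eqP => // e; rewrite -e AW in SW.
Qed.

Variable G : {set {set {set I}}}.
Hypothesis gG : good G.
Local Notation nest := (nested (C1 n) G).

(** Greedy choice: take a maximal [K] of [G] inside [W] through the lightest [A0], and subtract
    [mu A0] along [K]. Adding [K] keeps the family nested, for an antichain through [K] with union
    in [G] would have union [K] by maximality. *)
Lemma nested_decomposition W (mu : {set I} -> R) :
  flag W -> (forall A, A \in W -> 0 < mu A) ->
  exists N (la : {set {set I}} -> R),
  [/\ nest N, cover N = W, forall b, b \in N -> 0 < la b
    & forall A, A \in W -> mu A = \sum_(b in N) la b *+ (A \in b)].
Proof.
move: {2}#|W| (leqnn #|W|) => k.
elim: k W mu => [|k IH] W mu ck fW mu0; have [W0|/set0Pn[A1 A1W]] := eqVneq W set0.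
- exists set0, (fun=> 0); rewrite /cover big_set0 W0.
  by split=> // [|A|A]; rewrite ?inE //; apply: nested_set0.
- by move: ck; rewrite leqn0 cards_eq0 => /eqP e; rewrite e inE in A1W.
- exists set0, (fun=> 0); rewrite /cover big_set0 W0.
  by split=> // [|A|A]; rewrite ?inE //; apply: nested_set0.
have [A0 A0W' hmin] := arg_minP mu A1W.
have A0W : A0 \in W by [].
have [A0n A0T] := fW.1 _ A0W.
have pA0 : ([set A0] \in G) && ([set A0] \subset W).
  rewrite sub1set A0W andbT; case: gG => _ /subsetP AG _; apply: AG.
  by apply/A1P; exists A0.
have [K /maxsetP[/andP[KG KW] Kmax] A0K] :=
  @maxset_exists _ (fun b => (b \in G) && (b \subset W)) _ pA0.
rewrite sub1set in A0K.
pose mu' A := mu A - mu A0 *+ (A \in K).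
pose W' := [set A in W | mu' A != 0].
have W'W : W' \subset W by apply/subsetP => A; rewrite inE => /andP[].
have mu'0 A : A \in W' -> 0 < mu' A.
  rewrite inE => /andP[AW ne]; rewrite lt0r ne /= /mu'.
  by case: (A \in K); rewrite ?subr0 ?subr_ge0 ?hmin // ltW // mu0.
have {}A0W' : A0 \notin W' by rewrite inE /mu' A0K subrr eqxx andbF.
have cW' : (#|W'| <= k)%N.
  rewrite -ltnS; apply: leq_trans _ ck; apply: proper_card.
  by apply/properP; split=> //; exists A0.
have [N [la [nN cN la0 muE]]] := IH W' mu' cW' (flagS fW W'W) mu'0.
have KN : K \notin N.
  apply: contra A0W' => KN; rewrite -cN; apply/bigcupP; by exists K.
have cE : cover (K |: N) = W.
  rewrite /cover big_setU1 //= -[\bigcup_(_ in _) _]/(cover N) cN.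
  apply/eqP; rewrite eqEsubset subUset KW W'W /=; apply/subsetP => A AW.
  rewrite !inE AW /= /mu'; case: (boolP (A \in K)) => //= _.
  by rewrite subr0 gt_eqF // mu0.
exists (K |: N), (fun b => if b == K then mu A0 else la b); split=> //.
- apply/nestedP; split.
    apply/subsetP => b /setU1P[-> //|]; exact: (nested_mem nN).
  move=> F FN aF; case: (boolP (K \in F)) => [KF|KF]; last first.
    have FN' : F \subset N.
      apply/subsetP => M MF; have /setU1P[e|//] := subsetP FN _ MF.
      by move: KF; rewrite -e MF.
    by have [_ h] := nestedP _ _ nN; apply: h.
  have FW : cover F \subset W.
    rewrite -cE; apply/bigcupsP => M MF; apply: bigcup_sup.
    exact: (subsetP FN).
  split; first exact: flagS fW FW.
  apply/negP => FG; have [c hF] := antichainP _ aF.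
  have FK : cover F = K.
    by apply: Kmax; [rewrite FG|apply: bigcup_sup].
  have /card_gt1P[X [Y [XF YF XY]]] := c.
  case/negP: XY; apply/eqP.
  have sub M : M \in F -> M = K.
    by move=> MF; apply: hF => //; rewrite -FK; apply: bigcup_sup.
  by rewrite (sub X) // (sub Y).
- by move=> b /setU1P[->|bN]; [rewrite eqxx mu0|case: eqP => // _; [apply: mu0|apply: la0]].
move=> A AW; rewrite big_setU1 //= eqxx.
have -> : mu A = mu A0 *+ (A \in K) + mu' A by rewrite /mu' addrC subrK.
congr (_ + _).
have -> : \sum_(b in N) (if b == K then mu A0 else la b) *+ (A \in b) =
          \sum_(b in N) la b *+ (A \in b).
  by apply: eq_bigr => b bN; case: eqP => // e; rewrite -e bN in KN.
case: (boolP (A \in W')) => AW'; first exact: muE.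
rewrite big1 => [|b bN].
  by apply/eqP; apply: contraR AW' => ne; rewrite inE AW.
case: (boolP (A \in b)) => // Ab; case/negP: AW'; rewrite -cN.
by apply/bigcupP; exists b.
Qed.

Lemma cone_decomposition (w : I -> R) :
  exists (k : R) N (la : {set {set I}} -> R),
  [/\ nest N, forall b, b \in N -> 0 < la b
    & forall i, w i = k + \sum_(b in N) la b *+ #|[set A in b | i \in A]|].
Proof.
have [i0 _ hmin] := @arg_minP _ _ _ ord0 xpredT w isT.
(* Subtracting the minimum uses up the constant [k] and leaves a proper support. *)
pose v i := w i - w i0.
have v0 i : 0 <= v i by rewrite subr_ge0 hmin.
have vT : [set i | v i != 0] != setT.
  by rewrite -subTset; apply/subsetPn; exists i0; rewrite ?inE // negbK /v subrr.
have [W [mu [fW _ mu0 vE]]] := level_decomposition v0 vT.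
have [N [la [nN cN la0 muE]]] := nested_decomposition fW mu0.
exists (w i0), N, la; split=> // i.
have -> : w i = w i0 + v i by rewrite /v addrC subrK.
congr (_ + _); rewrite vE.
rewrite (eq_bigr (fun A => \sum_(b in N) la b *+ (A \in b) *+ (i \in A))); last first.
  by move=> A AW; rewrite muE // sumrMnl.
rewrite exchange_big /=; apply: eq_bigr => b bN.
rewrite -sum1_card -sumrMnr big_mkcond [RHS]big_mkcond /=; apply: eq_bigr => A _.
rewrite inE; case: (boolP (A \in b)) => Ab /=; last first.
  by rewrite mul0rn if_same.
have -> : A \in W by rewrite -cN; apply/bigcupP; exists b.
by rewrite mulr1n; case: (i \in A).
Qed.

End ConeDecomposition.

From mathcomp Require Import boolp classical_sets reals.
Import fintype finset.

(** * Scalar products, convex hulls and Minkowski sums *)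

Section Convexity.
Variables (R : realType) (m : nat).
Local Notation E := 'rV[R]_m.
Implicit Types (x y z u v : E) (S P Q : set E).

Lemma dotpC u v : dotp u v = dotp v u.
Proof. by apply: eq_bigr => i _; rewrite mulrC. Qed.

Lemma dotpDr u x y : dotp u (x + y) = dotp u x + dotp u y.
Proof. by rewrite -big_split; apply: eq_bigr => i _; rewrite mxE mulrDr. Qed.

Lemma dotpZr u a x : dotp u (a *: x) = a * dotp u x.
Proof. by rewrite mulr_sumr; apply: eq_bigr => i _; rewrite mxE mulrCA. Qed.

Lemma dotpNr u x : dotp u (- x) = - dotp u x.
Proof. by rewrite -scaleN1r dotpZr mulN1r. Qed.

Lemma dotpBr u x y : dotp u (x - y) = dotp u x - dotp u y.
Proof. by rewrite dotpDr dotpNr. Qed.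

Lemma dotp0r u : dotp u 0 = 0.
Proof. by rewrite -(scale0r 0) dotpZr mul0r. Qed.

Lemma dotp_sumr (T : Type) (r : seq T) (p : pred T) (f : T -> E) u :
  dotp u (\sum_(t <- r | p t) f t) = \sum_(t <- r | p t) dotp u (f t).
Proof.
elim/big_rec2: _ => [|t a b _ <-]; first exact: dotp0r.
exact: dotpDr.
Qed.

Lemma dotpDl u x y : dotp (x + y) u = dotp x u + dotp y u.
Proof. by rewrite ![dotp _ u]dotpC dotpDr. Qed.

Lemma dotpZl u a x : dotp (a *: x) u = a * dotp x u.
Proof. by rewrite ![dotp _ u]dotpC dotpZr. Qed.

Lemma dotpNl u x : dotp (- x) u = - dotp x u.
Proof. by rewrite ![dotp _ u]dotpC dotpNr. Qed.

Lemma dotp_suml (T : Type) (r : seq T) (p : pred T) (f : T -> E) u :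
  dotp (\sum_(t <- r | p t) f t) u = \sum_(t <- r | p t) dotp (f t) u.
Proof. by rewrite dotpC dotp_sumr; apply: eq_bigr => t _; rewrite dotpC. Qed.

Lemma dotp_delta v j : dotp v (delta_mx 0 j) = v 0 j.
Proof.
rewrite /dotp (bigD1 j) //= !mxE !eqxx mulr1 big1 ?addr0 // => k kj.
by rewrite !mxE (negPf kj) andbF mulr0.
Qed.

Lemma dotpp_gt0 x : x != 0 -> 0 < dotp x x.
Proof.
move=> x0; rewrite lt0r sumr_ge0 ?andbT => [|i _]; last by rewrite -expr2 sqr_ge0.
apply: contraNneq x0 => /psumr_eq0P h; apply/eqP/rowP => i; rewrite mxE.
by apply/eqP; rewrite -sqrf_eq0 expr2 h // => j _; rewrite -expr2 sqr_ge0.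
Qed.

Definition convex S := forall x y (t : R), S x -> S y -> 0 <= t <= 1 ->
  S (t *: x + (1 - t) *: y).

Lemma convex_convhull S : convex (convhull S).
Proof.
move=> x y t [m1 [p1 [w1 [S1 pos1 sum1 ->]]]] [m2 [p2 [w2 [S2 pos2 sum2 ->]]]].
move=> /andP[t0 t1].
exists (m1 + m2)%N, (fun i => match fintype.split i with inl j => p1 j | inr j => p2 j end),
  (fun i => match fintype.split i with inl j => t * w1 j | inr j => (1 - t) * w2 j end).
split.
- by move=> i; case: (fintype.split i).
- by move=> i; case: (fintype.split i) => j; rewrite mulr_ge0 // subr_ge0.
- rewrite big_split_ord /=.
  rewrite (eq_bigr (fun j => t * w1 j)) => [|j _]; last by rewrite (unsplitK (inl j)).
  rewrite [X in _ + X](eq_bigr (fun j => (1 - t) * w2 j)) => [|j _]; last first.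
    by rewrite (unsplitK (inr j)).
  by rewrite -!mulr_sumr sum1 sum2 !mulr1 addrC subrK.
rewrite big_split_ord /= !scaler_sumr; congr (_ + _); apply: eq_bigr => j _.
  by rewrite (unsplitK (inl j)) scalerA.
by rewrite (unsplitK (inr j)) scalerA.
Qed.

Lemma sub_convhull S x : S x -> convhull S x.
Proof.
move=> Sx; exists 1%N, (fun=> x), (fun=> 1); split=> //; rewrite big_ord1 //.
by rewrite scale1r.
Qed.

Lemma convhull_ge S u h : (forall p, S p -> h <= dotp u p) ->
  forall x, convhull S x -> h <= dotp u x.
Proof.
move=> hS _ [k [p [w [Sp w0 w1 ->]]]]; rewrite dotp_sumr -[h]mul1r -w1 mulr_suml.
by apply: ler_sum => i _; rewrite dotpZr ler_wpM2l ?hS.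
Qed.

Lemma convhull_eq S u h : (forall p, S p -> dotp u p = h) ->
  forall x, convhull S x -> dotp u x = h.
Proof.
move=> hS x Sx; apply/eqP; rewrite eq_le; apply/andP; split; last first.
  by apply: convhull_ge Sx => p /hS ->.
rewrite -lerN2 -dotpNl; apply: convhull_ge Sx => p /hS.
by rewrite dotpNl => ->.
Qed.

Lemma msum_convex P Q : convex P -> convex Q -> convex (msum P Q).
Proof.
move=> cP cQ _ _ t [x1 Px1 [x2 Qx2 ->]] [y1 Py1 [y2 Qy2 ->]] t01.
exists (t *: x1 + (1 - t) *: y1); first exact: cP.
exists (t *: x2 + (1 - t) *: y2); first exact: cQ.
by rewrite !scalerDr addrACA.
Qed.

Lemma set1_convex : convex [set (0 : E)]%classic.
Proof. by move=> _ _ t -> -> _; rewrite !scaler0 addr0. Qed.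

Lemma big_msum_convex (T : finType) (p : pred T) (F : T -> set E) :
  (forall t, p t -> convex (F t)) -> convex (\big[@msum R m/[set 0]%classic]_(t | p t) F t).
Proof.
move=> h; elim/big_rec: _ => [|t P pt cP]; first exact: set1_convex.
by apply: msum_convex => //; apply: h.
Qed.

Lemma big_msumP (T : finType) (p : pred T) (F : T -> set E) x :
  (\big[@msum R m/[set 0]%classic]_(t | p t) F t) x <->
  exists2 f : T -> E, forall t, p t -> F t (f t) & x = \sum_(t | p t) f t.
Proof.
have gen (s : seq T) : uniq s -> forall x,
    (\big[@msum R m/[set 0]%classic]_(t <- s | p t) F t) x <->
    exists2 f : T -> E, forall t, t \in s -> p t -> F t (f t) & x = \sum_(t <- s | p t) f t.
  elim: s => [_|t s IH /= /andP[ts us]] {}x.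
    rewrite !big_nil; split=> [->|[f _ ->]]; last by rewrite big_nil.
    by exists (fun=> 0) => //; rewrite big_nil.
  rewrite big_cons; case: ifPn => pt; split.
  - case=> y Fy [z /(IH us)[f hf ->] ->].
    exists (fun t' => if t' == t then y else f t').
      move=> t'; rewrite inE; case: eqP => [-> //|_] /=; exact: hf.
    rewrite big_cons pt eqxx; congr (_ + _); rewrite big_seq_cond [RHS]big_seq_cond.
    by apply: eq_bigr => t' /andP[t's _]; case: eqP => // e; rewrite -e t's in ts.
  - case=> f hf ->; rewrite big_cons pt; exists (f t); first by apply: hf; rewrite ?mem_head.
    exists (\sum_(t <- s | p t) f t) => //; apply/(IH us); exists f => // t' t's.
    by apply: hf; rewrite inE t's orbT.
  - move/(IH us) => [f hf ->]; exists f; last by rewrite big_cons (negPf pt).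
    move=> t'; rewrite inE => /orP[/eqP -> |]; [by rewrite (negPf pt)|exact: hf].
  - case=> f hf ->; rewrite big_cons (negPf pt); apply/(IH us); exists f => // t' t's.
    by apply: hf; rewrite inE t's orbT.
have g y := gen (index_enum T) (index_enum_uniq T) y; split=> [/g[f hf ->]|[f hf ->]].
  by exists f => // t; apply: hf; rewrite mem_index_enum.
by apply/g; exists f => // t _; apply: hf.
Qed.

End Convexity.

(** The form in which complementary slackness is used below. *)
Lemma sum_le_eq (R : realDomainType) (T : finType) (p : pred T) (f g : T -> R) :
  (forall t, p t -> f t <= g t) -> \sum_(t | p t) g t <= \sum_(t | p t) f t ->
  forall t, p t -> f t = g t.
Proof.
move=> le sle t pt; apply/eqP; rewrite eq_sym -subr_eq0.
have /psumr_eq0P : forall t, p t -> 0 <= g t - f t by move=> s ps; rewrite subr_ge0 le.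
move=> h; rewrite h //; apply/eqP; rewrite sumrB subr_eq0 eq_le sle /=.
exact: ler_sum.
Qed.

Section Values.
Variables (R : realType) (n : nat).
Local Notation I := 'I_n.+1.
Local Notation E := 'rV[R]_n.+1.
Implicit Types (A D : {set I}) (W b c M : {set {set I}}) (N F G : {set {set {set I}}}).
Implicit Types (x y z u v : E).

Definition mass A x : R := \sum_(i in A) x 0 i.
Definition cval b x : R := \sum_(A in b) mass A x.
Definition csum x : R := \sum_i x 0 i.
Definition ev b : E := \row_i (#|[set A in b | i \in A]|)%:R.
Definition one : E := const_mx 1.

Lemma dotp_one x : dotp one x = csum x.
Proof. by apply: eq_bigr => i _; rewrite mxE mul1r. Qed.

Lemma dotp_ev b x : dotp (ev b) x = cval b x.
Proof.
rewrite /cval /mass /dotp.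
under [RHS]eq_bigr do rewrite big_mkcond.
rewrite exchange_big /=; apply: eq_bigr => i _; rewrite mxE mulr_natl.
rewrite -sum1_card -sumrMnr big_mkcond [RHS]big_mkcond /=; apply: eq_bigr => A _.
by rewrite inE; case: (A \in b); case: (i \in A).
Qed.

Lemma cvalD b x y : cval b (x + y) = cval b x + cval b y.
Proof. by rewrite -!dotp_ev dotpDr. Qed.
Lemma cvalZ b a x : cval b (a *: x) = a * cval b x.
Proof. by rewrite -!dotp_ev dotpZr. Qed.
Lemma cvalB b x y : cval b (x - y) = cval b x - cval b y.
Proof. by rewrite -!dotp_ev dotpBr. Qed.
Lemma cval_sum (T : Type) (r : seq T) (p : pred T) (f : T -> E) b :
  cval b (\sum_(t <- r | p t) f t) = \sum_(t <- r | p t) cval b (f t).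
Proof. by rewrite -dotp_ev dotp_sumr; apply: eq_bigr => t _; rewrite dotp_ev. Qed.
Lemma csumD x y : csum (x + y) = csum x + csum y.
Proof. by rewrite -!dotp_one dotpDr. Qed.
Lemma csumZ a x : csum (a *: x) = a * csum x.
Proof. by rewrite -!dotp_one dotpZr. Qed.
Lemma csumB x y : csum (x - y) = csum x - csum y.
Proof. by rewrite -!dotp_one dotpBr. Qed.
Lemma csum_sum (T : Type) (r : seq T) (p : pred T) (f : T -> E) :
  csum (\sum_(t <- r | p t) f t) = \sum_(t <- r | p t) csum (f t).
Proof. by rewrite -dotp_one dotp_sumr; apply: eq_bigr => t _; rewrite dotp_one. Qed.
Lemma csum_delta i : csum (delta_mx 0 i : E) = 1.
Proof. by rewrite -dotp_one dotp_delta mxE. Qed.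
Lemma cval_set1 A x : cval [set A] x = mass A x.
Proof. by rewrite /cval big_set1. Qed.

End Values.

(** * Polytopes with prescribed normal fan *)

Section NestedPolytope.
Variables (R : realType) (n : nat).
Local Notation I := 'I_n.+1.
Local Notation E := 'rV[R]_n.+1.
Implicit Types (A D : {set I}) (W b c M : {set {set I}}) (N F G : {set {set {set I}}}).
Implicit Types (x y z u v : E) (h : {set {set I}} -> R) (tot : R).

Definition poly G h tot : set E :=
  [set x | csum x = tot /\ forall b, b \in G -> h b <= cval b x]%classic.

Definition nested_realised G h (S : set E) : Prop :=
  forall N, nested (C1 n) G N -> exists2 x, S x &
    forall b, b \in G -> (cval b x == h b) = (b \in N).

Lemma poly_convex G h tot : convex (poly G h tot).
Proof.
move=> x y t [tx hx] [ty hy] /andP[t0 t1]; split.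
  by rewrite csumD !csumZ tx ty -mulrDl addrC subrK mul1r.
move=> b bG; rewrite cvalD !cvalZ.
have -> : h b = t * h b + (1 - t) * h b by rewrite -mulrDl addrC subrK mul1r.
by rewrite lerD // ler_wpM2l ?hx ?hy // subr_ge0.
Qed.

Lemma nested_realised_weak G h (S : set E) : convex S ->
  (forall x b, S x -> b \in G -> h b <= cval b x) ->
  (forall N, nested (C1 n) G N -> exists2 x, S x &
     forall b, b \in N -> cval b x = h b) ->
  (forall N b0, nested (C1 n) G N -> b0 \in G -> b0 \notin N ->
     exists2 x, S x & (forall b, b \in N -> cval b x = h b) /\ h b0 < cval b0 x) ->
  nested_realised G h S.
Proof.
move=> cS hS base strict N nN.
have [x0 Qx0 x0N] := base N nN.
pose tight x := [set b in G | cval b x == h b].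
have ind k x : (#|tight x| <= k)%N -> S x -> (forall b, b \in N -> cval b x = h b) ->
    exists2 y, S y & forall b, b \in G -> (cval b y == h b) = (b \in N).
  elim: k x => [|k IH] x ck Qx xN;
    (case: (boolP [exists b in G, (cval b x == h b) && (b \notin N)]) => [|/exists_inPn none];
    last by (exists x => // b bG; have := none _ bG; rewrite negb_and negbK;
         case: (boolP (b \in N)) => [/xN ->|_]; rewrite ?eqxx // orbF => /negPf)).
    case/exists_inP => b bG /andP[bt _]; move: ck; rewrite leqn0 cards_eq0 => /eqP e.
    have : b \in tight x by rewrite inE bG bt.
    by rewrite e inE.
  case/exists_inP => b bG /andP[bt bN].
  have [y Qy [yN yb]] := strict N b nN bG bN.
  have val_mid b' : cval b' (2^-1 *: x + (1 - 2^-1) *: y) = (cval b' x + cval b' y) / 2.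
    by rewrite cvalD !cvalZ; lra.
  apply: (IH (2^-1 *: x + (1 - 2^-1) *: y)).
  - rewrite -ltnS; apply: leq_trans ck; apply: proper_card; apply/properP; split.
      apply/subsetP => b'; rewrite !inE val_mid => /andP[b'G /eqP e].
      rewrite b'G /=; apply/eqP; have := hS _ _ Qx b'G; have := hS _ _ Qy b'G; lra.
    exists b; rewrite !inE ?bG ?bt // val_mid /=.
    by move/eqP: bt => bt; apply/negP => /eqP; lra.
  - apply: cS => //; lra.
  - by move=> b' b'N; rewrite val_mid xN // yN //; lra.
exact: ind (leqnn _) Qx0 x0N.
Qed.

Variable G : {set {set {set I}}}.
Hypothesis gG : good G.
Local Notation nest := (nested (C1 n) G).

(** The normal cone at the face of [N]: it is generated by the line of [one] and the vectors
    [- ev b], with a minus sign because [poly] bounds [cval] from below whereas normal cones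
    maximise. *)
Definition sigma N : set E :=
  [set u | exists (k : R) (la : {set {set I}} -> R),
    (forall b, b \in N -> 0 <= la b) /\ u = k *: one R n - \sum_(b in N) la b *: ev R b]%classic.

Lemma cone_vector u : exists (k : R) N (la : {set {set I}} -> R),
  [/\ nest N, forall b, b \in N -> 0 < la b
    & u = k *: one R n - \sum_(b in N) la b *: ev R b].
Proof.
have [k [N [la [nN la0 e]]]] := cone_decomposition gG (fun i => - u 0 i).
exists (- k), N, la; split=> //; apply/rowP => i; rewrite !mxE mulr1 summxE.
apply: oppr_inj; rewrite e opprB opprK addrC; congr (_ + _).
by apply: eq_bigr => b _; rewrite !mxE mulr_natr.
Qed.

Lemma dotp_cone k N (la : {set {set I}} -> R) x :
  dotp (k *: one R n - \sum_(b in N) la b *: ev R b) x =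
  k * csum x - \sum_(b in N) la b * cval b x.
Proof.
rewrite dotpDl dotpZl dotp_one dotpNl dotp_suml; congr (_ - _).
by apply: eq_bigr => b _; rewrite dotpZl dotp_ev.
Qed.

Variables (h : {set {set I}} -> R) (tot : R).
Local Notation Q := (poly G h tot).
Definition face_of N : set E := [set x | Q x /\ forall b, b \in N -> cval b x = h b]%classic.

Lemma dotp_cone_le k N (la : {set {set I}} -> R) x : N \subset G -> 
  (forall b, b \in N -> 0 <= la b) -> Q x ->
  dotp (k *: one R n - \sum_(b in N) la b *: ev R b) x <=
  k * tot - \sum_(b in N) la b * h b.
Proof.
move=> /subsetP NG la0 [tx hx]; rewrite dotp_cone tx lerD2l lerN2.
by apply: ler_sum => b bN; rewrite ler_wpM2l ?la0 ?hx ?NG.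
Qed.

Lemma dotp_cone_eq k N (la : {set {set I}} -> R) x : Q x ->
  (forall b, b \in N -> cval b x = h b) ->
  dotp (k *: one R n - \sum_(b in N) la b *: ev R b) x =
  k * tot - \sum_(b in N) la b * h b.
Proof.
move=> [tx hx] xN; rewrite dotp_cone tx; congr (_ - _).
by apply: eq_bigr => b bN; rewrite xN.
Qed.

Lemma dotp_cone_face k N (la : {set {set I}} -> R) x : N \subset G ->
  (forall b, b \in N -> 0 < la b) -> Q x ->
  k * tot - \sum_(b in N) la b * h b <=
    dotp (k *: one R n - \sum_(b in N) la b *: ev R b) x ->
  forall b, b \in N -> cval b x = h b.
Proof.
move=> /subsetP NG la0 [tx hx]; rewrite dotp_cone tx lerD2l lerN2 => le b bN.
have /(_ _ b bN) e := sum_le_eq (p := mem N) (f := fun b => la b * h b)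
  (g := fun b => la b * cval b x) _ le.
have {}e : la b * h b = la b * cval b x.
  by apply: e => c cN; rewrite ler_wpM2l ?hx ?NG // ltW // la0.
by apply/esym/(mulfI _ e); rewrite gt_eqF // la0.
Qed.

Hypothesis real : nested_realised G h Q.

Lemma realising_points : exists xp : {set {set {set I}}} -> E, forall N, nest N ->
  Q (xp N) /\ forall b, b \in G -> (cval b (xp N) == h b) = (b \in N).
Proof.
have /choice [xp hxp] : forall N, exists x, nest N -> Q x /\
    forall b, b \in G -> (cval b x == h b) = (b \in N).
  move=> N; case: (boolP (nest N)) => [/real[x Qx xN]|nN]; first by exists x.
  by exists 0.
by exists xp.
Qed.

(** The functional [w] is maximal exactly where all of [T] is tight, in particular at [x]. It lies
    in the cone of a nested [N], so [xp N] maximises it too; hence [T] is tight at [xp N] and is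
    contained in [N]. *)
Lemma active_nested x : Q x -> nest [set b in G | cval b x == h b].
Proof.
move=> Qx; set T := [set b in G | _].
have [xp hxp] := realising_points.
pose w := - \sum_(b in T) ev R b.
have [k [N [la [nN la0 wE]]]] := cone_vector w.
have NG : N \subset G by case/(nestedP G): nN.
have TG : T \subset G by apply/subsetP => b; rewrite inE => /andP[].
have [Qp pN] := hxp _ nN.
have tp b : b \in N -> cval b (xp N) = h b.
  by move=> bN; apply/eqP; rewrite pN // (subsetP NG).
have dw y : dotp w y = - \sum_(b in T) cval b y.
  by rewrite dotpNl dotp_suml; congr (- _); apply: eq_bigr => b _; rewrite dotp_ev.
have le : dotp w x <= dotp w (xp N).
  rewrite wE (dotp_cone_eq k la Qp tp); apply: dotp_cone_le => // b bN.
  by rewrite ltW // la0.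
rewrite !dw lerN2 in le.
apply: nested_sub nN _; apply/subsetP => b bT; have bG := subsetP TG _ bT.
rewrite -(pN _ bG); apply/eqP/esym.
apply: (sum_le_eq (p := mem T) (f := h) (g := fun b => cval b (xp N))) bT.
  by move=> c cT; apply: Qp.2; apply: (subsetP TG).
apply: le_trans le _; apply: ler_sum => c; rewrite inE => /andP[_ /eqP ->].
exact: lexx.
Qed.

(* Moving away from the point realising the active constraints of x activates a
   further constraint, whence poly G h tot is the convex hull of those points. *)
Lemma poly_sub_convex (xp : {set {set {set I}}} -> E) (S : set E) :
  (forall N, nest N -> Q (xp N) /\ forall b, b \in G -> (cval b (xp N) == h b) = (b \in N)) ->
  convex S -> (forall N, nest N -> S (xp N)) -> forall x, Q x -> S x.
Proof.
move=> hxp cS Sxp x; pose T x := [set b in G | cval b x == h b].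
move: {2}(#|G| - #|T x|)%N (leqnn (#|G| - #|T x|)%N) => k.
have TG y : T y \subset G by apply/subsetP => b; rewrite inE => /andP[].
(* Expand one factor of the square of [y - z] in a nested cone: the multiple of [one] vanishes
   because both points have the same sum, so positivity forces a negative value on some [ev b]. *)
have away y z : Q y -> Q z -> y != z -> exists2 b, b \in G & cval b (y - z) < 0.
  move=> Qy Qz yz; have [k' [N [la [nN la0 e]]]] := cone_vector (y - z).
  have NG : N \subset G by case/(nestedP G): nN.
  have := dotpp_gt0 (_ : y - z != 0); rewrite subr_eq0 => /(_ yz).
  rewrite {1}e dotp_cone csumB Qy.1 Qz.1 subrr mulr0 sub0r oppr_gt0 => neg.
  apply/exists_inP; apply: contraLR neg => /exists_inPn pos.
  rewrite -leNgt sumr_ge0 // => b bN; rewrite mulr_ge0 //; first by rewrite ltW // la0.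
  by rewrite leNgt pos // (subsetP NG).
elim: k x => [|k IH] x ck Qx; have nT := active_nested Qx; have [Qz zT] := hxp _ nT;
  set z := xp _ in Qz zT; (have [->|xz] := eqVneq x z; first exact: Sxp);
  have {}zT b : b \in T x -> cval b z = h b by
    (move=> bT; apply/eqP; rewrite zT // (subsetP (TG x))).
  have [b bG] := away _ _ Qx Qz xz; rewrite cvalB subr_lt0 zT ?ltNge ?Qx.2 //.
  move: ck; rewrite leqn0 subn_eq0 => le.
  by have -> : T x = G by apply/eqP; rewrite eqEcard TG.
have [b0 b0G b0neg] := away _ _ Qx Qz xz.
pose neg b := (b \in G) && (cval b (x - z) < 0).
(* How far one can go from [x] in the direction [x - z] before the inequality of [b] becomes tight;
   the least such value gives the exit point [y]. *)
pose q b := (cval b x - h b) / - cval b (x - z).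
have p0 : neg b0 by rewrite /neg b0G.
have [b1 /andP[b1G b1neg] hmin] := arg_minP q p0.
have q0 : 0 <= q b1.
  by rewrite divr_ge0 // ?subr_ge0 ?Qx.2 // oppr_ge0 ltW.
pose y := x + q b1 *: (x - z).
have valy b : cval b y = cval b x + q b1 * cval b (x - z) by rewrite /y cvalD cvalZ.
have Qy : Q y.
  split; first by rewrite csumD csumZ csumB Qx.1 Qz.1 subrr mulr0 addr0.
  move=> b bG; rewrite valy; case: (ltP (cval b (x - z)) 0) => sg.
    have := hmin b; rewrite /neg bG sg => /(_ isT).
    rewrite {2}/q ler_pdivlMr ?oppr_gt0 // mulrN => le.
    by move: (q b1 * _) le => a le; lra.
  by rewrite -[h b]addr0 lerD ?Qx.2 // mulr_ge0.
have xE : x = (1 + q b1)^-1 *: y + (1 - (1 + q b1)^-1) *: z.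
  have nz : 1 + q b1 != 0 by rewrite gt_eqF // ltr_wpDr.
  have -> : 1 - (1 + q b1)^-1 = (1 + q b1)^-1 * q b1 by field.
  rewrite -scalerA -scalerDr /y.
  rewrite (_ : _ + q b1 *: z = (1 + q b1) *: x); first by rewrite scalerA mulVf // scale1r.
  by rewrite scalerDl scale1r scalerBr addrA subrK.
rewrite xE; apply: cS; last first.
- by rewrite invr_ge0 invf_le1 ?ltr_wpDr // addr_ge0 //= lerDl.
- exact: Sxp.
apply: IH Qy; rewrite -ltnS; apply: leq_trans ck.
have lt : (#|T x| < #|T y|)%N.
  apply: proper_card; apply/properP; split.
    apply/subsetP => b bT; have bG := subsetP (TG x) _ bT; rewrite inE bG valy.
    move: bT (zT _ bT); rewrite inE => /andP[_ /eqP xb] zb.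
    by rewrite cvalB xb zb subrr mulr0 addr0 /=.
  exists b1.
    rewrite inE b1G valy /q /=; apply/eqP; field; by rewrite lt_eqF.
  by apply/negP => /[dup] /zT zb; rewrite inE => /andP[_ /eqP xb]; move: b1neg;
    rewrite cvalB xb zb subrr ltxx.
by rewrite ltn_sub2l // (leq_trans lt) // subset_leq_card.
Qed.

End NestedPolytope.

(** * Face lattice, normal fan and dimension of [poly] *)

Section Consequences.
Variables (R : realType) (n : nat).
Local Notation I := 'I_n.+1.
Local Notation E := 'rV[R]_n.+1.
Implicit Types (A D : {set I}) (W b c M : {set {set I}}) (N F G : {set {set {set I}}}).
Implicit Types (x y z u v : E) (h : {set {set I}} -> R).

Variable G : {set {set {set I}}}.
Hypothesis gG : good G.
Local Notation nest := (nested (C1 n) G).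
Variables (h : {set {set I}} -> R) (tot : R).
Local Notation Q := (poly G h tot).
Hypothesis real : nested_realised G h Q.

Lemma poly_polytope : polytope Q.
Proof.
have [xp hxp] := realising_points real.
exists [seq xp N | N <- enum [set N | nest N]]; split.
  have : finset.set0 \in enum [set N | nest N] by rewrite mem_enum inE nested_set0.
  by case: (enum _).
apply/seteqP; split=> x.
  apply: (poly_sub_convex gG real hxp); first exact: convex_convhull.
  move=> N nN; apply: sub_convhull => /=; apply/mapP; exists N => //.
  by rewrite mem_enum inE.
have pt p : p \in [seq xp N | N <- enum [set N | nest N]] -> Q p.
  by case/mapP=> N; rewrite mem_enum inE => /hxp[Qp _] ->.
move=> hx; split.
  rewrite -dotp_one; apply: convhull_eq hx => p /pt[tp _].
  by rewrite dotp_one.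
move=> b bG; rewrite -dotp_ev; apply: convhull_ge hx => p /pt[_ hp].
by rewrite dotp_ev hp.
Qed.

(** The points of [S] that realise the nested sets also serve as the realising points of [Q], and
    these generate [Q]. *)
Lemma convex_eq_poly (S : set E) : convex S -> (forall x, S x -> Q x) ->
  nested_realised G h S -> S = Q.
Proof.
move=> cS SQ rS.
have /choice[xp hxp] : forall N, exists x, nest N -> S x /\
    forall b, b \in G -> (cval b x == h b) = (b \in N).
  move=> N; case: (boolP (nest N)) => [/rS[x Sx xN]|nN]; first by exists x.
  by exists 0.
apply/seteqP; split=> x; first exact: SQ.
apply: (poly_sub_convex gG real (xp := xp)) => // [N nN|N nN].
  by have [Sx xN] := hxp _ nN; split=> //; apply: SQ.
by have [Sx _] := hxp _ nN.
Qed.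

Lemma face_of_face N : nest N -> nonempty_face Q (face_of G h tot N).
Proof.
move=> nN; have [xp hxp] := realising_points real; have [Qp pN] := hxp _ nN.
have NG : N \subset G by case/(nestedP G): nN.
have tp b : b \in N -> cval b (xp N) = h b.
  by move=> bN; apply/eqP; rewrite pN // (subsetP NG).
split; last by exists (xp N).
exists (0 *: one R n - \sum_(b in N) 1 *: ev R b), (0 * tot - \sum_(b in N) 1 * h b).
split=> [z Qz|]; first exact: (dotp_cone_le 0 (la := fun=> 1) NG).
apply/seteqP; split=> x [Qx hx]; split=> //.
  exact: (dotp_cone_eq 0 (fun=> 1) Qx).
by apply: (dotp_cone_face (k := 0) (la := fun=> 1) NG _ Qx) => //; rewrite -hx.
Qed.

(** When [u] is expanded in the cone of [N] with positive coefficients, its maximum over [Q] is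
    attained exactly where all inequalities of [N] are tight. *)
Lemma nonempty_faceP (T : set E) : nonempty_face Q T -> exists2 N, nest N & T = face_of G h tot N.
Proof.
case=> -[u [k [Qk ->]]] [z [Qz zk]].
have [xp hxp] := realising_points real.
have [a [N [la [nN la0 uE]]]] := cone_vector gG u.
have NG : N \subset G by case/(nestedP G): nN.
have [Qp pN] := hxp _ nN.
have tp b : b \in N -> cval b (xp N) = h b.
  by move=> bN; apply/eqP; rewrite pN // (subsetP NG).
have la0' b : b \in N -> 0 <= la b by move=> bN; rewrite ltW // la0.
have kE : k = a * tot - \sum_(b in N) la b * h b.
  apply/eqP; rewrite eq_le; apply/andP; split.
    by rewrite -zk uE; apply: (dotp_cone_le a NG la0' Qz).
  by rewrite -(dotp_cone_eq a la Qp tp) -uE Qk.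
exists N => //; apply/seteqP; split=> x [Qx hx]; split=> //.
  by apply: (dotp_cone_face (k := a) NG la0 Qx); rewrite -uE hx kE.
by rewrite kE uE; apply: (dotp_cone_eq a la Qx hx).
Qed.

Lemma face_of_sub N N' : nest N ->
  (forall b, b \in N' -> b \in G) ->
  ((face_of G h tot N `<=` face_of G h tot N')%classic <-> N' \subset N).
Proof.
move=> nN N'G; have [xp hxp] := realising_points real; have [Qp pN] := hxp _ nN.
split=> [s|/subsetP s x [Qx xN]]; last by split=> // b /s; apply: xN.
have [|_ pN'] := s (xp N).
  by split=> // b bN; apply/eqP; rewrite pN // (nested_mem nN).
by apply/subsetP => b bN'; rewrite -pN ?N'G // pN'.
Qed.

Lemma poly_realises : realises Q (nested_complex (C1 n) G).
Proof.
exists (face_of G h tot); split.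
- by move=> X; rewrite inE; apply: face_of_face.
- by move=> T /nonempty_faceP[N nN ->]; exists N; rewrite ?inE.
move=> X Y; rewrite !inE => nX nY; apply: face_of_sub => //.
by move=> b; apply: nested_mem nY.
Qed.

(** A functional normal to the face of [N] lies in the cone of some nested [M]; being maximal at
    [xp N], it forces [M \subset N]. The right-hand side mentions neither [h] nor [tot], whence all
    normal equivalences. *)
Lemma normal_fan_poly : normal_fan Q = [set @sigma R n N | N in [set N | nest N]%classic]%classic.
Proof.
have [xp hxp] := realising_points real.
have coneE N : nest N -> normal_cone Q (face_of G h tot N) = @sigma R n N.
  move=> nN; have NG : N \subset G by case/(nestedP G): nN.
  have [Qp pN] := hxp _ nN.
  have tp b : b \in N -> cval b (xp N) = h b.
    by move=> bN; apply/eqP; rewrite pN // (subsetP NG).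
  apply/seteqP; split=> u.
    move=> hu; have [a [M [la [nM la0 uE]]]] := cone_vector gG u.
    have MG : M \subset G by case/(nestedP G): nM.
    have [Qm pM] := hxp _ nM.
    have tm b : b \in M -> cval b (xp M) = h b.
      by move=> bM; apply/eqP; rewrite pM // (subsetP MG).
    have MN : M \subset N.
      apply/subsetP => b bM; rewrite -pN ?(subsetP MG) //; apply/eqP.
      apply: (dotp_cone_face (k := a) MG la0 Qp) bM.
      by rewrite -(dotp_cone_eq a la Qm tm) -uE; apply: hu.
    exists a, (fun b => if b \in M then la b else 0); split.
      by move=> b _; case: ifP => // bM; rewrite ltW // la0.
    rewrite uE; congr (_ - _); rewrite big_mkcond [RHS]big_mkcond /=.
    apply: eq_bigr => b _; case: (boolP (b \in M)) => [/(subsetP MN) -> //|_].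
    by rewrite scale0r if_same.
  move=> [a [la [la0 ->]]] y [Qy yN] z Qz.
  by rewrite (dotp_cone_eq a la Qy yN); apply: (dotp_cone_le a NG la0 Qz).
apply/seteqP; split=> K [].
  by move=> T hT <-; have [N nN ->] := nonempty_faceP hT; exists N; rewrite ?coneE.
by move=> N nN <-; exists (face_of G h tot N); [apply: face_of_face|apply: coneE].
Qed.

(** The point of the empty nested set satisfies all inequalities strictly, so short steps from it
    along the [n] independent directions [d i] stay in [Q]. *)
Lemma poly_dim : affine_dim Q n.
Proof.
have [xp hxp] := realising_points real; have [Qp p0] := hxp _ (nested_set0 G).
set p := xp _ in Qp p0.
have pos b : b \in G -> 0 < cval b p - h b.
  move=> bG; rewrite subr_gt0 lt_neqAle Qp.2 // andbT eq_sym p0 //.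
  by rewrite inE.
have [e e0 he] := finite_lower_bound pos.
pose d (i : 'I_n) : E := delta_mx 0 (lift ord_max i) - delta_mx 0 ord_max.
have de b i : - cval b (d i) <= (#|b|)%:R.
  rewrite -dotp_ev dotpBr opprB lerBlDr.
  rewrite !dotp_delta !mxE -natrD ler_nat (leq_trans _ (leq_addr _ _)) // subset_leq_card //.
  by apply/subsetP => A; rewrite inE => /andP[].
(* Exceeds every [#|b|], which bounds the loss of [cval b] along [d i]; so a step [e / K] costs at
   most the common slack [e]. *)
pose K := (#|{set I}|.+1)%:R : R.
have K0 : 0 < K by rewrite ltr0n.
pose t : R := e / K.
have t0 : 0 < t by rewrite divr_gt0.
have tb b : b \in G -> t * (#|b|)%:R <= cval b p - h b.
  move=> bG; apply: le_trans (he _ bG); rewrite /t -mulrA -[X in _ <= X]mulr1.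
  rewrite ler_wpM2l ?(ltW e0) // mulrC ler_pdivrMr // mul1r ler_nat ltnW //.
  by rewrite ltnS; apply: max_card.
pose m := \matrix_(i < n, j < n.+1) (t * ((j == lift ord_max i)%:R - (j == ord_max)%:R)).
have rowm i : row i m = t *: d i.
  by apply/rowP => j; rewrite !mxE.
exists p, m; split=> //.
- apply/row_freeP; exists (\matrix_(j < n.+1, k < n) (t^-1 * (j == lift ord_max k)%:R)).
  apply/matrixP => i k; rewrite !mxE (bigD1 (lift ord_max k)) //= big1 ?addr0 => [|j jk].
    rewrite !mxE !(inj_eq lift_inj) [_ == ord_max]eq_sym (negPf (neq_lift _ _)) subr0.
    by rewrite eqxx [k == i]eq_sym mulr1 mulrAC mulfV ?mul1r // gt_eqF.
  by rewrite !mxE (negPf jk) !mulr0.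
- move=> i; rewrite rowm; split.
    by rewrite csumD csumZ Qp.1 csumB !csum_delta subrr mulr0 addr0.
  move=> b bG; rewrite cvalD cvalZ; have := tb _ bG; have := de b i.
  move=> /(ler_wpM2l (ltW t0)); rewrite mulrN; lra.
move=> x Qx; apply/submxP; exists (\row_i ((x - p) 0 (lift ord_max i) / t)).
apply/rowP => j; rewrite [RHS]mxE.
case: (unliftP ord_max j) => [k ->|->].
  rewrite (bigD1 k) //= big1 ?addr0 => [|i ik].
    rewrite !mxE eqxx [_ == ord_max]eq_sym (negPf (neq_lift _ _)) subr0 mulr1.
    by rewrite divfK ?gt_eqF.
  rewrite !mxE (inj_eq lift_inj) [k == i]eq_sym (negPf ik) [_ == ord_max]eq_sym.
  by rewrite (negPf (neq_lift _ _)) subr0 !mulr0.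
have /eqP : csum (x - p) = 0 by rewrite csumB Qx.1 Qp.1 subrr.
rewrite /csum (bigD1_ord ord_max) //= addr_eq0 => /eqP ->.
rewrite -sumrN; apply: eq_bigr => i _; rewrite !mxE eqxx (negPf (neq_lift _ _)) sub0r.
by rewrite mulrA divfK ?gt_eqF // mulrN1.
Qed.

End Consequences.

(** * Truncations *)

Section Facets.
Variables (R : realType) (m : nat).
Local Notation E := 'rV[R]_m.

Lemma row_free_col_mx d (a v : E) (M : 'M[R]_(d, m)) : row_free M ->
  (forall i, dotp a (row i M) = 0) -> dotp a v != 0 -> row_free (col_mx v M).
Proof.
move=> fM aM av; apply: inj_row_free => w; rewrite -(hsubmxK w) mul_row_col.
set w1 : 'rV_1 := lsubmx w; set w2 := rsubmx w => e.
have w10 : w1 = 0.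
  have : dotp a (w1 *m v + w2 *m M) = 0 by rewrite e dotp0r.
  rewrite dotpDr (mx11_scalar w1) mul_scalar_mx dotpZr mulmx_sum_row dotp_sumr.
  rewrite big1 => [|i _]; last by rewrite dotpZr aM mulr0.
  move/eqP; rewrite addr0 mulf_eq0 (negPf av) orbF => /eqP ->.
  by apply/matrixP => i j; rewrite !mxE mul0rn.
move: e; rewrite w10 mul0mx add0r => e.
have -> : w2 = 0 by apply: (row_free_inj fM); rewrite e mul0mx.
by rewrite row_mx0.
Qed.

(** [P] leaves the affine hull of [F] in two independent directions: [y] violates the second
    equation but not the first, and [z] violates the first. So the dimensions differ by at least
    2. *)
Lemma two_equations_not_facet (P F : set E) (a1 a2 : E) (k1 k2 : R) y z :
  (forall x, F x -> dotp a1 x = k1 /\ dotp a2 x = k2) -> (forall x, F x -> P x) ->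
  P y -> dotp a1 y = k1 -> dotp a2 y != k2 -> P z -> dotp a1 z != k1 -> ~ facet P F.
Proof.
move=> hF FP Py y1 y2 Pz z1 [_ [d [[q0 [M' [fM' Pq0 _ PM']]] [p0 [M [fM Fp0 FM _]]]]]].
have [p1 p2] := hF _ Fp0.
have M1 i : dotp a1 (row i M) = 0.
  by have [] := hF _ (FM i); rewrite dotpDr p1 -[X in _ = X -> _]addr0 => /addrI.
have M2 i : dotp a2 (row i M) = 0.
  by have [_] := hF _ (FM i); rewrite dotpDr p2 -[X in _ = X -> _]addr0 => /addrI.
have free2 : row_free (col_mx (y - p0) M).
  by apply: (@row_free_col_mx _ a2) => //; rewrite dotpBr p2 subr_eq0.
have free1 : row_free (col_mx (z - p0) (col_mx (y - p0) M)).
  apply: (@row_free_col_mx _ a1) => [//|i|]; last by rewrite dotpBr p1 subr_eq0.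
  rewrite -(splitK i); case: (fintype.split i) => j /=.
    by rewrite rowKu row_id dotpBr p1 y1 subrr.
  by rewrite rowKd.
have sub x : P x -> (x - p0 <= M')%MS.
  move=> Px; have -> : x - p0 = (x - q0) - (p0 - q0) by rewrite opprB addrA subrK.
  by apply: addmx_sub; [|rewrite eqmx_opp]; apply: PM' => //; apply: FP.
have : (\rank (col_mx (z - p0) (col_mx (y - p0) M)) <= \rank M')%N.
  apply: mxrankS; rewrite !col_mx_sub !sub //=; apply/row_subP => i.
  have -> : row i M = (p0 + row i M) - p0 by rewrite addrC addKr.
  by apply/sub/FP/FM.
by rewrite (eqP free1) (eqP fM') /= ltnn.
Qed.

End Facets.

Section Truncation.
Variables (R : realType) (n : nat).
Local Notation I := 'I_n.+1.
Local Notation E := 'rV[R]_n.+1.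
Implicit Types (A D : {set I}) (W b c M : {set {set I}}) (N F G : {set {set {set I}}}).
Implicit Types (x y z u v : E) (h : {set {set I}} -> R).

Variables (G : {set {set {set I}}}) (b0 : {set {set I}}).
Variables (h : {set {set I}} -> R) (tot : R).
Hypothesis gG : good G.
Hypothesis gG' : good (b0 |: G).
Hypothesis b0G : b0 \notin G.
Hypothesis cb0 : (1 < #|b0|)%N.
Hypothesis minb0 : forall c, c \in G -> c \subset b0 -> (#|c| <= 1)%N.
Hypothesis hb0 : h b0 = \sum_(A in b0) h [set A].
Local Notation Q := (poly G h tot).
Hypothesis real : nested_realised G h Q.

Let fb0 : flag b0.
Proof. by apply: B1_flag; case: gG' => /subsetP s _ _; apply: s; rewrite !inE eqxx. Qed.

Let pt_in A : A \in b0 -> [set A] \in G.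
Proof.
move=> Ab; case: gG => _ /subsetP AG _; apply: AG; apply/A1P; exists A.
by have [? ?] := fb0.1 _ Ab.
Qed.

Let b0_le x : Q x -> h b0 <= cval b0 x.
Proof.
move=> [_ hx]; rewrite hb0; apply: ler_sum => A Ab.
by rewrite -cval_set1 hx // pt_in.
Qed.

(** By [hb0] the inequality of [b0] is the sum of the inequalities of its points, so it is tight
    exactly on the face to be truncated. *)
Let b0_tight x : Q x -> cval b0 x = h b0 <-> forall c, c \in points_of b0 -> cval c x = h c.
Proof.
move=> Qx; split=> [e c /points_ofP[A Ab ->]|hx].
  apply/esym; rewrite cval_set1; apply: (sum_le_eq (p := mem b0) (f := fun A => h [set A])
    (g := fun A => mass A x)) Ab => [D Db|]; first by rewrite -cval_set1 Qx.2 // pt_in.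
  by rewrite -hb0 -e.
rewrite hb0; apply: eq_bigr => A Ab; rewrite -cval_set1 hx //.
by apply/points_ofP; exists A.
Qed.

Let antichain_points : antichain (points_of b0) /\ finset.cover (points_of b0) = b0.
Proof.
split; last first.
  apply/setP => A; apply/bigcupP/idP => [[c /points_ofP[D Db ->]]|Ab].
    by move/set1P ->.
  by exists [set A]; [apply/points_ofP; exists A|rewrite inE].
apply/antichainP; split; first by rewrite card_imset //; apply: set1_inj.
move=> X Y /points_ofP[A Ab ->] /points_ofP[D Db ->].
by rewrite finset.sub1set => /set1P ->.
Qed.

(** The points of [b0] form an antichain with union [b0], so a nested set for [b0 |: G] cannot
    contain all of them. *)
Let strict_b0 N x : nested (C1 n) (b0 |: G) N -> b0 \notin N -> Q x ->
  (forall b, b \in G -> (cval b x == h b) = (b \in N)) -> h b0 < cval b0 x.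
Proof.
move=> nN b0N Qx xN; rewrite lt_neqAle b0_le // andbT eq_sym.
apply/negP => /eqP /(b0_tight Qx) tight.
have [aP cP] := antichain_points.
have PN : points_of b0 \subset N.
  apply/subsetP => c cb; have /points_ofP[A Ab ce] := cb.
  by rewrite -xN ?tight // ce pt_in.
have [_ hN] := nestedP _ _ nN; have [_] := hN _ PN aP.
by rewrite cP !inE eqxx.
Qed.

Lemma truncation_exists : exists U T : set E,
  [/\ truncation Q U T, polytope T
    & normal_fan T = [set @sigma R n N | N in [set N | nested (C1 n) (b0 |: G) N]%classic]%classic].
Proof.
have [xp hxp] := realising_points real.
pose P N := nested (C1 n) G N && (h b0 < cval b0 (xp N)).
(* A common lower bound for the gaps of the realising points off the face; half of it places the
   cutting hyperplane strictly between these points and the face. *)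
have [e e0 he] : exists2 e : R, 0 < e & forall N, P N -> e <= cval b0 (xp N) - h b0.
  by apply: finite_lower_bound => N /andP[_]; rewrite subr_gt0.
pose k := h b0 + e / 2.
have kh : h b0 < k by rewrite /k; lra.
pose h' b := if b == b0 then k else h b.
pose T := (Q `&` [set x | k <= dotp (ev R b0) x])%classic.
have TE : T = poly (b0 |: G) h' tot.
  apply/seteqP; split=> x.
    case=> -[tx hx] /=; rewrite dotp_ev => kx; split=> // b /setU1P[->|bG].
      by rewrite /h' eqxx.
    by rewrite /h'; case: eqP => [->|_]; rewrite ?hx.
  move=> [tx hx]; split; [split=> // b bG|rewrite /= dotp_ev].
    have := hx b; rewrite /h' inE bG orbT => /(_ isT); case: eqP => // e'.
    by move: b0G; rewrite -e' bG.
  by have := hx b0; rewrite /h' eqxx setU11 => /(_ isT).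
have h'G b : b \in G -> h' b = h b.
  by rewrite /h'; case: eqP => // ->; rewrite (negPf b0G).
have nP : nested (C1 n) G (points_of b0).
  have := @nested_points _ _ gG finset.set0 b0 gG' b0G minb0 fb0.
  rewrite finset.set0U finset.setU0; apply; last by rewrite inE.
  by apply: nested_set1; rewrite setU11.
have real' : nested_realised (b0 |: G) h' (poly (b0 |: G) h' tot).
  rewrite -TE => N nN; case: (boolP (b0 \in N)) => b0N; last first.
    have nN' := nested_setU1 nN b0N; have [Qx xN] := hxp _ nN'.
    have lt := strict_b0 nN b0N Qx xN.
    have := he N; rewrite /P nN' lt => /(_ isT) le.
    have ltk : k < cval b0 (xp N) by rewrite /k; lra.
    exists (xp N); first by split=> //=; rewrite dotp_ev ltW.
    move=> b /setU1P[->|bG]; last by rewrite h'G // xN.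
    by rewrite /h' eqxx (negPf b0N) gt_eqF.
  pose N1 := N :\ b0.
  have NE : b0 |: N1 = N by rewrite finset.setD1K.
  have b0N1 : b0 \notin N1 by rewrite !inE eqxx.
  have nN1' : nested (C1 n) (b0 |: G) N1 by apply: nested_sub nN _; apply: finset.subD1set.
  have nN1 := nested_setU1 nN1' b0N1.
  have nN2 : nested (C1 n) G (N1 :|: points_of b0).
    by apply: nested_points => //; rewrite NE.
  have [Q1 x1N] := hxp _ nN1; have [Q2 x2N] := hxp _ nN2.
  set x1 := xp N1 in Q1 x1N; set x2 := xp _ in Q2 x2N.
  have lt := strict_b0 nN1' b0N1 Q1 x1N.
  have := he N1; rewrite /P nN1 lt => /(_ isT); rewrite -/x1 => le.
  have x2b0 : cval b0 x2 = h b0.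
    apply/(b0_tight Q2) => c cb; apply/eqP; rewrite x2N; first by rewrite inE cb orbT.
    by have /points_ofP[A Ab ->] := cb; apply: pt_in.
  pose g := cval b0 x1 - h b0.
  (* The gap to [h b0] is [g] at [x1] and 0 at [x2], so this weight makes it [e / 2]: the
     interpolated point lies on the cutting hyperplane. *)
  pose s := e / 2 / g.
  have g0 : 0 < g by rewrite subr_gt0.
  have s0 : 0 < s by rewrite !divr_gt0.
  have s1 : s < 1 by rewrite ltr_pdivrMr // mul1r /g; lra.
  have Qx : Q (s *: x1 + (1 - s) *: x2) by apply: poly_convex => //; lra.
  have xb0 : cval b0 (s *: x1 + (1 - s) *: x2) = k.
    rewrite cvalD !cvalZ x2b0 /k; have -> : e / 2 = s * g by rewrite divfK ?gt_eqF.
    by rewrite /g; ring.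
  exists (s *: x1 + (1 - s) *: x2); first by split=> //=; rewrite dotp_ev xb0.
  move=> b /setU1P[->|bG]; first by rewrite xb0 /h' !eqxx b0N.
  have bb0 : b != b0 by apply: contraTneq bG => ->.
  have -> : (b \in N) = (b \in N1) by rewrite !inE bb0.
  rewrite h'G // cvalD !cvalZ -x1N //.
  have le1 := Q1.2 _ bG; have le2 := Q2.2 _ bG.
  (* What is tight at [x1] is tight at [x2], since [N1] is part of the nested set of [x2]; the extra
     inequalities tight at [x2] are lost in the interpolation. *)
  case: (boolP (cval b x1 == h b)) => [e1|ne1].
    have /eqP -> : cval b x2 == h b by rewrite x2N // inE -x1N // e1.
    by rewrite (eqP e1) -mulrDl addrC subrK mul1r eqxx.
  apply/negbTE; rewrite gt_eqF //.
  have lt1 : h b < cval b x1 by rewrite lt_neqAle eq_sym ne1 le1.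
  have -> : h b = s * h b + (1 - s) * h b by rewrite -mulrDl addrC subrK mul1r.
  by rewrite ltr_leD // ?ltr_pM2l // ler_wpM2l // subr_ge0 ltW.
exists (face_of G h tot (points_of b0)), T; rewrite TE.
have polT := poly_polytope gG' real'.
have fanT := normal_fan_poly gG' real'.
split=> //.
have [A [A' [Ab Ab' AA']]] := card_gt1P cb0.
have inP D : D \in b0 -> [set D] \in points_of b0 by move=> Db; apply/points_ofP; exists D.
have [Q0 x0N] := hxp _ (nested_set0 G).
have ne0 D : D \in b0 -> cval [set D] (xp finset.set0) != h [set D].
  by move=> Db; rewrite x0N ?pt_in // inE.
split.
- exact: (face_of_face real nP).
- move=> e'; have : face_of G h tot (points_of b0) (xp finset.set0) by rewrite e'.
  by case=> _ /(_ _ (inP _ Ab)) /eqP; rewrite (negPf (ne0 _ Ab)).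
(* Two members of [b0] give two equations of the face; the points of [{{A}}] and of the empty nested
   set show that they are independent on [Q]. *)
- have [QA xAN] := hxp _ (nested_set1 (pt_in Ab)).
  apply: (@two_equations_not_facet _ _ _ _ (ev R [set A]) (ev R [set A']) (h [set A]) (h [set A'])
     (xp [set [set A]]) (xp finset.set0)) => //.
  + by move=> x [Qx hx]; rewrite !dotp_ev !hx // inP.
  + by move=> x [].
  + by rewrite dotp_ev; apply/eqP; rewrite xAN ?pt_in // inE.
  + rewrite dotp_ev xAN ?pt_in // inE; apply: contra AA' => /eqP/set1_inj ->.
    exact: eqxx.
  + by rewrite dotp_ev ne0.
- exact: polT.
exists (ev R b0), k; split.
- have [/set0Pn[i iA] _] := fb0.1 _ Ab.
  apply/eqP => /rowP /(_ i); rewrite !mxE => /eqP; rewrite pnatr_eq0 cards_eq0 => /eqP e'.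
  have : A \in [set A in b0 | i \in A] by rewrite inE Ab.
  by rewrite e' inE.
- by rewrite -TE.
(* A vertex is the face of some [N], so it is [xp N] and the bound [e] applies to it. *)
- move=> v fv nF; have [|N nN vE] := nonempty_faceP gG real (T := [set v]%classic).
    by split=> //; exists v.
  have [Qx xN] := hxp _ nN.
  have vx : v = xp N.
    have : face_of G h tot N (xp N).
      by split=> // b bN; apply/eqP; rewrite xN // (nested_mem nN).
    by rewrite -vE => ->.
  rewrite dotp_ev vx.
  have lt : h b0 < cval b0 (xp N).
    rewrite lt_neqAle b0_le // andbT eq_sym; apply/negP => /eqP /(b0_tight Qx) tight.
    by apply: nF; rewrite vx; split.
  by have := he N; rewrite /P nN lt => /(_ isT) le; rewrite /k; lra.
move=> v [u [d [_ vE]]]; have : face_of G h tot (points_of b0) v.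
  by have : [set v]%classic v by []; rewrite vE => -[].
case=> Qv hv; rewrite dotp_ev; have /(b0_tight Qv) -> := hv.
by apply/negP; rewrite -ltNge.
Qed.

End Truncation.

(** * The Minkowski summands *)

Section Summands.
Variables (R : realType) (n : nat).
Local Notation I := 'I_n.+1.
Local Notation E := 'rV[R]_n.+1.
Implicit Types (A B D : {set I}) (W b c M : {set {set I}}) (N F G : {set {set {set I}}}).
Implicit Types (x y z u v : E) (r : I -> nat).

Local Notation "''d_' i" := (delta_mx 0 i : E) (at level 8, i at level 2).

Lemma mass_delta A i : mass A 'd_i = (i \in A)%:R.
Proof.
rewrite -cval_set1 -dotp_ev dotp_delta mxE; congr (_%:R).
have -> : [set D in [set A] | i \in D] = if i \in A then [set A] else finset.set0.
  by apply/setP => D; case: ifP => iA; rewrite !inE; case: eqP => // ->.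
by case: (i \in A); rewrite ?cards1 ?cards0.
Qed.

Lemma mass_sum (T : Type) (s : seq T) (p : pred T) (f : T -> E) A :
  mass A (\sum_(t <- s | p t) f t) = \sum_(t <- s | p t) mass A (f t).
Proof. by rewrite -cval_set1 cval_sum; apply: eq_bigr => t _; rewrite cval_set1. Qed.

Lemma simplex_delta B i : i \in B -> simplex B 'd_i.
Proof. by move=> iB; apply: sub_convhull; exists i. Qed.

Lemma simplex_coord_ge0 B x i : simplex B x -> 0 <= x 0 i.
Proof.
rewrite -dotp_delta dotpC; apply: convhull_ge => _ [j _ <-].
by rewrite dotp_delta mxE ler0n.
Qed.

Lemma simplex_out B x i : simplex B x -> i \notin B -> x 0 i = 0.
Proof.
move=> Bx iB; rewrite -dotp_delta dotpC; apply: convhull_eq Bx => _ [j jB <-].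
by rewrite dotp_delta mxE eqxx; case: eqP => // e; rewrite -e (jB : j \in B) in iB.
Qed.

Lemma simplex_csum B x : simplex B x -> csum x = 1.
Proof.
rewrite -dotp_one; apply: convhull_eq => _ [j _ <-]; by rewrite dotp_one csum_delta.
Qed.

Lemma simplex_mass A B x : simplex B x -> (B \subset A)%:R <= mass A x.
Proof.
move=> Bx; case: (boolP (B \subset A)) => BA /=; last first.
  by apply: sumr_ge0 => i _; apply: simplex_coord_ge0 Bx.
rewrite -(simplex_csum Bx) /csum (bigID (mem A)) /= [X in _ + X]big1 ?addr0 // => i iA.
by apply: simplex_out Bx _; apply: contra iA; apply: (subsetP BA).
Qed.

Lemma simplex_convex B : convex (@simplex R n.+1 B).
Proof. exact: convex_convhull. Qed.

Definition inside b A : nat := #|[set B in Bsub b | B \subset A]|.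

Lemma insideE b A : (inside b A)%:R = \sum_(B in Bsub b) (B \subset A)%:R :> R.
Proof.
rewrite /inside -sum1_card -natr_sum; congr (_%:R).
rewrite big_mkcond [RHS]big_mkcond; apply: eq_bigr => B _.
by rewrite inE; case: (B \in Bsub b); case: (B \subset A).
Qed.

Lemma PBsub_mass b A x : PBsub b x -> (inside b A)%:R <= mass A x.
Proof.
case/big_msumP => f hf ->; rewrite insideE mass_sum; apply: ler_sum => B BB.
exact/simplex_mass/hf.
Qed.

Lemma PBsub_csum b x : PBsub b x -> csum x = #|Bsub b|%:R.
Proof.
case/big_msumP => f hf ->; rewrite csum_sum -sum1_card natr_sum.
by apply: eq_bigr => B BB; apply: simplex_csum (hf _ BB).
Qed.

Definition bvertex b (f : {set I} -> I) : E := \sum_(B in Bsub b) 'd_(f B).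

Lemma PBsub_bvertex b f : (forall B, B \in Bsub b -> f B \in B) -> PBsub b (bvertex b f).
Proof.
move=> hf; apply/big_msumP; exists (fun B => 'd_(f B)) => // B /hf.
exact: simplex_delta.
Qed.

Lemma mass_bvertex b f A : mass A (bvertex b f) = \sum_(B in Bsub b) (f B \in A)%:R.
Proof. by rewrite mass_sum; apply: eq_bigr => B _; rewrite mass_delta. Qed.

(** A functional exposing [v] is maximised by choosing in each simplex a vertex with the largest
    coefficient; uniqueness of the maximiser identifies the sum of these with [v]. *)
Lemma vertices_PBsub b v : vertices (PBsub b) v ->
  exists2 f, forall B, B \in Bsub b -> f B \in B & v = bvertex b f.
Proof.
case=> u [k [Pk vE]]; have [Pv vk] : PBsub b v /\ dotp u v = k.
  by have : [set v]%classic v by []; rewrite vE.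
pose f B := odflt ord0 [pick i in B | [forall j in B, u 0 j <= u 0 i]].
have hf B : B != finset.set0 -> f B \in B /\ forall j, j \in B -> u 0 j <= u 0 (f B).
  move=> /set0Pn[i0 i0B]; rewrite /f; case: pickP => [i /andP[iB /forall_inP]|] //=.
  have [i iB h] := arg_maxP (fun i => u 0 i) i0B.
  by move/(_ i); rewrite (iB : i \in B) /= => /forall_inPn[j /h /= ->].
have fB B : B \in Bsub b -> f B \in B by move=> /Bsub_neq0 /hf[].
exists f => //; suff : [set v]%classic (bvertex b f) by move=> ->.
rewrite vE; split; first exact: PBsub_bvertex.
apply/eqP; rewrite eq_le; apply/andP; split; first by apply/Pk/PBsub_bvertex.
rewrite -vk.
have [g hg ->] := (big_msumP _ _ _).1 Pv; rewrite /bvertex !dotp_sumr.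
apply: ler_sum => B BB; rewrite dotp_delta -[leRHS]mulr1 -(simplex_csum (hg _ BB)).
rewrite /csum mulr_sumr; apply: ler_sum => i _.
have [_ fmax] := hf _ (Bsub_neq0 BB); have := simplex_coord_ge0 i (hg _ BB).
case: (boolP (i \in B)) => iB ge0; first by rewrite ler_wpM2r // fmax.
by rewrite (simplex_out (hg _ BB) iB) !mulr0.
Qed.

(** Injectivity of [r] makes the maximiser of the functional [- r] unique on every simplex, hence on
    the sum. *)
Lemma vertices_first b r : injective r -> vertices (PBsub b) (bvertex b (first r)).
Proof.
move=> rI; have fB B : B \in Bsub b -> first r B \in B.
  by move=> BB; have [] := firstP r (Bsub_neq0 BB).
pose u : E := \row_i - (r i)%:R.
have Ple B x : B \in Bsub b -> simplex B x -> dotp u x <= dotp u 'd_(first r B) /\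
    (dotp u x = dotp u 'd_(first r B) -> x = 'd_(first r B)).
  move=> BB Bx; have [_ fmin] := firstP r (Bsub_neq0 BB).
  have le i : u 0 i * x 0 i <= u 0 (first r B) * x 0 i.
    case: (boolP (i \in B)) => iB; last by rewrite (simplex_out Bx iB) !mulr0.
    rewrite ler_wpM2r ?(simplex_coord_ge0 _ Bx) // !mxE lerN2 ler_nat; exact: fmin.
  have rhs : dotp u 'd_(first r B) = \sum_i u 0 (first r B) * x 0 i.
    by rewrite dotp_delta -mulr_sumr -/(csum x) (simplex_csum Bx) mulr1.
  split; first by rewrite rhs; apply: ler_sum.
  rewrite rhs => e; have x0 i : i != first r B -> x 0 i = 0.
    move=> neq; have := sum_le_eq (p := xpredT) (f := fun i => u 0 i * x 0 i)
      (g := fun i => u 0 (first r B) * x 0 i) (fun i _ => le i) _ (t := i) isT.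
    rewrite -e lexx => /(_ isT) /eqP; rewrite -subr_eq0 -mulrBl mulf_eq0.
    case/orP=> [|/eqP //]; rewrite !mxE opprK addrC subr_eq0 eqr_nat.
    by move/eqP/rI/esym/eqP; rewrite (negPf neq).
  apply/rowP => i; rewrite mxE eqxx /=; case: eqP => [->|/eqP /x0 //].
  by rewrite -(simplex_csum Bx) /csum (bigD1 (first r B)) //= big1 ?addr0.
exists u, (dotp u (bvertex b (first r))); split.
  move=> z /big_msumP[f hf ->]; rewrite /bvertex !dotp_sumr; apply: ler_sum => B BB.
  exact: (Ple _ _ BB (hf _ BB)).1.
apply/seteqP; split=> [x ->|x [/big_msumP[f hf ->]]].
  by split=> //; apply: PBsub_bvertex.
rewrite /bvertex !dotp_sumr => e; apply: eq_bigr => B BB.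
apply: (Ple _ _ BB (hf _ BB)).2.
apply: (sum_le_eq (p := mem (Bsub b)) (f := fun B => dotp u (f B))
  (g := fun B => dotp u 'd_(first r B))) BB => [D DB|]; last by rewrite e.
exact: (Ple _ _ DB (hf _ DB)).1.
Qed.

Lemma vertices_sub (P : set E) v : vertices P v -> P v.
Proof. by case=> u [k [_ vE]]; have : [set v]%classic v by []; rewrite vE => -[]. Qed.

Lemma Fsub_vertices b v : vertices (PBsub b) v -> Fsub b v -> b != finset.set0 ->
  vertices (Fsub b) v.
Proof.
move=> [u [k [Pk vE]]] Fv /set0Pn[A Ab]; exists u, k; split.
  by move=> z /(_ A Ab) [Pz _]; apply: Pk.
apply/seteqP; split=> x.
  move=> ->; split=> //; have : [set v]%classic v by []; by rewrite vE => -[].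
by case=> /(_ A Ab) [Px _] xk; rewrite vE.
Qed.

Lemma not_Fsub b v : PBsub b v -> ~ Fsub b v ->
  exists2 A, A \in b & mass A v != (inside b A)%:R.
Proof.
move=> Pv nF; apply/exists_inP; apply: contra_notT nF => /exists_inPn h A Ab.
by split=> //=; have /negbNE/eqP := h A Ab.
Qed.

Lemma Nsub_vertex_mass b c v : (vertices (PBsub b) `\` vertices (Fsub b))%classic v ->
  b != finset.set0 ->
  ((\sum_(A in c) inside b A + (b \subset c))%N)%:R <= cval c v.
Proof.
move=> [Pv nF] b0; have PBv := vertices_sub Pv.
have [A Ab ne] : exists2 A, A \in b & mass A v != (inside b A)%:R.
  by apply: not_Fsub PBv _ => Fv; apply: nF; apply: Fsub_vertices.
have [f fB vE] := vertices_PBsub Pv.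
have lt : (inside b A).+1%:R <= mass A v.
  have massE : mass A v = (\sum_(B in Bsub b) (f B \in A))%N%:R.
    by rewrite vE mass_bvertex natr_sum.
  have := PBsub_mass A PBv; move: ne; rewrite massE eqr_nat !ler_nat => ne le.
  by rewrite ltn_neqAle eq_sym ne.
rewrite natrD natr_sum; case: (boolP (b \subset c)) => bc; last first.
  by rewrite addr0; apply: ler_sum => D _; apply: PBsub_mass.
have Ac := subsetP bc _ Ab.
rewrite /cval (bigD1 A) //= [leRHS](bigD1 A) //= addrAC lerD //.
  by rewrite -natrD addn1.
by apply: ler_sum => D _; apply: PBsub_mass.
Qed.

Lemma Nsub_cval b c x : Nsub b x -> b != finset.set0 ->
  ((\sum_(A in c) inside b A + (b \subset c))%N)%:R <= cval c x.
Proof.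
move=> Nx b0; rewrite -dotp_ev; apply: convhull_ge Nx => p hp.
by rewrite dotp_ev; apply: Nsub_vertex_mass.
Qed.

Lemma Nsub_csum b x : Nsub b x -> csum x = #|Bsub b|%:R.
Proof.
rewrite -dotp_one; apply: convhull_eq => p [/vertices_sub Pp _].
by rewrite dotp_one; apply: PBsub_csum.
Qed.

Lemma mass_first b r D : upset r D -> mass D (bvertex b (first r)) = (inside b D)%:R.
Proof.
move=> uD; rewrite mass_bvertex insideE; apply: eq_bigr => B BB.
by rewrite (first_upset uD) ?(Bsub_neq0 BB).
Qed.

Lemma Nsub_first b r : b \in B1 n -> injective r -> ~~ [forall A in b, upset r A] ->
  (vertices (PBsub b) `\` vertices (Fsub b))%classic (bvertex b (first r)).
Proof.
move=> bB rI nu; split; first exact: vertices_first.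
move=> /vertices_sub Fv.
have [A [B [Ab BB fA nBA]]] := Bsub_not_upset bB rI nu.
have [Pv] := Fv A Ab; rewrite /= -/(mass A _) => e.
have lt : (inside b A)%:R < mass A (bvertex b (first r)).
  rewrite mass_bvertex insideE (bigD1 B) //= [ltRHS](bigD1 B) //= (negPf nBA) fA.
  rewrite ltr_leD // ?ltr01 //; apply: ler_sum => D /andP[DB _]; rewrite ler_nat.
  case: (boolP (D \subset A)) => //= /subsetP -> //.
  by have [] := firstP r (Bsub_neq0 DB).
by rewrite e ltxx in lt.
Qed.

Lemma Nsub_swap b r A : b \in B1 n -> injective r -> (forall D, D \in b -> upset r D) ->
  A \in b -> exists2 x : E, Nsub b x &
    forall D, upset r D -> mass D x = (inside b D)%:R + (D == A)%:R.
Proof.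
move=> bB rI ub Ab; have [A0 AT] := (B1_flag bB).1 _ Ab.
have [r' [a [o [r'I [aA oA ao] nuA up hB]]]] := swap_order rI (ub _ Ab) A0 AT.
exists (bvertex b (first r')).
  by apply/sub_convhull/Nsub_first => //; apply/forall_inPn; exists A.
move=> D uD; case: (eqVneq D A) => [->|DA]; last first.
  by rewrite addr0 mass_first //; have [] := up _ uD DA.
have oB : o |: A \in Bsub b.
  apply: Bsub_setU1 => // X Xb AX neq; apply: (up _ (ub _ Xb) _).2 => //.
  by rewrite eq_sym.
(* After the transposition, [o |: A] is the only set that contributes to the mass on [A] without
   being included in [A]: this is the unit gained. *)
have firstE B : B \in Bsub b -> (first r' B \in A) = (B \subset A) || (B == o |: A).
  move=> BB; have Bn0 := Bsub_neq0 BB.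
  have [fB fmin] := firstP r' Bn0.
  case: (boolP (B \subset A)) => [/subsetP -> //|nBA] /=.
  apply/idP/eqP => [fA|Be].
    have [aB oB' BoA] := hB _ Bn0 fA nBA.
    exact: Bsub_setU1_uniq BB aB oB' BoA.
  apply: contraT => nf; have fo : first r' B = o.
    by move: fB; rewrite {2}Be => /setU1P[//|fA]; rewrite fA in nf.
  by have := fmin a; rewrite fo Be !inE aA orbT leqNgt ao => /(_ isT).
rewrite mass_bvertex insideE (bigD1 (o |: A)) //= [X in _ = X + _](bigD1 (o |: A)) //=.
rewrite firstE // eqxx orbT finset.subUset finset.sub1set (negPf oA) /= add0r addrC; congr (_ + _).
apply: eq_bigr => B /andP[BB neq]; by rewrite firstE // (negPf neq) orbF.
Qed.

End Summands.

(** * The partial sums and the points realising nested sets *)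

Section MinkowskiSums.
Variables (R : realType) (n : nat).
Local Notation I := 'I_n.+1.
Local Notation E := 'rV[R]_n.+1.
Implicit Types (A B D : {set I}) (W b c M : {set {set I}}) (N F G T : {set {set {set I}}}).
Implicit Types (x y z u v : E) (r : I -> nat).

Local Notation "''d_' i" := (delta_mx 0 i : E) (at level 8, i at level 2).

Definition summand b : set E :=
  if #|b| == 1 then simplex (finset.cover b) else Nsub b.

(** The bound on [cval c] before a face is removed; [low] adds the unit enforced by replacing
    [PBsub b] with [Nsub b]. *)
Definition low0 b c : nat :=
  if #|b| == 1 then #|[set A in c | finset.cover b \subset A]|
  else \sum_(A in c) inside b A.

Definition low b c : nat := (low0 b c + ((b \subset c) && (#|b| != 1)))%N.

Definition summand_csum b : nat := if #|b| == 1 then 1 else #|Bsub b|.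

Lemma card_sum_sub (c : {set {set I}}) B :
  (#|[set A in c | B \subset A]|)%:R = \sum_(A in c) (B \subset A)%:R :> R.
Proof.
rewrite -sum1_card -natr_sum; congr (_%:R).
rewrite big_mkcond [RHS]big_mkcond; apply: eq_bigr => A _.
by rewrite inE; case: (A \in c); case: (B \subset A).
Qed.

Lemma summand_low b c x : b != finset.set0 -> summand b x -> (low b c)%:R <= cval c x.
Proof.
rewrite /summand /low /low0 => b0; case: (#|b| == 1) => Sx; last first.
  by rewrite andbT; apply: Nsub_cval.
rewrite andbF addn0 card_sum_sub; apply: ler_sum => A _; exact: simplex_mass.
Qed.

Lemma summand_csumE b x : summand b x -> csum x = (summand_csum b)%:R.
Proof.
rewrite /summand /summand_csum; case: (#|b| == 1); [exact: simplex_csum|exact: Nsub_csum].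
Qed.

Lemma summand_convex b : convex (summand b).
Proof. by rewrite /summand; case: (#|b| == 1); apply: convex_convhull. Qed.

Definition upsets r c : bool := [forall A in c, upset r A].

Lemma cval_delta c i : cval c 'd_i = (#|[set A in c | i \in A]|)%:R.
Proof. by rewrite -dotp_ev dotp_delta mxE. Qed.

(** When some member of [b] is no up-set, the vertex of [PBsub b] chosen by [r] already avoids the
    removed face; only otherwise is the transposition across [A] needed, and then [A] is where the
    unit falls. *)
Lemma summand_point b r (A : {set I}) : b \in B1 n -> injective r ->
  (upsets r b -> A \in b) ->
  exists z, [/\ summand b z,
    forall c, upsets r c ->
      cval c z = (low0 b c + [&& upsets r b, #|b| != 1 & A \in c])%N%:R
    & #|b| = 1 -> z = 'd_(first r (finset.cover b))].
Proof.
move=> bB rI Ab; have fb := B1_flag bB; have b0 := B1_neq0 bB.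
rewrite /summand /low0; case: (boolP (#|b| == 1)) => [/cards1P[D bD]|c1].
  have cD : finset.cover b = D by rewrite bD /finset.cover big_set1.
  have Db : D \in b by rewrite bD inE.
  have [D0 _] := fb.1 D Db.
  have [fD _] := firstP r D0.
  exists ('d_(first r D)); rewrite cD; split=> //; first exact: simplex_delta.
  move=> c /forall_inP uc; rewrite /= andbF addn0 cval_delta; congr (_%:R).
  apply: eq_card => X; rewrite !inE; case: (boolP (X \in c)) => //= /uc uX.
  exact: first_upset.
case: (boolP (upsets r b)) => ub /=; last first.
  exists (bvertex R b (first r)); split; last by move/eqP; rewrite (negPf c1).
    by apply/sub_convhull/Nsub_first.
  move=> c /forall_inP uc; rewrite addn0 natr_sum; apply: eq_bigr => X /uc uX.
  exact: mass_first.
have [x Nx xm] := Nsub_swap R bB rI (fun D Db => forall_inP ub D Db) (Ab ub).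
exists x; split=> //; last by move/eqP; rewrite (negPf c1).
move=> c /forall_inP uc; rewrite natrD natr_sum.
rewrite /cval (eq_bigr (fun X => (inside b X)%:R + (X == A)%:R)) => [|X /uc /xm //].
rewrite big_split; congr (_ + _) => /=; rewrite -natr_sum; congr (_%:R).
case: (boolP (A \in c)) => Ac.
  by rewrite (bigD1 A) //= eqxx big1 // => X /andP[_ /negPf ->].
by rewrite big1 // => X Xc; case: eqP => // e; rewrite -e Xc in Ac.
Qed.

Definition partial_sum T : set E :=
  msum (simplex [set: I]%SET) (\big[@msum R n.+1/[set 0]%classic]_(b in A1 n :|: T) summand b).

(** The simplex on all of [I] contributes no term, as its least mass on a proper subset is 0. *)
Definition support T b : R := \sum_(g in A1 n :|: T) (low g b)%:R.
Definition sum_csum T : R := 1 + \sum_(g in A1 n :|: T) (summand_csum g)%:R.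

Lemma partial_sum_convex T : convex (partial_sum T).
Proof.
apply: msum_convex; first exact: simplex_convex.
by apply: big_msum_convex => b _; apply: summand_convex.
Qed.

Lemma partial_sumP T x : partial_sum T x <->
  exists2 z : {set {set I}} -> E, forall b, b \in A1 n :|: T -> summand b (z b) &
    exists2 y, simplex [set: I]%SET y & x = y + \sum_(b in A1 n :|: T) z b.
Proof.
split=> [[y Dy [_ /big_msumP[f hf ->] ->]]|[z hz [y Dy ->]]].
  by exists f => //; exists y.
exists y => //; exists (\sum_(b in A1 n :|: T) z b) => //.
by apply/big_msumP; exists z.
Qed.

Lemma A1_sub_B1 b : b \in A1 n -> b \in B1 n.
Proof. by rewrite inE => /andP[]. Qed.

Variable T : {set {set {set I}}}.
Hypothesis TA : T \subset A2 n.
Local Notation G := (A1 n :|: T).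

Let GB b : b \in G -> b \in B1 n.
Proof.
case/setUP; first exact: A1_sub_B1.
by move/(subsetP TA); rewrite inE => /andP[].
Qed.

Lemma partial_sum_support x b : partial_sum T x -> b \in G -> support T b <= cval b x.
Proof.
case/partial_sumP=> z hz [y Dy ->] bG; rewrite cvalD cval_sum -[support T b]add0r.
apply: lerD; first by apply: sumr_ge0 => A _; apply: sumr_ge0 => i _; apply: simplex_coord_ge0 Dy.
apply: ler_sum => g gG; apply: summand_low; last exact: hz.
exact/B1_neq0/GB.
Qed.

Lemma partial_sum_csum x : partial_sum T x -> csum x = sum_csum T.
Proof.
case/partial_sumP=> z hz [y Dy ->]; rewrite csumD csum_sum (simplex_csum Dy).
by congr (_ + _); apply: eq_bigr => g /hz/summand_csumE.
Qed.

Lemma partial_sum_poly x : partial_sum T x -> poly G (support T) (sum_csum T) x.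
Proof.
move=> Sx; split; first exact: partial_sum_csum.
by move=> b bG; apply: partial_sum_support.
Qed.

Hypothesis gG : good G.
Hypothesis n2 : (2 <= n)%N.

(** For [M] in [N], [ch b] lies in [M] exactly when [b \subset M], so the unit of [b] is paid just
    where [low] counts it. *)
Lemma partial_sum_point N r (ch : {set {set I}} -> {set I}) : nested (C1 n) G N ->
  injective r -> upsets r (finset.cover N) ->
  (forall b, b \in G -> ch b \in b /\ forall M, M \in N -> ch b \in M -> b \subset M) ->
  exists z : {set {set I}} -> E,
    [/\ forall b, b \in G -> summand b (z b),
        forall b c, b \in G -> upsets r c ->
          cval c (z b) = (low0 b c + [&& upsets r b, #|b| != 1 & ch b \in c])%N%:R,
        forall b, b \in G -> #|b| = 1 -> z b = 'd_(first r (finset.cover b))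
      & forall b M, b \in G -> M \in N -> cval M (z b) = (low b M)%:R].
Proof.
move=> nN rI uN hch.
have /choice [z hz] : forall b, exists z, b \in G -> [/\ summand b z,
    forall c, upsets r c ->
      cval c z = (low0 b c + [&& upsets r b, #|b| != 1 & ch b \in c])%N%:R
    & #|b| = 1 -> z = 'd_(first r (finset.cover b))].
  move=> b; case: (boolP (b \in G)) => [bG|]; last by exists 0.
  have [z hz] := summand_point (GB bG) rI (fun _ => (hch b bG).1).
  by exists z.
exists z; split=> [b|b c|b|b M bG MN].
- by case/hz.
- by move=> /hz[_ h _]; apply: h.
- by case/hz.
have uM : upsets r M.
  apply/forall_inP => A AM; apply: (forall_inP uN); apply/bigcupP; by exists M.
have [_ h _] := hz b bG; rewrite h // /low; congr (_%:R); congr (_ + _)%N; congr (nat_of_bool _).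
have [cb hb] := hch b bG.
apply/and3P/andP => [[_ c1 cM]|[bM c1]]; first by rewrite hb.
split=> //; last exact: (subsetP bM).
by apply/forall_inP => A Ab; apply: (forall_inP uM); apply: (subsetP bM).
Qed.

Lemma partial_sum_nested_realised : nested_realised G (support T) (partial_sum T).
Proof.
have choices N : nested (C1 n) G N -> exists ch : {set {set I}} -> {set I},
    forall b, b \in G -> ch b \in b /\ forall M, M \in N -> ch b \in M -> b \subset M.
  move=> nN; have /choice[ch hch] : forall b, exists A, b \in G ->
      A \in b /\ forall M, M \in N -> A \in M -> b \subset M.
    move=> b; case: (boolP (b \in G)) => [bG|]; last by exists finset.set0.
    by have [A Ab hA] := nested_not_covered gG nN bG; exists A.
  by exists ch.
(* The lowest element of the order lies in no proper up-set, so this vertex adds nothing to the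
   inequalities that must be tight. *)
pose y0 r : E := 'd_(first r [set: I]%SET).
have T0 : [set: I]%SET != finset.set0 by apply/set0Pn; exists ord0; rewrite inE.
have Dy0 r : simplex [set: I]%SET (y0 r) by apply: simplex_delta; rewrite inE.
have y0E N r M : nested (C1 n) G N -> upsets r (finset.cover N) -> M \in N ->
    cval M (y0 r) = 0.
  move=> nN uN MN; rewrite cval_delta.
  have -> : [set A in M | first r [set: I]%SET \in A] = finset.set0; last by rewrite cards0.
  apply/setP => A; rewrite !inE; apply: contraTF isT => /andP[AM].
  have AN : A \in finset.cover N by apply/bigcupP; exists M.
  rewrite (first_upset (forall_inP uN _ AN)) // finset.subTset.
  by have [_ /negPf ->] := (nested_flag gG nN).1 _ AN.
have y0_ge0 r b : 0 <= cval b (y0 r) by rewrite cval_delta ler0n.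
have tight N r (z : {set {set I}} -> E) : nested (C1 n) G N -> upsets r (finset.cover N) ->
    (forall b M, b \in G -> M \in N -> cval M (z b) = (low b M)%:R) ->
    forall M, M \in N -> cval M (y0 r + \sum_(b in G) z b) = support T M.
  move=> nN uN hz M MN; rewrite cvalD (y0E N) // add0r cval_sum.
  by apply: eq_bigr => b bG; rewrite hz.
have order N : nested (C1 n) G N -> exists2 r : I -> nat, injective r &
    upsets r (finset.cover N).
  move=> /(nested_flag gG) /flag_order[r rI rN]; exists r => //.
  exact/forall_inP.
apply: nested_realised_weak; first exact: partial_sum_convex.
- exact: partial_sum_support.
- move=> N nN; have [ch hch] := choices N nN; have [r rI uN] := order N nN.
  have [z [zS _ _ zN]] := partial_sum_point nN rI uN hch.
  exists (y0 r + \sum_(b in G) z b); last exact: tight.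
  by apply/partial_sumP; exists z => //; exists (y0 r).
move=> N b nN bG bN; have bB := GB bG.
have strict r (z : {set {set I}} -> E) g : (forall b, b \in G -> summand b (z b)) -> g \in G ->
    (low g b)%:R < cval b (z g) -> support T b < cval b (y0 r + \sum_(b in G) z b).
  move=> zS gG' lt; rewrite cvalD cval_sum -[support T b]add0r ler_ltD //.
  rewrite /support (bigD1 g) //= [ltRHS](bigD1 g) //= ltr_leD //.
  by apply: ler_sum => g' /andP[gG'' _]; apply: summand_low (zS _ gG''); apply/B1_neq0/GB.
have [A Ab [AN|[M MN [bM AM hA]]]] := nested_witness gG nN bG bN.
  have [A0 AT] := (B1_flag bB).1 _ Ab.
  have [r [rI rN nuA]] := flag_order_avoiding (nested_flag gG nN) A0 AT AN.
  have uN : upsets r (finset.cover N) by apply/forall_inP.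
  have [ch hch] := choices N nN.
  have [z [zS _ z1 zN]] := partial_sum_point nN rI uN hch.
  exists (y0 r + \sum_(b in G) z b).
    by apply/partial_sumP; exists z => //; exists (y0 r).
  split; first exact: tight.
  have [a [o [aA oA le]]] := upsetPn _ _ nuA.
  have ao : a != o by apply: contraNneq oA => <-.
  (* The simplex on [D] selects its vertex at [a], which lies in [A] although [D] does not lie
     inside [A]; this makes the inequality of [b] strict. [D] is proper because [n >= 2]. *)
  pose D := [set a; o].
  have D0 : D != finset.set0 by apply/set0Pn; exists a; rewrite !inE eqxx.
  have DT : D != [set: I]%SET.
    apply: contraTneq n2 => e; have := cards2 a o; rewrite -/D e cardsT card_ord ao.
    by case=> ->.
  have gG' : [set D] \in G by apply/setUP; left; apply/A1P; exists D.
  apply: (strict r z [set D]) => //.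
  have cD : finset.cover [set D] = D by rewrite /finset.cover big_set1.
  have fD : first r D = a.
    have [] := firstP r D0; rewrite !inE => /orP[/eqP //|/eqP fo /(_ a)].
    rewrite !inE eqxx fo => /(_ isT) le'; case/eqP: ao; apply: rI.
    by apply/eqP; rewrite eqn_leq le.
  rewrite z1 ?cards1 // cD fD cval_delta /low /low0 cards1 eqxx andbF addn0 cD ltr_nat.
  apply: proper_card; apply/properP; split.
    apply/subsetP => X; rewrite !inE => /andP[-> /subsetP h] /=.
    by apply: h; rewrite !inE eqxx.
  exists A; rewrite !inE Ab //=; apply: contra oA => /subsetP; apply.
  by rewrite !inE eqxx orbT.
have [r rI uN] := order N nN; have [ch0 hch0] := choices N nN.
(* By the minimality of [M] this choice is still admissible, and the unit of [M] now falls in [b],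
   which does not contain [M]. *)
pose ch g := if g == M then A else ch0 g.
have hch g : g \in G -> ch g \in g /\ forall M, M \in N -> ch g \in M -> g \subset M.
  by move=> /hch0; rewrite /ch; case: eqP => [->|].
have [z [zS zu _ zN]] := partial_sum_point nN rI uN hch.
exists (y0 r + \sum_(b in G) z b).
  by apply/partial_sumP; exists z => //; exists (y0 r).
split; first exact: tight.
have MG := nested_mem nN MN.
have uM : upsets r M.
  apply/forall_inP => X XM; apply: (forall_inP uN); apply/bigcupP; by exists M.
have ub : upsets r b.
  by apply/forall_inP => X Xb; apply: (forall_inP uM); apply: (subsetP (proper_sub bM)).
have M1 : #|M| != 1.
  rewrite neq_ltn orbC; apply/orP; left; apply: leq_ltn_trans (proper_card bM).
  by rewrite card_gt0 B1_neq0.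
apply: (strict r z M) => //.
rewrite zu // /low uM M1 /ch eqxx Ab /= ltr_nat ltn_add2l andbT.
case: (boolP (M \subset b)) => // Mb; have := proper_sub_trans bM Mb.
by rewrite properxx.
Qed.

End MinkowskiSums.

(** * The polytope PA *)

Section Stars.
Variable n : nat.
Local Notation I := 'I_n.+1.
Implicit Types (A D : {set I}) (b g : {set {set I}}) (s : seq I).

Lemma card_star k s : uniq s -> (k <= size s)%N -> #|star k s| = k.
Proof.
move=> us ks; rewrite card_imset ?card_ord // => i j e; apply: val_inj.
have := card_drop i us; have := card_drop j us; rewrite /= -e => -> /eqP.
by have := ltn_ord i; have := ltn_ord j; move: (nat_of_ord i) (nat_of_ord j) => a c; lia.
Qed.

Lemma star_sub j k s : (j <= k)%N -> star j s \subset star k s.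
Proof.
move=> jk; apply/subsetP => A /starP[i ij ->]; apply/starP; exists i => //.
exact: leq_trans jk.
Qed.

(** The origin of the coefficients in [PA]; since [j] counts from 0, the number of members
    containing the entry is [minn j.+1 k]. *)
Lemma star_mem k s x j : uniq s -> (j < size s)%N -> (k <= size s)%N ->
  [set A in star k s | nth x s j \in A] = star (minn j.+1 k) s.
Proof.
move=> us js ks; apply/setP => A; rewrite inE; apply/andP/starP.
  case=> /starP[i ik ->]; rewrite inE => jd; exists i => //.
  rewrite leq_min ik andbT ltnS leqNgt; apply/negP => ji.
  have : nth x s j \in take i s.
    by rewrite -(nth_take x ji); apply: mem_nth; rewrite size_take; case: ifP.
  by move: us; rewrite -{1}(cat_take_drop i s) cat_uniq => /and3P[_ /hasPn/(_ _ jd)/negPf ->].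
case=> i; rewrite leq_min ltnS => /andP[ij ik] ->; split; first by apply/starP; exists i.
rewrite inE -{1}(subnKC ij) -nth_drop; apply: mem_nth.
by rewrite size_drop ltn_sub2r // (leq_ltn_trans ij).
Qed.

(** Along a star the cardinality drops by one at each step, so a contiguous subfamily with the
    largest member is an initial segment. *)
Lemma star_top g k s : uniq s -> (k <= size s)%N -> g \in B1 n -> g \subset star k s ->
  [set x in drop 0 s] \in g -> g = star #|g| s.
Proof.
move=> us ks /B1P[fg _ cg] /subsetP gs Dg; apply/eqP; rewrite eqEcard.
have gk : (#|g| <= k)%N by rewrite -[leqRHS](card_star us ks); apply/subset_leq_card/subsetP.
have -> : #|star #|g| s| = #|g| by apply: card_star => //; apply: leq_trans gk ks.
rewrite leqnn andbT; apply/subsetP => A Ag.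
have /starP[j jk Aj] := gs _ Ag; apply/starP; exists j => //.
rewrite -(card_star us (leq_trans jk ks)); apply: subset_leq_card.
apply/subsetP => B /starP[i ij ->].
have [|X Xg Xi] := cg A [set x in drop 0 s] (size s - i)%N Ag Dg.
  by rewrite Aj !card_drop // leq_sub2l //= leq_sub.
have /starP[i' i'k Xi'] := gs _ Xg.
suff <- : i' = i by rewrite -Xi'.
move: Xi; rewrite Xi' card_drop //; lia.
Qed.

(** A contiguous subfamily either omits the largest member, and lives in the star of the tail, or is
    one of the initial segments [star j.+1 s]. *)
Lemma sum_substars (V : nmodType) (m : nat -> V) k s : uniq s -> (k < size s <= n)%N ->
  \sum_(g in B1 n | g \subset star k.+1 s) m #|g| =
  \sum_(g in B1 n | g \subset star k (behead s)) m #|g| + \sum_(j < k.+1) m j.+1.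
Proof.
case: s => [|x s] //= us /andP[ks sn]; rewrite ltnS in ks.
have us' : uniq s by case/andP: us.
set D := [set y in x :: s].
have bE : star k.+1 (x :: s) = D |: star k s by apply: star_cons.
have Db : D \notin star k s.
  apply/starP => -[j jk e]; have : x \in D by rewrite !inE eqxx.
  by rewrite e inE => /mem_drop; apply/negP; case/andP: us.
rewrite (bigID (fun g : {set {set I}} => D \in g)) /= addrC; congr (_ + _).
  apply: eq_bigl => g; rewrite -andbA; congr (_ && _); rewrite bE.
  apply/andP/idP => [[gs Dg]|gs].
    apply/subsetP => A Ag; have /setU1P[AD|//] := subsetP gs _ Ag.
    by rewrite -AD Ag in Dg.
  split; first by apply: subset_trans gs _; apply: finset.subsetUr.
  by apply: contra Db; apply: (subsetP gs).
pose f (j : 'I_k.+1) := star j.+1 (x :: s).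
have fcard (j : 'I_k.+1) : #|f j| = j.+1.
  by rewrite card_star //= ltnS (leq_trans _ ks) // -ltnS.
rewrite (reindex_onto f (fun g => inord #|g|.-1)) /=; last first.
  move=> g /andP[/andP[gB gs] Dg].
  have gE : g = star #|g| (x :: s) by apply: (star_top (k := k.+1)) => //; rewrite drop0.
  have g0 : (0 < #|g|)%N by rewrite card_gt0 B1_neq0.
  have gk : (#|g| <= k.+1)%N.
    rewrite -[leqRHS](card_star (s := x :: s)) //; exact: subset_leq_card.
  by rewrite /f inordK ?prednK // -ltnS prednK.
under eq_bigr do rewrite fcard.
apply: eq_bigl => j; rewrite fcard /= inord_val eqxx andbT.
have -> /= : f j \in B1 n.
  apply/B1P; apply: star_flag => //=; apply/andP; split=> //.
  by rewrite ltnS (leq_trans _ ks) // -ltnS.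
rewrite star_sub //=; apply/starP; exists 0%N; by rewrite ?drop0.
Qed.

End Stars.

(** * The correction term of [kappa] and its weights *)

Section Associahedral.
Variables (R : realType) (n : nat).
Hypothesis n2 : (2 <= n)%N.
Local Notation I := 'I_n.+1.
Local Notation E := 'rV[R]_n.+1.
Implicit Types (A B D : {set I}) (W b c g M : {set {set I}}) (N F G T : {set {set {set I}}}).
Implicit Types (x y z u v : E) (r : I -> nat).

Definition eps (k : nat) : R := (3 ^+ k - 3 * k%:R) / (3 ^+ n - n%:R - 1).

(* [weight j = eps j - 2 * eps j.-1 + eps j.-2], with 0 in place of [eps 0]: the
   Moebius inverse of [eps] over contiguous subfamilies, see [sum_weight_B1]. *)
Definition weight (j : nat) : R := match j with
  | 0 | 1 => 0 | 2 => 3 / (3 ^+ n - n%:R - 1)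
  | j'.+3 => 4 * 3 ^+ j'.+1 / (3 ^+ n - n%:R - 1) end.

Lemma pow3_gt k : (3 * k.+1 <= 3 ^ k.+1)%N.
Proof.
elim: k => // k IH; rewrite expnS mulnS [X in (_ <= X)%N]mulSn leq_add //.
  by rewrite -[X in (X <= _)%N]expn1 leq_exp2l.
by rewrite (leq_trans IH) // mulSn leq_addr.
Qed.

(** Monotonicity of the numerator of [eps] from 1 on, written without subtraction. *)
Lemma pow3_mono j k : (1 <= j <= k)%N -> (3 ^ j + 3 * k <= 3 ^ k + 3 * j)%N.
Proof.
case: j => // j /andP[_ jk]; have [d ->] : exists d, k = (j.+1 + d)%N.
  by exists (k - j.+1)%N; rewrite subnKC.
elim: d => [|d IH]; first by rewrite addn0.
move: IH; rewrite addnS !addSn [(3 ^ (j + d).+2)%N]expnS; have := pow3_gt (j + d).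
move: (3 ^ (j + d).+1)%N (3 ^ j.+1)%N => p q; lia.
Qed.

Lemma den_gt0 : 0 < 3 ^+ n - n%:R - 1 :> R.
Proof.
rewrite -[n in 3 ^+ n]prednK ?(ltnW n2) //; have := pow3_gt n.-1.
rewrite prednK ?(ltnW n2) // => h.
have : (n.+1 < 3 ^ n)%N by apply: leq_trans h; move: n2; lia.
by rewrite -(ltr_nat R) natrX -addn1 natrD; lra.
Qed.

Lemma eps1 : eps 1 = 0.
Proof. by rewrite /eps expr1 mulr1 subrr mul0r. Qed.

Lemma weight_gt0 j : (1 < j)%N -> 0 < weight j.
Proof.
case: j => [|[|[|j]]] // _; rewrite /weight.
  exact: divr_gt0 _ den_gt0.
by rewrite divr_gt0 ?den_gt0 // mulr_gt0 // exprn_gt0.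
Qed.

Lemma weight_ge0 j : 0 <= weight j.
Proof. by case: j => [|[|j]]; rewrite ?lexx // ltW // weight_gt0. Qed.

Lemma eps_lt1 k : (0 < k <= n)%N -> eps k < 1.
Proof.
move=> /pow3_mono h; rewrite /eps ltr_pdivrMr ?den_gt0 // mul1r.
have : (3 ^ k + n + 1 < 3 ^ n + 3 * k)%N by move: n2; lia.
by rewrite -(ltr_nat R) 2!natrD natrX [ltRHS]natrD natrX natrM; lra.
Qed.

(** Second differences add up to first differences. The case [k = 0] fails because the actual
    [eps 0] is not 0. *)
Lemma sum_weight k : (0 < k)%N -> \sum_(j < k.+1) weight j.+1 = eps k.+1 - eps k.
Proof.
have dn : 3 ^+ n - n%:R - 1 != 0 :> R by rewrite gt_eqF ?den_gt0.
case: k => // k _; elim: k => [|k IH].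
  by rewrite !big_ord_recl big_ord0 /= /weight /eps; field; exact: dn.
rewrite big_ord_recr /= IH /weight /eps /= !exprS.
rewrite -[k.+3]addn3 -[k.+2]addn2 -[k.+1]addn1 !natrD.
by field; exact: dn.
Qed.

(** By [sum_substars], adding the largest member increases the sum by a first difference of
    [eps]. *)
Lemma sum_weight_B1 b : b \in B1 n -> \sum_(g in B1 n | g \subset b) weight #|g| = eps #|b|.
Proof.
move=> /B1P[fb b0 cb]; have [s [us ks sn bE]] := star_exists fb b0 cb.
have {fb b0 cb} k0 : (0 < #|b|)%N by rewrite card_gt0.
rewrite {1}bE; move: #|b| k0 ks => k {b bE}; elim: k s us sn => // k IH s us sn _ ks.
rewrite sum_substars ?ks //; case: (posnP k) => [k0|k0].
  rewrite k0 big_ord_recl big_ord0 addr0 eps1 star0 /= big1 ?addr0 // => g /andP[gB].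
  by rewrite finset.subset0 => /eqP g0; have := B1_neq0 gB; rewrite g0 eqxx.
rewrite sum_weight // IH ?size_behead //; last 1 first.
- by rewrite -ltnS prednK // (leq_trans _ ks).
- by rewrite addrC subrK.
- by case: (s) us => //= x s' /andP[].
by rewrite (leq_trans (leq_pred _)).
Qed.

End Associahedral.

(** * The full flag of up-sets of an order *)

Section FullFlags.
Variable n : nat.
Local Notation I := 'I_n.+1.
Implicit Types (A B D : {set I}) (b : {set {set I}}).
Variable r : I -> nat.
Hypothesis rI : injective r.

Definition full_flag : {set {set I}} :=
  [set A | [&& A != finset.set0, A != [set: I]%SET & upset r A]].

Lemma upset_setD1_first A : upset r A -> A != finset.set0 -> upset r (A :\ first r A).
Proof.
move=> /upsetP uA A0; have [_ fmin] := firstP r A0.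
apply/upsetP => a o; rewrite !inE => /andP[af aA]; rewrite negb_and negbK.
case/orP=> [/eqP ->|]; last exact: uA.
rewrite ltn_neqAle fmin // andbT; apply: contra af => /eqP/rI ->; exact: eqxx.
Qed.

Lemma upset_of_card A t : upset r A -> (t <= #|A|)%N -> exists2 D, upset r D & #|D| = t.
Proof.
move: {2}(#|A| - t)%N (erefl (#|A| - t)%N) => k.
elim: k A => [|k IH] A dk uA tA.
  by exists A => //; apply/eqP; rewrite eqn_leq tA andbT -subn_eq0 dk.
have A0 : A != finset.set0 by rewrite -card_gt0; lia.
have [fA _] := firstP r A0.
have := cardsD1 (first r A) A; rewrite fA add1n => cA.
have tA' : (t <= #|A :\ first r A|)%N by rewrite -ltnS -cA -subn_gt0 dk.
apply: (IH (A :\ first r A)) => //; last exact: upset_setD1_first.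
by move: dk; rewrite cA subSn // => -[].
Qed.

Lemma full_flagP : flag full_flag.
Proof.
split=> [A|A D]; first by rewrite inE => /and3P[].
by rewrite !inE => /and3P[_ _ uA] /and3P[_ _ uD]; apply: upset_chain uA uD.
Qed.

Lemma upset_up i : upset r [set j | (r i <= r j)%N].
Proof. by apply/upsetP => a o; rewrite !inE -ltnNge => h /leq_trans; apply. Qed.

Lemma full_flag_B1 : (0 < n)%N -> full_flag \in B1 n.
Proof.
move=> n0; apply/B1P; split; first exact: full_flagP.
  have uT : upset r [set: I]%SET by apply/upsetP => a o; rewrite !inE.
  have [|D uD cD] := @upset_of_card [set: I]%SET 1 uT; first by rewrite cardsT card_ord.
  apply/set0Pn; exists D; rewrite inE uD andbT -card_gt0 cD /=.
  by apply: contraTneq n0 => DT; move: cD; rewrite DT cardsT card_ord => -[->].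
move=> A D t; rewrite !inE => /and3P[A0 _ _] /and3P[_ DT uD] /andP[At tD].
have [X uX Xt] := upset_of_card uD tD; exists X => //; rewrite inE uX andbT -card_gt0 Xt.
rewrite (leq_trans _ At) ?card_gt0 //=; apply: contra_neq DT => XT.
apply/eqP; rewrite eqEcard finset.subsetT /= -XT Xt tD //.
Qed.

End FullFlags.

(** * The points realising nested sets on [PA] *)

Section PAPoints.
Variables (R : realType) (n : nat).
Hypothesis n2 : (2 <= n)%N.
Local Notation I := 'I_n.+1.
Local Notation E := 'rV[R]_n.+1.
Implicit Types (A B D : {set I}) (W b c g M : {set {set I}}) (N F G T : {set {set {set I}}}).

Definition hPA b : R := \sum_(A in b) 3 ^+ #|A| + eps R n #|b|.

Section Point.
Variable r : I -> nat.
Hypothesis rI : injective r.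
Variable ch : {set {set I}} -> {set I}.
Hypothesis hch : forall b, b \in B1 n -> ch b \in b.
Local Notation Fl := (full_flag r).

Definition yPA A : R := \sum_(g in B1 n | g \subset Fl) weight R n #|g| *+ (ch g == A).

Definition gPA A : R := 3 ^+ #|A| *+ (A != finset.set0) + yPA A.

(** Successive differences along the order, so that the mass on an up-set telescopes to [gPA]. *)
Definition xPA : E := \row_i (gPA [set j | (r i <= r j)%N] - gPA [set j | (r i < r j)%N]).

Let n0 : (0 < n)%N := ltnW n2.

Lemma yPA_ge0 A : 0 <= yPA A.
Proof. by apply: sumr_ge0 => g _; rewrite mulrn_wge0 // weight_ge0. Qed.

(** Even all the weights together amount only to [eps] of the cardinality of the full flag. *)
Lemma yPA_lt1 A : yPA A < 1.
Proof.
apply: le_lt_trans (_ : eps R n #|Fl| < 1); last first.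
  have fB := full_flag_B1 rI n0.
  by apply: eps_lt1 => //; rewrite card_gt0 B1_neq0 //= flag_card //; apply: full_flagP.
rewrite -(sum_weight_B1 R n2 (full_flag_B1 rI n0)); apply: ler_sum => g _.
by case: (_ == _); rewrite ?mulr0n ?weight_ge0.
Qed.

Lemma yPA_out A : A \notin Fl -> yPA A = 0.
Proof.
move=> AF; apply: big1 => g /andP[gB /subsetP gF]; case: eqP => // e.
by move: AF; rewrite -e gF // hch.
Qed.

Lemma mass_xPA A : upset r A -> mass A xPA = gPA A.
Proof.
move: {2}#|A| (erefl #|A|) => k; elim: k A => [|k IH] A cA uA.
  rewrite (cards0_eq cA) /mass big_set0 /gPA eqxx add0r yPA_out //.
  by rewrite inE eqxx.
have A0 : A != finset.set0 by rewrite -card_gt0 cA.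
have [fA fmin] := firstP r A0; set a := first r A in fA fmin.
have upA : [set j | (r a <= r j)%N] = A.
  apply/setP => j; rewrite inE; apply/idP/idP; last exact: fmin.
  by apply: contraTT => jA; rewrite -ltnNge (upsetP _ _ uA).
have up'A : [set j | (r a < r j)%N] = A :\ a.
  by rewrite -upA; apply/setP => j; rewrite !inE ltn_neqAle [r a == _]eq_sym (inj_eq rI).
have cA' : #|A :\ a| = k by move: cA; rewrite (cardsD1 a) fA => -[].
have := IH _ cA' (upset_setD1_first rI uA A0); rewrite /mass => IHA.
by rewrite (big_setD1 a) //= IHA !mxE upA up'A subrK.
Qed.

(** The two up-sets differ by one element, so their powers of 3 differ by at least twice the
    smaller; the corrections lie between 0 and 1. *)
Lemma xPA_ge i : 2 * 3 ^+ #|[set j | (r i < r j)%N]| - 1 < xPA 0 i.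
Proof.
rewrite !mxE; set U := [set j | (r i <= r j)%N]; set V := [set j | (r i < r j)%N].
have cU : #|U| = #|V|.+1.
  rewrite (cardsD1 i) inE leqnn add1n; congr _.+1; apply: eq_card => j.
  by rewrite !inE ltn_neqAle [r i == _]eq_sym (inj_eq rI).
rewrite /gPA cU exprS -card_gt0 cU /= mulr1n.
have := yPA_ge0 U; have := yPA_lt1 V.
have p1 : 1 <= 3 ^+ #|V| :> R by rewrite exprn_ege1 // ler1n.
have : 3 ^+ #|V| *+ (V != finset.set0) <= 3 ^+ #|V| :> R.
  by case: (V != _); rewrite ?mulr0n // (le_trans ler01).
by lra.
Qed.

Lemma xPA_gt0 i : 0 < xPA 0 i.
Proof.
apply: lt_trans (xPA_ge i).
have : 1 <= 3 ^+ #|[set j | (r i < r j)%N]| :> R by rewrite exprn_ege1 // ler1n.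
by lra.
Qed.

(* The slack 1 absorbs every correction term [eps]. *)
Lemma mass_xPA_slack A : A != finset.set0 -> ~~ upset r A -> 3 ^+ #|A| + 1 < mass A xPA.
Proof.
move=> A0 nu; have [fA fmin] := firstP r A0; set a := first r A in fA fmin.
pose U := [set j | (r a <= r j)%N]; pose V := [set j | (r a < r j)%N].
have AU : A \proper U.
  rewrite finset.properEneq; apply/andP; split.
    by apply: contraNneq nu => ->; apply: upset_up.
  by apply/subsetP => j jA; rewrite inE fmin.
have cV : (#|A| <= #|V|)%N.
  rewrite -ltnS; apply: leq_trans (proper_card AU) _.
  have aU : a \in U by rewrite inE.
  rewrite (cardsD1 a U) aU add1n ltnS; apply: subset_leq_card; apply/subsetP => j.
  by rewrite !inE ltn_neqAle [r a == _]eq_sym (inj_eq rI).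
have le3 : 3 ^+ #|A| <= 3 ^+ #|V| :> R by rewrite ler_eXn2l ?ltr1n.
have ge3 : 3 <= 3 ^+ #|A| :> R.
  by rewrite -[leLHS]expr1 ler_eXn2l ?ltr1n // card_gt0.
have := xPA_ge a; rewrite -/V => xa.
rewrite /mass (bigD1 a) //=.
have : 0 <= \sum_(i in A | i != a) xPA 0 i.
  by apply: sumr_ge0 => i _; apply/ltW/xPA_gt0.
by lra.
Qed.

Lemma mass_xPA_ge A : A != finset.set0 -> 3 ^+ #|A| <= mass A xPA.
Proof.
move=> A0; case: (boolP (upset r A)) => [uA|nu]; last first.
  by have := mass_xPA_slack A0 nu; lra.
by rewrite mass_xPA // /gPA A0 mulr1n lerDl yPA_ge0.
Qed.

Lemma csum_xPA : csum xPA = 3 ^+ n.+1.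
Proof.
have uT : upset r [set: I]%SET by apply/upsetP => a o; rewrite !inE.
have -> : csum xPA = mass [set: I]%SET xPA by apply: eq_bigl => i; rewrite inE.
rewrite mass_xPA // /gPA cardsT card_ord yPA_out ?inE ?eqxx ?andbF //.
by rewrite -card_gt0 cardsT card_ord addr0.
Qed.

Lemma cval_xPA b : b \in B1 n -> upsets r b ->
  cval b xPA = \sum_(A in b) 3 ^+ #|A| +
    \sum_(g in B1 n | g \subset Fl) weight R n #|g| *+ (ch g \in b).
Proof.
move=> bB /forall_inP ub; rewrite /cval.
rewrite (eq_bigr (fun A => 3 ^+ #|A| + yPA A)) => [|A Ab]; last first.
  rewrite mass_xPA ?ub // /gPA; have [-> _] := (B1_flag bB).1 _ Ab.
  by rewrite mulr1n.
rewrite big_split; congr (_ + _); rewrite /yPA exchange_big /=; apply: eq_bigr => g _.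
case: (boolP (ch g \in b)) => cb.
  rewrite (bigD1 (ch g)) //= eqxx big1 ?addr0 // => A /andP[_ /negPf].
  by rewrite eq_sym => ->.
by rewrite big1 // => A Ab; case: eqP => // e; rewrite e Ab in cb.
Qed.

Lemma upsets_full b : b \in B1 n -> upsets r b -> b \subset Fl.
Proof.
move=> bB /forall_inP ub; apply/subsetP => A Ab; rewrite inE ub // andbT.
by have [-> ->] := (B1_flag bB).1 _ Ab.
Qed.

(** Same index set as in [cval_xPA], so the bound and the value are compared term by term:
    [g \subset b] against [ch g \in b]. *)
Lemma epsE b : b \in B1 n -> upsets r b ->
  eps R n #|b| = \sum_(g in B1 n | g \subset Fl) weight R n #|g| *+ (g \subset b).
Proof.
move=> bB ub; rewrite -(sum_weight_B1 R n2 bB) big_mkcondr [RHS]big_mkcondr /=.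
apply: eq_bigr => g _; case: (boolP (g \subset b)) => gb; last by rewrite mulr0n if_same.
by rewrite (subset_trans gb) // upsets_full.
Qed.

Lemma hPA_lt b : b \in B1 n -> ~~ upsets r b -> hPA b < cval b xPA.
Proof.
move=> bB /forall_inPn[A Ab nu]; have fb := B1_flag bB.
have e1 : eps R n #|b| < 1.
  by apply: eps_lt1; rewrite // card_gt0 B1_neq0 //= flag_card.
rewrite /hPA /cval (bigD1 A) //= [ltRHS](bigD1 A) //=.
have := mass_xPA_slack (fb.1 _ Ab).1 nu.
have : \sum_(D in b | D != A) 3 ^+ #|D| <= \sum_(D in b | D != A) mass D xPA.
  by apply: ler_sum => D /andP[Db _]; apply: mass_xPA_ge; have [] := fb.1 _ Db.
by lra.
Qed.

Lemma hPA_le b : b \in B1 n -> hPA b <= cval b xPA.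
Proof.
move=> bB; case: (boolP (upsets r b)) => [ub|]; last by move/(hPA_lt bB)/ltW.
rewrite /hPA cval_xPA // lerD2l epsE //; apply: ler_sum => g /andP[gB _].
rewrite ler_wpMn2l ?weight_ge0 //; case: (boolP (g \subset b)) => // /subsetP -> //.
exact: hch.
Qed.

Lemma hPA_eq b : b \in B1 n -> upsets r b ->
  (forall g, g \in B1 n -> ch g \in b -> g \subset b) -> cval b xPA = hPA b.
Proof.
move=> bB ub hb; rewrite /hPA cval_xPA // epsE //; congr (_ + _).
apply: eq_bigr => g /andP[gB _]; congr (_ *+ nat_of_bool _).
by apply/idP/idP => [/hb ->//|/subsetP]; apply; apply: hch.
Qed.

(** The weight of [M] is counted in [cval b] but not in the bound, and it is positive because [M],
    properly containing a nonempty family, has at least two members. *)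
Lemma hPA_lt_witness b M : b \in B1 n -> M \in B1 n -> upsets r M ->
  b \proper M -> ch M \in b -> hPA b < cval b xPA.
Proof.
move=> bB MB uM bM cb.
have ub : upsets r b.
  by apply/forall_inP => X Xb; apply: (forall_inP uM); apply: (subsetP (proper_sub bM)).
rewrite /hPA cval_xPA // ltrD2l epsE //.
have pM : (M \in B1 n) && (M \subset Fl) by rewrite MB upsets_full.
rewrite (bigD1 M) //= [ltRHS](bigD1 M) //= cb ltr_leD //.
  have -> : (M \subset b) = false.
    by apply: negbTE; apply/negP => Mb; have := proper_sub_trans bM Mb; rewrite properxx.
  rewrite mulr1n weight_gt0 //; apply: leq_ltn_trans (proper_card bM).
  by rewrite card_gt0 B1_neq0.
apply: ler_sum => g /andP[/andP[gB _] _]; rewrite ler_wpMn2l ?weight_ge0 //.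
by case: (boolP (g \subset b)) => // /subsetP -> //; apply: hch.
Qed.

Lemma xPA_poly : poly (B1 n) hPA (3 ^+ n.+1) xPA.
Proof. by split; [exact: csum_xPA|exact: hPA_le]. Qed.

End Point.

Lemma PA_nested_realised : nested_realised (B1 n) hPA (poly (B1 n) hPA (3 ^+ n.+1)).
Proof.
have gG := good_B1 n.
have choices N : nested (C1 n) (B1 n) N -> exists ch : {set {set I}} -> {set I},
    forall b, b \in B1 n -> ch b \in b /\ forall M, M \in N -> ch b \in M -> b \subset M.
  move=> nN; have /choice[ch hch] : forall b, exists A, b \in B1 n ->
      A \in b /\ forall M, M \in N -> A \in M -> b \subset M.
    move=> b; case: (boolP (b \in B1 n)) => [bG|]; last by exists finset.set0.
    by have [A Ab hA] := nested_not_covered gG nN bG; exists A.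
  by exists ch.
have NB N M : nested (C1 n) (B1 n) N -> M \in N -> M \in B1 n by apply: nested_mem.
have upsN N r M : (forall D, D \in finset.cover N -> upset r D) -> M \in N -> upsets r M.
  by move=> uN MN; apply/forall_inP => X XM; apply: uN; apply/bigcupP; exists M.
have tight N r ch M : nested (C1 n) (B1 n) N -> injective r ->
    (forall D, D \in finset.cover N -> upset r D) ->
    (forall b, b \in B1 n -> ch b \in b /\ forall M, M \in N -> ch b \in M -> b \subset M) ->
    M \in N -> cval M (xPA r ch) = hPA M.
  move=> nN rI uN hch MN; apply: hPA_eq => //.
  - by move=> b /hch[].
  - exact: NB MN.
  - exact: upsN MN.
  by move=> g /hch[_ h]; apply: h.
apply: nested_realised_weak; first exact: poly_convex.
- by move=> x b [_ h] /h.
- move=> N nN; have [r rI uN] := flag_order (nested_flag gG nN).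
  have [ch hch] := choices N nN; exists (xPA r ch); last by move=> b; apply: tight.
  by apply: xPA_poly => // b /hch[].
move=> N b nN bB bN.
have [A Ab [AN|[M MN [bM AM hA]]]] := nested_witness gG nN bB bN.
  have [A0 AT] := (B1_flag bB).1 _ Ab.
  have [r [rI uN nuA]] := flag_order_avoiding (nested_flag gG nN) A0 AT AN.
  have [ch hch] := choices N nN; exists (xPA r ch).
    by apply: xPA_poly => // c /hch[].
  split; first by move=> c; apply: tight.
  apply: hPA_lt => //; [by move=> c /hch[]|by apply/forall_inPn; exists A].
have [r rI uN] := flag_order (nested_flag gG nN); have [ch0 hch0] := choices N nN.
pose ch g := if g == M then A else ch0 g.
have hch g : g \in B1 n -> ch g \in g /\ forall M, M \in N -> ch g \in M -> g \subset M.
  by move=> /hch0; rewrite /ch; case: eqP => [->|].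
exists (xPA r ch); first by apply: xPA_poly => // c /hch[].
split; first by move=> c; apply: tight.
apply: (@hPA_lt_witness r rI ch _ b M) => //; [by move=> c /hch[]|exact: NB MN|exact: upsN MN|].
by rewrite /ch eqxx.
Qed.

(** A geometric series, the cardinalities running from [l + 1] to [k + l]; this is the first summand
    of [kappa]. *)
Lemma sum_pow3_star k (s : seq I) l : uniq s -> size s = (k + l)%N ->
  \sum_(A in star k s) 3 ^+ #|A| = (3 ^+ (k + l + 1) - 3 ^+ (l + 1)) / 2 :> R.
Proof.
elim: k s => [|k IH] s us sz.
  by rewrite star0 big_set0 subrr mul0r.
case: s us sz => // x s us [sz]; have us' : uniq s by case/andP: us.
have Dn : [set y in x :: s] \notin star k s.
  apply/starP => -[j jk e]; have : x \in [set y in x :: s] by rewrite !inE eqxx.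
  by rewrite e inE => /mem_drop; apply/negP; case/andP: us.
rewrite star_cons big_setU1 //= IH // cardsE (card_uniqP us) /= sz.
by rewrite !addn1 addSn !exprS; field.
Qed.

Lemma PA_poly : PA R n = poly (B1 n) hPA (3 ^+ n.+1).
Proof.
have valE k l (s : (k + l).-tuple I) x : (0 < k)%N -> uniq s ->
    cval (star k s) x = \sum_(j < k + l) (minn j.+1 k)%:R * x 0 (tnth s j) :> R.
  move=> k0 us; rewrite -dotp_ev /dotp.
  rewrite (bigID (fun i => i \in (s : seq I))) /= [X in _ + X]big1 ?addr0 => [|i iS]; last first.
    rewrite mxE (_ : [set A in _ | _] = finset.set0) ?cards0 ?mul0r //.
    apply/setP => A; rewrite !inE; apply: contraNF iS => /andP[/starP[j _ ->]].
    by rewrite inE => /mem_drop.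
  rewrite -big_uniq //= big_tuple; apply: eq_bigr => j _; rewrite mxE; congr (_%:R * _).
  have js : (j < size s)%N by rewrite size_tuple.
  rewrite (tnth_nth ord0) star_mem ?size_tuple ?leq_addr // card_star //.
  by rewrite size_tuple geq_min leq_addr orbT.
have hE k l (s : (k + l).-tuple I) : uniq s -> hPA (star k s) = kappa R n k l.
  move=> us; rewrite /hPA (sum_pow3_star us (size_tuple s)) card_star //.
  by rewrite size_tuple leq_addr.
apply/seteqP; split=> x [tx hx]; split=> //.
  move=> b; rewrite inE => /existsP[k /existsP[l /existsP[s /and4P[k0 kl us /eqP ->]]]].
  by rewrite hE // valE // hx.
move=> k l s k0 kl us; rewrite -(valE k l s x k0 us) -(hE k l s us); apply: hx; apply/B1P.
by apply: star_flag => //; rewrite size_tuple leq_addr kl.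
Qed.

End PAPoints.

(** * The sequence of truncations and the conclusion *)

Section Truncators.
Variables (R : realType) (n : nat).
Hypothesis n2 : (2 <= n)%N.
Local Notation I := 'I_n.+1.
Local Notation E := 'rV[R]_n.+1.
Implicit Types (A B D : {set I}) (W b c g M : {set {set I}}) (N F G T : {set {set {set I}}}).
Implicit Types (x y z u v : E) (r : I -> nat).

Lemma simplex_polytope A : A != finset.set0 -> polytope (@simplex R n.+1 A).
Proof.
move=> /set0Pn[i iA]; exists [seq delta_mx 0 j | j <- enum A]; split.
  by move: iA; rewrite -mem_enum; case: (enum A).
congr convhull; apply/seteqP; split=> x /=.
  by case=> j jA <-; apply/mapP; exists j => //; rewrite mem_enum.
by case/mapP=> j; rewrite mem_enum => jA ->; exists j.
Qed.

Lemma Nsub_polytope b : b \in B1 n -> polytope (@Nsub R n b).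
Proof.
move=> bB; pose V := (vertices (@PBsub R n b) `\` vertices (Fsub b))%classic.
(* A finite list containing all vertices of [PBsub b], from which those outside the removed face are
   filtered. *)
pose s := [seq bvertex R b (f : {ffun {set I} -> I}) | f <- enum {: {ffun {set I} -> I}}].
have sE : V = [set` [seq v <- s | `[< V v >]]]%classic.
  apply/seteqP; split=> v /=; last by rewrite mem_filter => /andP[/asboolP].
  move=> Vv; rewrite mem_filter; apply/andP; split; first exact/asboolP.
  have [f _ vE] := vertices_PBsub Vv.1.
  apply/mapP; exists [ffun B => f B]; first by rewrite mem_enum.
  by rewrite vE; apply: eq_bigr => B _; rewrite ffunE.
exists [seq v <- s | `[< V v >]]; split; last by rewrite /Nsub -/V {1}sE.
have /set0Pn[A Ab] := B1_neq0 bB; have [A0 AT] := (B1_flag bB).1 _ Ab.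
have [|r [rI _ nu]] := flag_order_avoiding (flag0 n) A0 AT; first by rewrite inE.
have : V (bvertex R b (first r)).
  by apply: Nsub_first => //; apply/forall_inPn; exists A.
by rewrite {1}sE /=; case: [seq v <- s | `[< V v >]].
Qed.

Lemma summand_polytope b : b \in B1 n -> polytope (@summand R n b).
Proof.
move=> bB; rewrite /summand; case: (boolP (#|b| == 1)) => [/cards1P[A bA]|_].
  have Ab : A \in b by rewrite bA inE.
  rewrite bA /finset.cover big_set1; apply: simplex_polytope.
  by have [] := (B1_flag bB).1 _ Ab.
exact: Nsub_polytope.
Qed.

Lemma low0_additive g c : low0 g c = (\sum_(A in c) low0 g [set A])%N.
Proof.
rewrite /low0; case: (#|g| == 1); last by apply: eq_bigr => A _; rewrite big_set1.
rewrite -sum1_card big_mkcond [RHS]big_mkcond; apply: eq_bigr => A _; rewrite inE.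
case: (A \in c) => //=; case: (boolP (_ \subset A)) => gA.
  by rewrite (_ : [set D in _ | _] = [set A]) ?cards1 //; apply/setP => D; rewrite !inE;
    case: eqP => // ->.
by rewrite (_ : [set D in _ | _] = finset.set0) ?cards0 //; apply/setP => D; rewrite !inE;
  case: eqP => // ->; apply: negbTE.
Qed.

(** Supplies the hypothesis [hb0] of the truncation: [low0] is additive in its second argument, and
    by assumption no unit of [low] is counted, neither at [b] nor at its points. *)
Lemma support_additive T b : T \subset A2 n ->
  (forall g, g \in A1 n :|: T -> g \subset b -> (#|g| <= 1)%N) ->
  support R T b = \sum_(A in b) support R T [set A].
Proof.
move=> TA hT; rewrite /support exchange_big /=; apply: eq_bigr => g gG.
have low_small c : (g \subset c -> (#|g| <= 1)%N) -> low g c = low0 g c.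
  move=> gc; rewrite /low (_ : (_ && _) = false) ?addn0 //.
  apply/negP => /andP[/gc g1]; apply/negP; rewrite negbK eqn_leq g1 card_gt0.
  apply: B1_neq0; case/setUP: gG => [/A1_sub_B1 //|/(subsetP TA)].
  by rewrite inE => /andP[].
rewrite low_small ?low0_additive ?natr_sum => [|/hT -> //]; apply: eq_bigr => A _.
by rewrite low_small // => /subset_leq_card; rewrite cards1.
Qed.

Lemma partial_sum_realised T : T \subset A2 n -> good (A1 n :|: T) ->
  nested_realised (A1 n :|: T) (support R T) (poly (A1 n :|: T) (support R T) (sum_csum R T)).
Proof.
move=> TA gG N nN; have [x Sx xN] := partial_sum_nested_realised R TA gG n2 nN.
by exists x => //; apply: partial_sum_poly.
Qed.

Lemma partial_sumE T : T \subset A2 n -> good (A1 n :|: T) ->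
  @partial_sum R n T = poly (A1 n :|: T) (support R T) (sum_csum R T).
Proof.
move=> TA gG; apply: (convex_eq_poly gG (partial_sum_realised TA gG)).
- exact: partial_sum_convex.
- by move=> x; apply: partial_sum_poly.
exact: partial_sum_nested_realised.
Qed.

Lemma partial_sumU1 T b : b \notin A1 n :|: T ->
  @partial_sum R n (b |: T) = msum (@partial_sum R n T) (@summand R n b).
Proof.
move=> bG; rewrite /partial_sum finset.setUCA big_setU1 //= -msumA.
by congr msum; rewrite msumC.
Qed.

(** Generalised over the set [T] of families already added, so that induction on the list of the
    remaining ones applies. *)
Lemma partial_sum_truncators T (l : seq {set {set I}}) : T \subset A2 n ->
  (forall b, b \in A2 n -> (b \in T) || (b \in l)) ->
  (forall b, b \in l -> (b \in A2 n) && (b \notin T)) ->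
  (forall b c, b \in T -> c \in l -> (#|c| <= #|b|)%N) ->
  uniq l -> pairwise (fun b c : {set {set I}} => (#|c| <= #|b|)%N) l ->
  truncator_set (@partial_sum R n T) (map (@summand R n) l).
Proof.
have gT T' (l' : seq {set {set I}}) : T' \subset A2 n ->
    (forall b, b \in A2 n -> (b \in T') || (b \in l')) ->
    (forall b c, b \in T' -> c \in l' -> (#|c| <= #|b|)%N) -> good (A1 n :|: T').
  move=> TA cov le; apply: good_A1U => // b c bT cA lt.
  by case/orP: (cov _ cA) => // cl; have := le _ _ bT cl; rewrite leqNgt lt.
elim: l T => [|b l IH] T TA cov lT le //= /andP[bl ul] /andP[/allP hb pl].
have /andP[bA bT] := lT b (mem_head _ _).
have gG := gT T (b :: l) TA cov le.
have TA' : b |: T \subset A2 n by rewrite finset.subUset finset.sub1set bA.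
have cov' c : c \in A2 n -> (c \in b |: T) || (c \in l).
  by move=> /cov; rewrite !inE; case/or3P=> ->; rewrite ?orbT.
have le' c d : c \in b |: T -> d \in l -> (#|d| <= #|c|)%N.
  move=> /setU1P[->|cT] dl; first exact: hb.
  by apply: le => //; rewrite inE dl orbT.
have gG' := gT _ l TA' cov' le'.
have bG : b \notin A1 n :|: T.
  by rewrite inE negb_or bT andbT; move: bA; rewrite finset.in_setD => /andP[].
have GE : A1 n :|: (b |: T) = b |: (A1 n :|: T) by rewrite finset.setUCA.
(* A family of [T] is at least as large as [b], so inside [b] it could only be [b], which is not yet
   in [T]. *)
have minb g : g \in A1 n :|: T -> g \subset b -> (#|g| <= 1)%N.
  case/setUP=> [|gT' gb]; first by rewrite inE => /andP[_ /eqP ->].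
  have /eqP e : g == b by rewrite eqEcard gb le ?mem_head.
  by move: bT; rewrite -e gT'.
split; last first.
  rewrite -partial_sumU1 //; apply: IH => // c cl.
  have := lT c; rewrite inE cl orbT => /(_ isT) /andP[-> cT] /=.
  by rewrite !inE negb_or cT andbT; apply: contraNneq bl => <-.
have gGb : good (b |: (A1 n :|: T)) by rewrite -GE.
have b1 : (1 < #|b|)%N by move: bA; rewrite A2E => /andP[].
have [U [Tr [tr polTr fanTr]]] := truncation_exists (tot := sum_csum R T) gG gGb bG b1 minb
  (support_additive TA minb) (partial_sum_realised TA gG).
exists U, Tr; rewrite -partial_sumU1 // !partial_sumE //; split=> //.
have real' := partial_sum_realised TA' gG'.
split=> //; first exact: (poly_polytope gG' real').
by rewrite (normal_fan_poly gG' real') fanTr GE.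
Qed.

Lemma PA1E : PA1 R n = @partial_sum R n (A2 n).
Proof.
rewrite /PA1 /partial_sum -msumA; congr msum.
rewrite A1U_A2 [RHS](big_setID (A1 n)) /=.
have -> : B1 n :&: A1 n = A1 n.
  by apply/finset.setIidPr/subsetP => b /A1_sub_B1.
congr msum; apply: eq_bigr => b; first by rewrite inE /summand => /andP[_ ->].
by rewrite -/(A2 n) A2E /summand => /andP[_ /gtn_eqF ->].
Qed.

End Truncators.

Theorem theorem5p18 (R : realType) (n : nat) (hn : (2 <= n)%N) :
  Minkowski_realisation (C1 n) (B1 n) (C n) (PA1 R n) /\
  normally_equivalent (PA1 R n) (PA R n).
Proof.
have gB := good_B1 n.
have A12 := A1U_A2 n.
have gA : good (A1 n :|: A2 n) by rewrite A12.
have real := partial_sum_realised R hn (subxx (A2 n)) gA.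
have E := partial_sumE R hn (subxx (A2 n)) gA.
rewrite A12 in real E.
have realPA := PA_nested_realised R hn.
rewrite PA1E E; split; last first.
  split; [exact: (poly_polytope gB real)|rewrite PA_poly //; exact: (poly_polytope gB realPA)|].
  by rewrite PA_poly // (normal_fan_poly gB real) (normal_fan_poly gB realPA).
split; [exact: B1_building|by []|exact: (poly_polytope gB real)|exact: (poly_dim real)|].
split; first exact: (poly_realises gB real).
exists (@summand R n); split.
- by move=> b; apply: summand_polytope.
- by rewrite -E /partial_sum A12.
move=> m x xI xE xle.
have -> : [seq @summand R n (x i) | i <- enum 'I_m] = map (@summand R n) [seq x i | i <- enum 'I_m].
  by elim: (enum _) => //= i s ->.
have -> : msum (simplex [set: 'I_n.+1]%SET)
    (\big[@msum R n.+1/[set 0]%classic]_(b in singletons_of (B1 n)) @summand R n b) =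
    @partial_sum R n finset.set0.
  by rewrite /partial_sum finset.setU0.
have mem_x b : (b \in [seq x i | i <- enum 'I_m]) = (b \in A2 n).
  rewrite /A2 /A1 -xE; apply/mapP/imsetP => -[i]; first by exists i.
  by exists i; rewrite ?mem_enum.
apply: partial_sum_truncators => //.
- exact: finset.sub0set.
- by move=> b bA; rewrite mem_x bA orbT.
- by move=> b; rewrite mem_x => ->; rewrite inE.
- by move=> b c; rewrite inE.
- by rewrite map_inj_uniq // enum_uniq.
rewrite pairwise_map; have : pairwise ltn (map val (enum 'I_m)).
  by rewrite val_enum_ord -sorted_pairwise; [exact: iota_ltn_sorted|exact: ltn_trans].
by rewrite pairwise_map; apply: sub_pairwise => i j; apply: xle.
Qed.
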